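(* Let $p>1$ and let $u$ be a solution, with finite energy $E$, to the defocusing wave equation $u_{tt}-u_{xx}=-|u|^{p-1}u$ on $\mathbb{R}_x\times\mathbb{R}_t$. Then for any given constant $c\in(0,1)$ we have \[ \lim_{t\to+\infty}\int_{-\infty}^{ct}\left(\frac14|u_x(x,t)-u_t(x,t)|^2+\frac{1}{2(p+1)}|u(x,t)|^{p+1}\right)dx=0, \] \[ \lim_{t\to+\infty}\int_{-ct}^{\infty}\left(\frac14|u_x(x,t)+u_t(x,t)|^2+\frac{1}{2(p+1)}|u(x,t)|^{p+1}\right)dx=0. \] As a consequence, \[ \lim_{t\to\pm\infty}\int_{-c|t|}^{c|t|}\left(\frac12|u_x(x,t)|^2+\frac12|u_t(x,t)|^2+\frac{1}{p+1}|u(x,t)|^{p+1}\right)dx=0. \]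
   Context: Functions are real-valued. A solution with finite energy to the defocusing equation $u_{tt}-u_{xx}=-|u|^{p-1}u$ with initial data $(u(\cdot,0),u_t(\cdot,0))=(u_0,u_1)\in(\dot H^1(\mathbb{R})\cap L^{p+1}(\mathbb{R}))\times L^2(\mathbb{R})$ means the unique global solution $u\in C(\mathbb{R}_x\times\mathbb{R}_t)$ with $(u(\cdot,t),u_t(\cdot,t))\in C(\mathbb{R}_t;(\dot H^1\cap L^{p+1})\times L^2)$ satisfying D'Alembert's formula \[ u(x,t)=\tfrac12\Big[u_0(x-t)+u_0(x+t)+\int_{x-t}^{x+t}u_1(x')\,dx'\Big]-\tfrac12\int_0^t\int_{x-t+t'}^{x+t-t'}|u|^{p-1}u(x',t')\,dx'\,dt'. \] The energy $E=\int_{\mathbb{R}}\big(\frac12|u_x(x,t)|^2+\frac12|u_t(x,t)|^2+\frac1{p+1}|u(x,t)|^{p+1}\big)dx$ is finite and constant in $t$. *)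

(* Defs.v *)
From HB Require Import structures.
From mathcomp Require Import all_boot all_order all_algebra.
From mathcomp Require Import all_classical all_reals all_analysis.
Set Implicit Arguments.
Unset Strict Implicit.
Unset Printing Implicit Defensive.
Import Order.TTheory GRing.Theory Num.Theory.
Import numFieldNormedType.Exports.
Local Open Scope classical_set_scope.
Local Open Scope ring_scope.

(* The integral from a to b for arbitrary a and b, with the sign change when
   b < a; D'Alembert's formula needs it for negative times. *)
Definition oriented_integral (R : realType) (a b : R) (f : R -> R) : R :=
  if a <= b then \int[@lebesgue_measure R]_(x in `[a, b]) f x
  else - \int[@lebesgue_measure R]_(x in `[b, a]) f x.

Definition test_function (R : realType) (phi : R -> R) : Prop :=
  (forall (n : nat) (x : R), derivable (phi^`(n))%classic x 1) /\
  compact (closure [set x | phi x != 0]).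

Definition weak_derivative (R : realType) (f g : R -> R) : Prop :=
  [/\ locally_integrable [set: R] f, locally_integrable [set: R] g &
      forall phi : R -> R, test_function phi ->
        \int[@lebesgue_measure R]_x (f x * (phi^`())%classic x) =
        - \int[@lebesgue_measure R]_x (g x * phi x)].

Definition Hdot1 (R : realType) (f : R -> R) : Prop :=
  exists2 g : R -> R, weak_derivative f g &
    g \in Lfun (@lebesgue_measure R) 2%:E.

(* The map t |-> v(., t) belongs to C(R_t; L^q(R_x)). *)
Definition continuous_in_Lp (R : realType) (q : R) (v : R -> R -> R) : Prop :=
  (forall t : R, v^~ t \in Lfun (@lebesgue_measure R) q%:E) /\
  (forall t0 : R,
    Lnorm (@lebesgue_measure R) q%:E (fun x => (v x t - v x t0)%:E)
      @[t --> t0] --> 0%E).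

(* w is the time derivative of v, where v is regarded as the curve
   t |-> v(., t) in the space of distributions on R_x. *)
Definition distributional_time_derivative (R : realType) (v w : R -> R -> R)
    : Prop :=
  forall phi : R -> R, test_function phi -> forall t : R,
    is_derive t (1 : R)
      (fun s : R => \int[@lebesgue_measure R]_x (v x s * phi x))
      (\int[@lebesgue_measure R]_x (w x t * phi x)).

(* Functions of (x, t) are curried, space variable first. The functions ux and
   ut are representatives, at every time t, of the classes u_x(., t) and
   u_t(., t) in L^2. *)
Record finite_energy_solution (R : realType) (p : R) (u0 u1 : R -> R)
    (u ux ut : R -> R -> R) : Prop := FiniteEnergySolution {
  data_Hdot1 : Hdot1 u0;
  data_Lp : u0 \in Lfun (@lebesgue_measure R) (p + 1)%:E;
  data_L2 : u1 \in Lfun (@lebesgue_measure R) 2%:E;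
  sol_continuous : continuous (fun z : R * R => u z.1 z.2);
  sol_ux : forall t : R, weak_derivative (u^~ t) (ux^~ t);
  sol_ut : distributional_time_derivative u ut;
  sol_ux_L2 : continuous_in_Lp 2 ux;
  sol_Lp : continuous_in_Lp (p + 1) u;
  sol_ut_L2 : continuous_in_Lp 2 ut;
  sol_init0 : forall x : R, u x 0 = u0 x;
  sol_init1 : {ae @lebesgue_measure R, forall x : R, ut x 0 = u1 x};
  sol_dalembert : forall x t : R,
    u x t =
      2^-1 * (u0 (x - t) + u0 (x + t) + oriented_integral (x - t) (x + t) u1)
      - 2^-1 * oriented_integral 0 t (fun s : R =>
          oriented_integral (x - t + s) (x + t - s)
            (fun y : R => `|u y s| `^ (p - 1) * u y s))
}.

(* Main.v *)
Require Import Defs.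
From HB Require Import structures.
From mathcomp Require Import all_boot all_order all_algebra.
From mathcomp Require Import all_classical all_reals all_analysis.
From mathcomp Require Import ring lra.
From mathcomp Require Import measurable_realfun.

(** Put [xi = t + x], [eta = t - x], [N u = |u|^(p-1) u],
    [F u = |u|^(p+1) / (p+1)], [a = u_t + u_x] and [b = u_t - u_x]. D'Alembert's
    formula says that [a] has derivative [- N u] along the lines on which [xi]
    is constant and is the derivative of [u] along the lines on which [eta] is
    constant; the same holds for [b] with the two families exchanged (record
    [char_solution]). Everything is derived from this first order system, in
    which only absolute continuity along lines is needed. The integrand of the
    second limit is [e = a^2/4 + F/2], that of the first is its mirror image
    under [x -> - x], and their sum is the energy density; so it suffices to
    treat [e] for [t -> +oo], then to reflect in space and to reverse time.

    For a weight [W (xi, eta)] the product rule along the two families of lines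
    and Fubini's theorem give ([energy_identity])

      d/dt int W e = int (W_eta a^2/2 + W_xi F).

    With [W = clip (xi / T)], which is at least [1 - c] where [x >= - c T] and
    [t = T], this bounds the energy of [e] in [[- c T, +oo[] at time [T] by

      (1 - c)^-1 (int clip (x/T) e (x, 0) dx + T^-1 int int_(0 < xi <= T) F).

    The first term tends to zero since the initial energy is finite. In the
    second one the strip [0 < xi <= T] is cut into four pieces
    ([strip_pointwise]). Near the two characteristics, where [xi <= d T] or
    [|eta| <= d T], the flux bound [flux_bound] gives [O (d)]. Where
    [eta <= - d T], outside the light cone, finite speed of propagation bounds
    the energy by the tail of the initial energy ([exterior_bound]). Where
    [xi, eta > d T], the factor [T^-1] is at most [27/d^2] times
    [xi eta / rho^3] with [rho^2 = 1 + xi^2 + eta^2], and times later than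
    [d T] only are involved; this piece tends to zero because of the Morawetz
    estimate ([integral_morawetz_density])

      int_0^oo int xi_+ eta_+ / rho^3 F dx dt < oo.

    Letting [T] tend to infinity and then [d] to zero gives [energy_limit].

    The Morawetz estimate comes from the weights [eta/rho - 1] on [e] and
    [xi/rho - 1] on its mirror image, together with the term
    [- xi_+ eta_+ / rho^3 u a]. The derivative of the sum of the three integrals
    dominates [(p - 1) xi_+ eta_+ / rho^3 F] up to an error
    [4 rho^-2 |u a|] in the light cone, which is integrable in time because
    [u^2 <= 1 + (p + 1) F] and the section of the cone at time [t] has length
    [2 t].

    It remains to pass from the solution, whose derivatives are only classes in
    [L^2], to the characteristic system. There [a] is defined by Duhamel's
    formula, [a (x, t) = alpha (x + t) - int_0^t N u (x + t - s, s) ds] with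
    [alpha = u_t (., 0) + u_x (., 0)]; a du Bois-Reymond argument
    ([weak_derivative_primitive]) turns d'Alembert's formula into the
    characteristic system for it. That [a (., t) = u_t (., t) + u_x (., t)]
    almost everywhere follows by differentiating [int u (x + h, t + h) phi (x) dx]
    at [h = 0] in two ways, through [a] and through the distributional
    derivatives ([right_identification]). *)

Set Implicit Arguments.
Unset Strict Implicit.
Unset Printing Implicit Defensive.
Import Order.TTheory GRing.Theory Num.Theory.
Import numFieldNormedType.Exports.
Local Open Scope classical_set_scope.
Local Open Scope ring_scope.

(** * Integrals and affine changes of variable *)

Section Rintegrable_helpers.
Context d (T : measurableType d) (R : realType) (mu : {measure set T -> \bar R}).
Variables (D : set T) (mD : measurable D).
Implicit Types f g h : T -> R.

Lemma integrable_EFinD f g : mu.-integrable D (EFin \o f) ->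
  mu.-integrable D (EFin \o g) -> mu.-integrable D (EFin \o (fun x => f x + g x)).
Proof. by move=> i1 i2; apply: eq_integrable (integrableD mD i1 i2) => // x _. Qed.

Lemma integrable_EFinB f g : mu.-integrable D (EFin \o f) ->
  mu.-integrable D (EFin \o g) -> mu.-integrable D (EFin \o (fun x => f x - g x)).
Proof. by move=> i1 i2; apply: eq_integrable (integrableB mD i1 i2) => // x _. Qed.

Lemma integrable_EFinZ (c : R) f : mu.-integrable D (EFin \o f) ->
  mu.-integrable D (EFin \o (fun x => c * f x)).
Proof.
by move=> i1; apply: eq_integrable (integrableZl mD c i1) => // x _; rewrite /= EFinM.
Qed.

Lemma integrable_EFin_le f g : measurable_fun D f ->
  (forall x, D x -> `|f x| <= g x) ->
  mu.-integrable D (EFin \o g) -> mu.-integrable D (EFin \o f).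
Proof.
move=> mf fg; apply: le_integrable => //; first exact/measurable_EFinP.
by move=> x Dx /=; rewrite lee_fin (le_trans (fg _ Dx))// ler_norm.
Qed.

Lemma integrable_EFinM (K : R) h f : measurable_fun D h ->
  (forall x, D x -> `|h x| <= K) -> mu.-integrable D (EFin \o f) ->
  mu.-integrable D (EFin \o (fun x => h x * f x)).
Proof.
move=> mh hK i1; have mf : measurable_fun D f.
  exact/measurable_EFinP/(measurable_int mu).
apply: (@integrable_EFin_le _ (fun x => `|K| * `|f x|)).
- exact: measurable_funM.
- by move=> x Dx; rewrite normrM ler_wpM2r// (le_trans (hK _ Dx))// ler_norm.
- by apply: integrable_EFinZ; exact: integrable_norm.
Qed.

End Rintegrable_helpers.

Section affine.
Context {R : realType}.
Notation mu := (@lebesgue_measure R).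

Lemma measurable_affine (k c : R) :
  measurable_fun [set: R] (fun x => k * x + c).
Proof. by apply: measurable_funD => //; apply: measurable_funM. Qed.

(** Packaging the rescaled image measure as an abstract measure that agrees
    with Lebesgue measure lets the change of variables below go through
    extensionality of the integral in its measure; the agreement is checked on
    half-open intervals. *)
Lemma pushforward_affine (k c : R) : k != 0 ->
  exists m : {measure set (measurableTypeR R) -> \bar R},
    (forall A, measurable A -> m A = mu A) /\
    forall f : R -> \bar R, measurable_fun setT f -> (forall x, 0 <= f x)%E ->
      (\int[m]_x f x = `|k|%:E * \int[mu]_x f (k * x + c)%R)%E.
Proof.
move=> k0; pose phi : R -> measurableTypeR R := fun x => k * x + c.
have mphi : measurable_fun setT phi by exact: measurable_affine.
have [pm [pmE pmI]] : exists m : {measure set (measurableTypeR R) -> \bar R},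
    (forall A, m A = mu (phi @^-1` A)) /\
    (forall f : R -> \bar R, measurable_fun setT f -> (forall x, 0 <= f x)%E ->
      \int[m]_x f x = \int[mu]_x f (phi x))%E.
  unshelve eexists (pushforward mu phi); first exact: mphi.
  by split=> // f mf f0; rewrite ge0_integral_pushforward.
exists (mscale (NngNum (normr_ge0 k)) pm); split; last first.
  by move=> f mf f0; rewrite ge0_integral_mscale//= pmI.
move=> A mA; apply/esym/lebesgue_measure_unique => //.
move=> _ [[a b]] _ <- /=; rewrite -[RHS]/(`|k|%:E * pm `]a, b]%classic)%E pmE.
have [k_gt0|k_le0] := ltP 0 k.
  have -> : phi @^-1` `]a, b]%classic = `](a - c) / k, (b - c) / k]%classic.
    apply/seteqP; split => x /=; rewrite /phi !in_itv/= ltr_pdivrMr// ler_pdivlMr//;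
      rewrite (mulrC x) ltrBlDr lerBrDr//.
  rewrite [LHS]lebesgue_measure_itv [in LHS]/= lebesgue_measure_itv/=.
  rewrite gtr0_norm// !lte_fin ltr_pM2r ?invr_gt0// ltrD2r.
  case: ifPn => // _; last by rewrite mule0.
  by rewrite -!EFinB -EFinM; congr EFin; field.
have {k_le0} k_lt0 : k < 0 by rewrite lt_neqAle k0.
have -> : phi @^-1` `]a, b]%classic = `[(b - c) / k, (a - c) / k[%classic.
  apply/seteqP; split => x /=; rewrite /phi !in_itv/= ltr_ndivlMr// ler_ndivrMr//;
    rewrite (mulrC x) ltrBlDr lerBrDr//; by rewrite andbC.
rewrite [LHS]lebesgue_measure_itv [in LHS]/= lebesgue_measure_itv/=.
rewrite ltr0_norm// !lte_fin ltr_nM2r ?invr_lt0// ltrD2r.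
case: ifPn => // _; last by rewrite mule0.
by rewrite -!EFinB -EFinM; congr EFin; field.
Qed.

Lemma ge0_integral_affine (k c : R) (f : R -> \bar R) : k != 0 ->
  measurable_fun setT f -> (forall x, 0 <= f x)%E ->
  (\int[mu]_x f x = `|k|%:E * \int[mu]_x f (k * x + c)%R)%E.
Proof.
move=> k0 mf f0; have [m [mE <-//]] := pushforward_affine c k0.
by apply: eq_measure_integral => A mA _; rewrite mE.
Qed.

Lemma integrable_affine (k c : R) (f : R -> \bar R) : k != 0 ->
  mu.-integrable setT f -> mu.-integrable setT (fun x => f (k * x + c)).
Proof.
move=> k0 /integrableP[mf foo]; apply/integrableP; split.
  exact: (measurableT_comp mf (measurable_affine k c)).
set J := (X in (X < +oo)%E); have : (0 <= J)%E by apply: integral_ge0.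
move: foo; rewrite (ge0_integral_affine c k0)//=; last exact: measurableT_comp.
rewrite -/J; case: J => [r _ _|+ _|//]; first by rewrite ltry.
by rewrite mulry gtr0_sg ?normr_gt0// mul1e.
Qed.

Lemma integral_affine (k c : R) (f : R -> \bar R) : k != 0 ->
  mu.-integrable setT f ->
  (\int[mu]_x f x = `|k|%:E * \int[mu]_x f (k * x + c)%R)%E.
Proof.
move=> k0 intf; have mf := measurable_int _ intf.
rewrite integralE [in RHS]integralE.
rewrite (ge0_integral_affine c k0 (measurable_funepos mf))//.
rewrite (ge0_integral_affine c k0 (measurable_funeneg mf))//.
rewrite -muleBr; [|by []|].
  by congr (_ * (_ - _))%E; apply: eq_integral => x _; rewrite ?funeposE ?funenegE.
apply: fin_num_adde_defl; rewrite fin_numN.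
have := integrable_neg_fin_num measurableT (integrable_affine c k0 intf).
by rewrite (funeneg_comp f (fun x => k * x + c)).
Qed.

Lemma mem_affine_itv (k c a b x : R) : 0 < k ->
  ((k * x + c)%R \in `[k * a + c, k * b + c]) = (x \in `[a, b]).
Proof. by move=> k0; rewrite !in_itv/= !lerD2r !ler_pM2l. Qed.

Lemma integrable_affine_itv (k c a b : R) (f : R -> R) : 0 < k ->
  mu.-integrable `[k * a + c, k * b + c] (EFin \o f) ->
  mu.-integrable `[a, b] (fun x => (f (k * x + c))%:E).
Proof.
move=> k0 /integrable_mkcond => /(_ (measurable_itv _)) /(integrable_affine c (lt0r_neq0 k0)) h.
apply/integrable_mkcond => //; apply: eq_integrable h => // x _.
rewrite !patchE !mem_setE.
by rewrite mem_affine_itv.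
Qed.

Lemma Rintegral_affine_itv (k c a b : R) (f : R -> R) : 0 < k ->
  mu.-integrable `[k * a + c, k * b + c] (EFin \o f) ->
  \int[mu]_(x in `[a, b]) (k * f (k * x + c)) =
  \int[mu]_(x in `[k * a + c, k * b + c]) f x.
Proof.
move=> k0 intf; rewrite RintegralZl//; last exact: integrable_affine_itv.
have := intf; move=> /integrable_mkcond => /(_ (measurable_itv _)) intf'.
have := integral_affine c (lt0r_neq0 k0) intf'.
rewrite -integral_mkcond /Rintegral => ->; rewrite gtr0_norm// fineM//; last first.
  by apply: integrable_fin_num => //; apply: integrable_affine => //; rewrite gt_eqF.
congr (_ * fine _).
rewrite [LHS]integral_mkcond; apply: eq_integral => x _.
by rewrite !patchE !mem_setE mem_affine_itv.
Qed.

Lemma Rintegral_itv_cat (f : R -> R) (a b c : R) : a <= b -> b <= c ->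
  mu.-integrable `[a, c] (EFin \o f) ->
  \int[mu]_(x in `[a, c]) f x =
  \int[mu]_(x in `[a, b]) f x + \int[mu]_(x in `[b, c]) f x.
Proof.
move=> ab bc intf.
have : \int[mu]_(x in `[a, c]) f x - \int[mu]_(x in `[a, b]) f x =
    \int[mu]_(x in `]b, c]) f x by apply: Rintegral_itvB.
rewrite Rintegral_itv_obnd_cbnd; first by move=> <-; rewrite addrC subrK.
apply: integrableS intf => //; apply: subset_itvr.
by rewrite bnd_simp.
Qed.

End affine.

(** * Absolutely continuous functions on a segment *)

Section absolute_continuity.
Context {R : realType}.
Notation mu := (@lebesgue_measure R).
Implicit Types (f g h : R -> R) (l r s t e : R).

(** Absolute continuity of [f] together with a chosen density [g]; the
    functions met below along characteristics come with an explicit density,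
    never with a pointwise derivative. *)
Definition ac_on l r f g :=
  mu.-integrable `[l, r] (EFin \o g) /\
  forall s t, l <= s -> s <= t -> t <= r ->
    f t - f s = \int[mu]_(x in `[s, t]) g x.

Lemma integrable_sub_itv l r s t g : l <= s -> t <= r ->
  mu.-integrable `[l, r] (EFin \o g) -> mu.-integrable `[s, t] (EFin \o g).
Proof.
by move=> ls tr; apply: integrableS => //; apply: subset_itv; rewrite bnd_simp.
Qed.

Lemma integrable_normr_itv l r g :
  mu.-integrable `[l, r] (EFin \o g) ->
  mu.-integrable `[l, r] (EFin \o (fun x => `|g x|)).
Proof. exact: integrable_norm. Qed.

Lemma heine_cantor h l r e : continuous h -> 0 < e ->
  exists2 d, 0 < d & forall s t, l <= s <= r -> `|t - s| < d -> `|h t - h s| < e.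
Proof.
move=> ch e0.
have /compact_near_coveringP/(_ R (0^'+)
    (fun d s => forall t, `|t - s| < d -> `|h t - h s| < e)) :=
  @segment_compact R l r.
have e20 : 0 < e / 2 by rewrite divr_gt0.
case.
- move=> x _; have /cvgrPdist_lt/(_ _ e20)/nbhs_ballP[d /= d0 hd] := ch x.
  exists (ball x (d / 2), [set y | 0 < y /\ y < d / 2]) => /=.
    split; first by apply/nbhs_ballP; exists (d / 2) => //=; rewrite divr_gt0.
    near=> y; split=> //; near: y; apply: nbhs_right_lt; by rewrite divr_gt0.
  move=> [s d'] /= [xs [d'0 d'd]] t ts.
  have hs := hd s; have ht := hd t.
  rewrite -(subrK (h x) (h t)) -addrA (splitr e); apply: (le_lt_trans (ler_normD _ _)).
  rewrite ltrD//.
    rewrite distrC; apply: ht; rewrite /ball/=.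
    rewrite -(subrK s x) -addrA; apply: (le_lt_trans (ler_normD _ _)).
    by rewrite (splitr d) ltrD// distrC (lt_trans ts).
  apply: hs; apply: le_ball xs.
  by rewrite ler_pdivrMr// ler_peMr ?(ltW d0)// ler1n.
- move=> d /= d0 H; exists (d / 2); first by rewrite divr_gt0.
  move=> s t slr; have Hs : (`[l, r]%classic : set R) s by rewrite /= in_itv.
  apply: (H (d / 2) _ _ s Hs) => //; last by rewrite divr_gt0.
  by rewrite /= sub0r normrN gtr0_norm ?divr_gt0// ltr_pdivrMr// ltr_pMr// ltr1n.
Unshelve. all: by end_near. Qed.

(** Summing local errors over a fine subdivision: this is how both the product
    rule and the chain rule below are proved. *)
Lemma ac_on_of_local l r f g m :
  mu.-integrable `[l, r] (EFin \o g) -> mu.-integrable `[l, r] (EFin \o m) ->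
  (forall x, l <= x <= r -> 0 <= m x) ->
  (forall e, 0 < e -> exists2 d, 0 < d & forall s t, l <= s -> s <= t -> t <= r ->
    t - s < d -> `|f t - f s - \int[mu]_(x in `[s, t]) g x|
                 <= e * \int[mu]_(x in `[s, t]) m x) ->
  ac_on l r f g.
Proof.
move=> ig im m0 H; split => // s t ls st tr; apply/eqP; rewrite -subr_eq0 -normr_le0.
set M := \int[mu]_(x in `[s, t]) m x.
have M0 : 0 <= M.
  apply: Rintegral_ge0 => x /=; rewrite in_itv/= => /andP[sx xt].
  by rewrite m0// (le_trans ls)//= (le_trans xt).
suff K e : 0 < e -> `|f t - f s - \int[mu]_(x in `[s, t]) g x| <= e * M.
  rewrite leNgt; apply/negP => D0.
  have := K (`|f t - f s - \int[mu]_(x in `[s, t]) g x| / (M + 1) / 2).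
  have M1 : 0 < M + 1 by rewrite ltr_wpDl.
  move=> /(_ ltac:(by rewrite !divr_gt0)); apply/negP; rewrite -ltNge.
  set D := `|f t - f s - _| in D0 *; rewrite -[D / _ / 2]mulrA -invfM mulrAC ltr_pdivrMr ?mulr_gt0//.
  by rewrite ltr_pM2l//; lra.
move=> e0; have [d d0 Hd] := H _ e0.
rewrite {M0}/M.
have K n : forall s t, l <= s -> s <= t -> t <= r -> t - s <= n%:R * (d / 2) ->
  `|f t - f s - \int[mu]_(x in `[s, t]) g x| <= e * \int[mu]_(x in `[s, t]) m x.
  clear s t ls st tr; elim: n => [|n IH] s t ls st tr.
    by rewrite mul0r => ts; apply: Hd => //; exact: le_lt_trans d0.
  have [ts _|dts tsn] := ltP (t - s) d; first exact: Hd.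
  have tm : s <= t - d / 2 by lra.
  have ig' : mu.-integrable `[s, t] (EFin \o g) by exact: integrable_sub_itv ig.
  have im' : mu.-integrable `[s, t] (EFin \o m) by exact: integrable_sub_itv im.
  rewrite (@Rintegral_itv_cat _ g s (t - d / 2) t)//; last by lra.
  rewrite (@Rintegral_itv_cat _ m s (t - d / 2) t)//; last by lra.
  rewrite mulrDr.
  rewrite [X in `|X|](_ : _ =
    (f (t - d / 2) - f s - \int[mu]_(x in `[s, t - d / 2]) g x) +
    (f t - f (t - d / 2) - \int[mu]_(x in `[t - d / 2, t]) g x)); last by ring.
  apply: (le_trans (ler_normD _ _)); apply: lerD.
    apply: IH => //; first lra.
    move: tsn; rewrite -natr1 mulrDl mul1r; lra.
  by apply: Hd => //; lra.
have d20 : 0 < d / 2 by lra.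
apply: (K (Num.bound ((t - s) / (d / 2)))) => //.
rewrite -ler_pdivrMr//; apply/ltW/archi_boundP.
by rewrite divr_ge0// ?subr_ge0// ltW.
Qed.

Lemma ac_on_unif l r f g e : ac_on l r f g -> 0 < e ->
  exists2 d, 0 < d & forall s t, l <= s -> s <= t -> t <= r ->
    t - s < d -> `|f t - f s| < e.
Proof.
move=> [ig fE] e0.
have ig' : mu.-integrable setT (EFin \o (g \_ `[l, r])).
  by rewrite -restrict_EFin -integrable_mkcond.
have [d [d0 Hd]] := integral_normr_continuous ig' e0.
exists d => // s t ls st tr tsd.
rewrite fE//; apply: (le_lt_trans (le_normr_Rintegral _ _)) => //.
  exact: integrable_sub_itv ig.
have -> : \int[mu]_(x in `[s, t]) `|g x| = \int[mu]_(x in `[s, t]) `|(g \_ `[l, r]) x|.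
  apply: eq_Rintegral => x; rewrite inE/= in_itv/= => /andP[sx xt].
  by rewrite patchE mem_set//= in_itv/= (le_trans ls)//= (le_trans xt).
apply: Hd => //.
have : (mu `[s, t]%classic <= (t - s)%:E)%E.
  by rewrite lebesgue_measure_itv/=; case: ifPn => //; rewrite lee_fin subr_ge0.
by move=> /le_lt_trans; apply; rewrite lte_fin.
Qed.

Lemma ac_on_continuous l r f g : ac_on l r f g -> {within `[l, r], continuous f}.
Proof.
move=> fg; apply/subspace_continuousP => x /=; rewrite in_itv/= => /andP[lx xr].
apply/cvgrPdist_lt => e e0; have [d d0 Hd] := ac_on_unif fg e0.
rewrite near_withinE; near_simpl; near=> y => /=; rewrite in_itv/= => /andP[ly yr].
have xy : `|x - y| < d by near: y; exact: (@cvgr_dist_lt _ _ _ _ _ idfun).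
have [xley|/ltW ylex] := leP x y.
  by rewrite distrC Hd// -[ltLHS]ger0_norm ?subr_ge0// distrC.
by rewrite Hd// -[ltLHS]ger0_norm ?subr_ge0.
Unshelve. all: by end_near. Qed.

Lemma ac_on_measurable l r f g : ac_on l r f g -> measurable_fun `[l, r] f.
Proof.
move=> fg; apply: subspace_continuous_measurable_fun => //.
exact: ac_on_continuous fg.
Qed.

Lemma ac_on_bounded l r f g : ac_on l r f g ->
  exists2 M, 0 < M & forall x, l <= x <= r -> `|f x| <= M.
Proof.
move=> [ig fE].
exists (`|f l| + \int[mu]_(x in `[l, r]) `|g x| + 1).
  by rewrite ltr_wpDl// addr_ge0// Rintegral_ge0.
move=> x /andP[lx xr]; have -> : f x = f l + (f x - f l) by rewrite addrC subrK.
apply: (le_trans (ler_normD _ _)); rewrite -addrA lerD2l.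
rewrite fE//.
have igx : mu.-integrable `[l, x] (EFin \o g) by exact: integrable_sub_itv ig.
apply: (le_trans (le_normr_Rintegral _ _)) => //.
rewrite (@Rintegral_itv_cat _ _ l x r)//; last exact: integrable_norm.
by rewrite -addrA lerDl addr_ge0// Rintegral_ge0.
Qed.

Lemma ac_on_integrableM l r f g h : ac_on l r f g ->
  mu.-integrable `[l, r] (EFin \o h) ->
  mu.-integrable `[l, r] (EFin \o (fun x => f x * h x)).
Proof.
move=> fg ih; have [M M0 fM] := ac_on_bounded fg.
apply: integrable_EFinM ih => //; first exact: ac_on_measurable fg.
by move=> x /=; rewrite in_itv/= => /fM; exact.
Qed.

Lemma eq_ac_on l r f g f' g' : (forall x, l <= x <= r -> f x = f' x) ->
  (forall x, l <= x <= r -> g x = g' x) -> ac_on l r f g -> ac_on l r f' g'.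
Proof.
move=> ff gg [ig fE]; split.
  apply: eq_integrable ig => // x; rewrite inE/= in_itv/= => xlr.
  by rewrite /= gg.
move=> s t ls st tr; rewrite -!ff ?ls ?(le_trans ls)//= ?(le_trans st)//.
rewrite fE//; apply: eq_Rintegral => x; rewrite inE/= in_itv/= => /andP[sx xt].
by rewrite gg// (le_trans ls)//= (le_trans xt).
Qed.

Lemma ac_onD l r f g f' g' : ac_on l r f g -> ac_on l r f' g' ->
  ac_on l r (fun x => f x + f' x) (fun x => g x + g' x).
Proof.
move=> [ig fE] [ig' fE']; split; first exact: integrable_EFinD.
move=> s t ls st tr; rewrite RintegralD//; last 2 first.
  exact: integrable_sub_itv ig.
  exact: integrable_sub_itv ig'.
by rewrite -fE// -fE'//; ring.
Qed.

Lemma ac_onZ l r f g c : ac_on l r f g ->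
  ac_on l r (fun x => c * f x) (fun x => c * g x).
Proof.
move=> [ig fE]; split.
  exact: integrable_EFinZ.
move=> s t ls st tr; rewrite RintegralZl//; last exact: integrable_sub_itv ig.
by rewrite -fE// mulrBr.
Qed.

Lemma ac_on_cst l r c : ac_on l r (fun=> c) (fun=> 0).
Proof.
split; first by apply: eq_integrable (integrable0 _ _) => //.
by move=> s t _ _ _; rewrite subrr Rintegral_cst// mul0r.
Qed.

(** On a short segment the error is [int (g (f' t - f' x) + g' (f s - f x))],
    small compared with [int (|g| + |g'|)] by uniform continuity. *)
Lemma ac_onM l r f g f' g' : ac_on l r f g -> ac_on l r f' g' ->
  ac_on l r (fun x => f x * f' x) (fun x => g x * f' x + f x * g' x).
Proof.
move=> fg fg'; have [ig fE] := fg; have [ig' fE'] := fg'.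
have i1 : mu.-integrable `[l, r] (EFin \o (fun x => g x * f' x)).
  by apply: eq_integrable (ac_on_integrableM fg' ig) => // x _; rewrite /= mulrC.
have i2 := ac_on_integrableM fg ig'.
apply: (@ac_on_of_local _ _ _ _ (fun x => `|g x| + `|g' x|)).
- exact: integrable_EFinD.
- by apply: integrable_EFinD => //; exact: integrable_norm.
- by move=> x _; rewrite addr_ge0.
move=> e e0; have [d d0 Hd] := ac_on_unif fg e0.
have [d' d'0 Hd'] := ac_on_unif fg' e0.
exists (Num.min d d'); first by rewrite lt_min d0.
move=> s t ls st tr; rewrite lt_min => /andP[tsd tsd'].
have sub k : mu.-integrable `[l, r] (EFin \o k) -> mu.-integrable `[s, t] (EFin \o k).
  exact: integrable_sub_itv.
have -> : f t * f' t - f s * f' s - \int[mu]_(x in `[s, t]) (g x * f' x + f x * g' x) =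
    \int[mu]_(x in `[s, t]) (g x * (f' t - f' x) + g' x * (f s - f x)).
  have iA : mu.-integrable `[s, t] (EFin \o (fun x => g x * f' t + g' x * f s)).
    apply: (@integrable_EFinD _ _ _ mu _ _ (fun x => g x * f' t)) => //.
      by apply: eq_integrable (integrable_EFinZ _ (f' t) (sub _ ig)) => // x _; rewrite /= mulrC.
    by apply: eq_integrable (integrable_EFinZ _ (f s) (sub _ ig')) => // x _; rewrite /= mulrC.
  rewrite [RHS](_ : _ = \int[mu]_(x in `[s, t])
      ((g x * f' t + g' x * f s) - (g x * f' x + f x * g' x))); last first.
    by apply: eq_Rintegral => x _; ring.
  rewrite RintegralB//; last by apply: integrable_EFinD => //; exact: sub.
  congr (_ - _).
  rewrite RintegralD//; last 2 first.
    by apply: eq_integrable (integrable_EFinZ _ (f' t) (sub _ ig)) => // x _; rewrite /= mulrC.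
    by apply: eq_integrable (integrable_EFinZ _ (f s) (sub _ ig')) => // x _; rewrite /= mulrC.
  rewrite !RintegralZr//; [|exact: sub..].
  by rewrite -fE// -fE'//; ring.
have iL : mu.-integrable `[s, t]
    (EFin \o (fun x => g x * (f' t - f' x) + g' x * (f s - f x))).
  have k1 := ac_onD (ac_on_cst l r (f' t)) (ac_onZ (-1) fg').
  have k2 := ac_onD (ac_on_cst l r (f s)) (ac_onZ (-1) fg).
  have := integrable_EFinD _ (sub _ (ac_on_integrableM k1 ig))
    (sub _ (ac_on_integrableM k2 ig')).
  move=> /(_ (measurable_itv _)).
  by apply: eq_integrable => // x _; congr EFin; ring.
apply: (le_trans (le_normr_Rintegral _ _)) => //.
have iN : mu.-integrable `[s, t] (EFin \o (fun x => `|g x| + `|g' x|)).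
  by apply: integrable_EFinD => //; apply: integrable_norm; exact: sub.
rewrite -RintegralZl//; apply: le_Rintegral => //.
- exact: integrable_norm iL.
- exact: integrable_EFinZ.
move=> x /=; rewrite in_itv/= => /andP[sx xt].
apply: (le_trans (ler_normD _ _)); rewrite !normrM mulrDr ![e * _]mulrC.
apply: lerD; apply: ler_wpM2l => //; apply: ltW.
  by apply: Hd' => //; [exact: le_trans sx|lra].
by rewrite distrC; apply: Hd => //; [exact: le_trans tr|lra].
Qed.

(** On a short segment the increment of the composite is [N c] times that of
    [f], with [c] between the end values of [f], and [N c] is close to [N (f
    x)]. *)
Lemma ac_on_comp l r (F N : R -> R) f g :
  (forall x : R, is_derive x (1 : R) F (N x)) -> continuous N ->
  ac_on l r f g -> ac_on l r (fun x => F (f x)) (fun x => N (f x) * g x).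
Proof.
move=> dF cN fg; have [ig fE] := fg; have [M M0 fM] := ac_on_bounded fg.
have cF : continuous F.
  by move=> x; apply: differentiable_continuous; apply/derivable1_diffP; case: (dF x).
have mNf : measurable_fun `[l, r] (N \o f).
  apply: measurableT_comp; first exact: continuous_measurable_fun.
  exact: ac_on_measurable fg.
have [K KN] : exists K, forall x, `|x| <= M -> `|N x| <= K.
  have [c _ Hc] := @EVT_max R (fun x => `|N x|) (- M) M ltac:(lra)
    (continuous_subspaceT (fun x => cvg_norm (cN x))).
  by exists (`|N c|) => x xM; apply: Hc; rewrite in_itv/= -ler_norml.
have iN : mu.-integrable `[l, r] (EFin \o (fun x => N (f x) * g x)).
  apply: integrable_EFinM ig => //.
  by move=> x /=; rewrite in_itv/= => /fM /KN; exact.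
apply: (@ac_on_of_local _ _ _ _ (fun x => `|g x|)) => //; first exact: integrable_norm.
move=> e e0; have [d d0 Hd] := heine_cantor (- M) M cN e0.
have [d' d'0 Hd'] := ac_on_unif fg d0.
exists d' => // s t ls st tr tsd.
have sub k : mu.-integrable `[l, r] (EFin \o k) -> mu.-integrable `[s, t] (EFin \o k).
  exact: integrable_sub_itv.
have [c cb Fc] : exists2 c, (f s <= c <= f t) || (f t <= c <= f s) &
    F (f t) - F (f s) = N c * (f t - f s).
  have [fst|/ltW fts] := leP (f s) (f t).
    have [c cin ->] := @MVT_segment R F N (f s) (f t) fst (fun x _ => dF x)
      (continuous_subspaceT cF).
    by exists c => //; move: cin; rewrite in_itv/= => ->.
  have [c cin E] := @MVT_segment R F N (f t) (f s) fts (fun x _ => dF x)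
      (continuous_subspaceT cF).
  exists c; first by move: cin; rewrite in_itv/= => ->; rewrite orbT.
  by rewrite -opprB E -mulrN opprB.
rewrite Fc fE// -RintegralZl//; last exact: sub.
have iNg : mu.-integrable `[s, t] (EFin \o (fun x => N c * g x)).
  by apply: integrable_EFinZ => //; exact: sub.
rewrite -RintegralB//; last exact: sub.
have iNB : mu.-integrable `[s, t] (EFin \o (fun x => N c * g x - N (f x) * g x)).
  by apply: integrable_EFinB => //; exact: sub.
apply: (le_trans (le_normr_Rintegral _ _)) => //.
rewrite -RintegralZl//; last exact: integrable_norm (sub _ ig).
apply: le_Rintegral => //.
- exact: integrable_norm iNB.
- by apply: integrable_EFinZ => //; apply: integrable_norm; exact: sub.
move=> x /=; rewrite in_itv/= => /andP[sx xt].
rewrite -mulrBl normrM ler_wpM2r//; apply/ltW/Hd.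
  by rewrite -ler_norml; apply: fM; rewrite (le_trans ls)//= (le_trans xt).
have := Hd' s x ls sx (le_trans xt tr) ltac:(lra).
have := Hd' x t (le_trans ls sx) xt tr ltac:(lra).
rewrite !ltr_norml => /andP[? ?] /andP[? ?].
by apply/andP; case/orP: cb => /andP[? ?]; split; lra.
Qed.

Lemma ac_on_affine l r k c : ac_on l r (fun x => k * x + c) (fun=> k).
Proof.
have ik s t : mu.-integrable `[s, t] (EFin \o (fun=> k)).
  apply: continuous_compact_integrable; first exact: segment_compact.
  by apply: continuous_subspaceT => x; exact: cvg_cst.
split => // s t _ st _.
rewrite Rintegral_cst//= lebesgue_measure_itv/= lte_fin.
move: st; rewrite le_eqVlt => /predU1P[->|->/=]; last by ring.
by rewrite ltxx/= mulr0 subrr.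
Qed.

Lemma ac_on_posP l r :
  ac_on l r (fun x => Num.max 0 x) (fun x => ((0 < x)%R)%:R).
Proof.
have ik s t : mu.-integrable `[s, t] (EFin \o (fun x : R => ((0 < x)%R)%:R : R)).
  apply: measurable_bounded_integrable => //.
  - exact: compact_finite_measure (@segment_compact R s t).
  - apply: measurable_funTS.
    rewrite (_ : (fun _ => _) = \1_(`]0, +oo[%classic)).
      exact: measurable_indic.
    apply/funext => x; rewrite indicE; congr ((nat_of_bool _)%:R).
    by apply/idP/idP; rewrite inE/= in_itv/= andbT.
  - exists 1; split => // x x1 y _ /=; apply: (le_trans _ (ltW x1)).
    by case: (0 < y); rewrite ?normr1 ?normr0.
split => // s t _ st _.
have neg a b : b <= 0 -> \int[mu]_(x in `[a, b]) ((0 < x)%R)%:R = 0 :> R.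
  move=> b0; rewrite (@eq_Rintegral _ _ _ _ _ (fun=> 0)) ?Rintegral_cst ?mul0r//.
  move=> x; rewrite inE/= in_itv/= => /andP[_ xb].
  by rewrite ltNge (le_trans xb).
have pos a b : 0 <= a -> a <= b -> \int[mu]_(x in `[a, b]) ((0 < x)%R)%:R = b - a.
  move=> a0 ab; rewrite -Rintegral_itv_obnd_cbnd; last first.
    by apply: integrableS (ik a b) => //; exact: subset_itv_oc_cc.
  rewrite (@eq_Rintegral _ _ _ _ _ (fun=> 1)).
    rewrite Rintegral_cst//= lebesgue_measure_itv/= lte_fin mul1r.
    move: ab; rewrite le_eqVlt => /predU1P[->|->//].
    by rewrite ltxx/= subrr.
  move=> x; rewrite inE/= in_itv/= => /andP[ax _].
  by rewrite (le_lt_trans a0 ax).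
have [t0|t0] := leP t 0.
  by rewrite neg// (max_l (le_trans st t0)) subrr.
have [s0|/ltW s0] := leP 0 s.
  by rewrite pos.
rewrite subr0 (@Rintegral_itv_cat _ _ s 0 t)//; last exact: ltW.
by rewrite neg// pos// ?ltW// add0r subr0.
Qed.

Lemma ac_on_compaffine l r k c f g : 0 < k ->
  ac_on (k * l + c) (k * r + c) f g ->
  ac_on l r (fun x => f (k * x + c)) (fun x => k * g (k * x + c)).
Proof.
move=> k0 [ig fE]; split.
  by apply: integrable_EFinZ => //; exact: integrable_affine_itv.
move=> s t ls st tr; rewrite fE ?lerD2r ?ler_pM2l//.
rewrite -Rintegral_affine_itv//.
by apply: integrable_sub_itv ig; rewrite lerD2r ler_pM2l.
Qed.

End absolute_continuity.

(** * Integration along parallel lines *)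

Section transport.
Context {R : realType}.
Notation mu := (@lebesgue_measure R).
Notation mu2 := (mu \x mu)%E.

(** Points of the plane are pairs [(x, t)], the space variable first. *)
Definition slab (T : R) : set (measurableTypeR R * measurableTypeR R) := [set: R] `*` `[0, T].

Lemma measurable_slab T : measurable (slab T).
Proof. by apply: measurableX. Qed.

Lemma measurable_shear (k c : R) :
  measurable_fun [set: R * R] (fun z : R * R => (z.1 + k * z.2, z.2)).
Proof.
apply/measurable_fun_pairP; split => /=; last exact: measurable_snd.
by apply: measurable_funD; [exact: measurable_fst|
  apply: measurable_funM => //; exact: measurable_snd].
Qed.

Lemma integral_shift (c : R) (f : R -> \bar R) :
  mu.-integrable setT f -> (\int[mu]_x f (x + c)%R = \int[mu]_x f x)%E.
Proof.
move=> intf; rewrite [RHS](integral_affine c (oner_neq0 R))// normr1 mul1e.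
by apply: eq_integral => x _; rewrite mul1r.
Qed.

Lemma ge0_integral_shift (c : R) (f : R -> \bar R) : measurable_fun setT f ->
  (forall x, 0 <= f x)%E -> (\int[mu]_x f (x + c)%R = \int[mu]_x f x)%E.
Proof.
move=> mf f0; rewrite [RHS](ge0_integral_affine c (oner_neq0 R))// normr1 mul1e.
by apply: eq_integral => x _; rewrite mul1r.
Qed.

Lemma integrable_shear (k c : R) (H : R * R -> \bar R) : k != 0 ->
  mu2.-integrable setT H ->
  mu2.-integrable setT (fun z => H (k * z.1 + c * z.2, z.2)).
Proof.
move=> k0 iH; have mH := measurable_int _ iH.
have mHS : measurable_fun setT (fun z : R * R => H (k * z.1 + c * z.2, z.2)).
  apply: (measurableT_comp mH).
  apply/measurable_fun_pairP; split => /=; last exact: measurable_snd.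
  by apply: measurable_funD; apply: measurable_funM.
apply/integrable21ltyP => //; move/(integrable21ltyP mu mu mH) : iH.
have -> : (\int[mu]_s \int[mu]_x `|H (x, s)| =
    `|k|%:E * \int[mu]_s \int[mu]_x `|H ((k * x + c * s)%R, s)|)%E.
  rewrite -ge0_integralZl//; last 2 first.
    apply: (@measurable_fun_fubini_tonelli_G _ _ _ _ _ mu
      (fun z => `|H ((k * z.1 + c * z.2)%R, z.2)|%E)) => //.
    exact: measurableT_comp.
    by move=> s _; exact: integral_ge0.
  apply: eq_integral => s _.
  rewrite [LHS](ge0_integral_affine (c * s) k0)//.
  by apply: measurableT_comp => //; exact: measurableT_comp.
set J := integral _ _ _; have : (0 <= J)%E.
  by apply: integral_ge0 => s _; exact: integral_ge0.
case: J => [r _ _|_|//]; first by rewrite ltry.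
by rewrite mulry gtr0_sg ?normr_gt0// mul1e.
Qed.

Lemma integral_shear (k c : R) (H : R * R -> \bar R) : `|k| = 1 ->
  mu2.-integrable setT H ->
  (\int[mu2]_z H ((k * z.1 + c * z.2)%R, z.2) = \int[mu2]_z H z)%E.
Proof.
move=> k1 iH; have k0 : k != 0 by rewrite -normr_eq0 k1 oner_eq0.
have iHS := integrable_shear c k0 iH.
rewrite -(integral21_prod_meas1 iHS) -(integral21_prod_meas1 iH).
apply: ae_eq_integral => //.
- exact: (measurable_fubini_G iHS).
- exact: (measurable_fubini_G iH).
apply: filterS (ae_integrable2 iH) => s iHs _.
by rewrite /fubini_G [RHS](integral_affine (c * s) k0 iHs) k1 mul1e.
Qed.

(** Integrating the rate of change of [h] along the lines [x - k t = const]: a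
    shear maps these lines to vertical ones and preserves area. *)
Lemma transport_integral (k T : R) (h h' : R -> R -> R) :
  measurable_fun [set: R * R] (fun z : R * R => h' z.1 z.2) ->
  mu2.-integrable (slab T) (fun z => (h' z.1 z.2)%:E) ->
  mu.-integrable setT (EFin \o h^~ 0) -> mu.-integrable setT (EFin \o h^~ T) ->
  (forall z, ac_on 0 T (fun t => h (z + k * t) t) (fun t => h' (z + k * t) t)) ->
  0 <= T ->
  \int[mu]_x h x T - \int[mu]_x h x 0 = \int[mu2]_(z in slab T) h' z.1 z.2.
Proof.
move=> mh' ih' ih0 ihT ach T0.
pose H : R * R -> \bar R := (fun z => (h' z.1 z.2)%:E) \_ (slab T).
have mH : measurable_fun setT H.
  apply/(measurable_restrictT _ (measurable_slab T)).
  by apply: measurable_funTS; exact/measurable_EFinP.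
have iH : mu2.-integrable setT H.
  by move/(integrable_mkcond _ (measurable_slab T)) : ih'.
pose S (z : R * R) := (z.1 + k * z.2, z.2).
have mS : measurable_fun setT S by exact: measurable_shear.
have iHS : mu2.-integrable setT (H \o S).
  apply: eq_integrable (integrable_shear k (oner_neq0 R) iH) => // z _.
  by rewrite mul1r.
have HSE z : (\int[mu]_s (H \o S) (z, s) = (h (z + k * T) T - h z 0)%:E)%E.
  have [ig hE] := ach z.
  have := hE 0 T (lexx _) T0 (lexx _); rewrite mulr0 addr0 => ->.
  rewrite /Rintegral fineK; last exact: integrable_fin_num.
  rewrite [RHS]integral_mkcond; apply: eq_integral => s _.
  rewrite /H /= !patchE /S /=; congr (if _ then _ else _).
  by apply/idP/idP; rewrite !inE /slab/= => // -[].
have E1 := integral12_prod_meas1 iHS.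
have E3 : (\int[mu2]_z H z = \int[mu2]_z (H \o S) z)%E.
  rewrite -(integral_shear k (normr1 R) iH); apply: eq_integral => z _.
  by rewrite mul1r.
rewrite {2}/Rintegral [X in _ = fine X]integral_mkcond -/H E3 -E1.
under [X in _ = fine X]eq_integral do rewrite /fubini_F HSE.
have ihT' : mu.-integrable setT (fun z => (h (z + k * T) T)%:E).
  have := integrable_affine (k * T) (oner_neq0 R) ihT.
  by apply: eq_integrable => // x _ /=; rewrite mul1r.
rewrite -[RHS]/(\int[mu]_z (h (z + k * T) T - h z 0)) RintegralB//.
by congr (fine _ - _); rewrite -(integral_shift (k * T) ihT).
Qed.

End transport.

(** * The nonlinearity and its potential *)

Section continuous_plane.
Context {R : realType}.

Lemma open_measurable_plane (U : set (R * R)) : open U -> measurable U.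
Proof.
move=> oU.
pose box (q1 q2 q3 : rat) : set (R * R) :=
  `](ratr q1 - ratr q3 : R), (ratr q1 + ratr q3)[ `*` `](ratr q2 - ratr q3), (ratr q2 + ratr q3)[.
have -> : U = \bigcup_q1 \bigcup_q2 \bigcup_q3
    (if `[< box q1 q2 q3 `<=` U >] then box q1 q2 q3 else set0).
  apply/seteqP; split => [[x y] Uxy|z [q1 _ [q2 _ [q3 _]]]]; last first.
    by case: ifPn => // /asboolP; apply.
  have /nbhs_ballP[e /= e0 eU] : nbhs (x, y) U by exact: open_nbhs_nbhs.
  have [q3 q3e] := @rat_in_itvoo R 0 (e / 2) ltac:(lra).
  move: q3e; rewrite in_itv/= => /andP[q30 q3e].
  have [q1] := @rat_in_itvoo R (x - ratr q3) (x + ratr q3) ltac:(lra).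
  rewrite in_itv/= => /andP[q1x xq1].
  have [q2] := @rat_in_itvoo R (y - ratr q3) (y + ratr q3) ltac:(lra).
  rewrite in_itv/= => /andP[q2y yq2].
  exists q1 => //; exists q2 => //; exists q3 => //.
  rewrite asboolT; first by split; rewrite /= in_itv/=; apply/andP; split; lra.
  move=> [x' y'] [/=]; rewrite !in_itv/= => /andP[? ?] /andP[? ?].
  by apply: eU; split; rewrite /ball/= ltr_norml; apply/andP; split; lra.
apply: bigcupT_measurable_rat => q1; apply: bigcupT_measurable_rat => q2.
apply: bigcupT_measurable_rat => q3; case: ifPn => // _.
by apply: measurableX; exact: measurable_itv.
Qed.

Lemma continuous_plane_measurable (f : R * R -> R) : continuous f ->
  measurable_fun [set: R * R] f.
Proof.
move=> /continuousP cf; apply: (measurability _ (RGenOpens.measurableE R)).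
move=> _ [_ [a [b ->] <-]]; rewrite setTI; apply: open_measurable_plane.
exact/cf/interval_open.
Qed.

End continuous_plane.

Section nonlinearity.
Context {R : realType}.
Implicit Types (p x : R).

Definition nonlinearity p x := `|x| `^ (p - 1) * x.
Definition potential p x := (p + 1)^-1 * `|x| `^ (p + 1).

Lemma potential_ge0 p x : 1 < p -> 0 <= potential p x.
Proof. by move=> p1; rewrite mulr_ge0// ?powR_ge0// invr_ge0; lra. Qed.

Lemma normr_powR_split p x : 1 < p -> `|x| `^ (p + 1) = `|x| `^ (p - 1) * `|x| * `|x|.
Proof.
move=> p1; have [->|x0] := eqVneq x 0.
  by rewrite normr0 mulr0 powR0//; lra.
rewrite -mulrA -[X in _ * (X * _)]powRr1// -[X in _ * (_ * X)]powRr1//.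
rewrite -!powRD ?normr_eq0 ?x0 ?implybT//; congr (_ `^ _); lra.
Qed.

Lemma nonlinearityM p x : 1 < p -> x * nonlinearity p x = (p + 1) * potential p x.
Proof.
move=> p1; rewrite /nonlinearity /potential [RHS]mulrA mulfV ?mul1r; last by apply/eqP; lra.
rewrite normr_powR_split// mulrCA -!mulrA; congr (_ * _).
by rewrite -[RHS]expr2 -normrX ger0_norm ?sqr_ge0// expr2.
Qed.

Lemma continuous_powR_normr (q : R) : 0 < q -> continuous (fun x : R => `|x| `^ q).
Proof.
move=> q0 x; have [->|x0] := eqVneq x 0.
  apply/cvgrPdist_lt => e e0; near=> y.
  rewrite normr0 powR0 ?gt_eqF// sub0r normrN ger0_norm ?powR_ge0//.
  have -> : e = (e `^ q^-1) `^ q by rewrite -powRrM mulVf ?gt_eqF// powRr1// ltW.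
  apply: gt0_ltr_powR => //; rewrite ?nnegrE ?powR_ge0//.
  by near: y; apply: (@cvgr0_norm_lt _ _ _ _ _ idfun) => //; rewrite powR_gt0.
apply: (@continuous_comp _ _ _ (fun x : R => `|x|) (fun y => y `^ q)).
  exact: norm_continuous.
apply: differentiable_continuous; apply/derivable1_diffP.
by have [] := @is_derive1_powR R q `|x| ltac:(by rewrite normr_gt0).
Unshelve. all: by end_near. Qed.

Lemma continuous_nonlinearity p : 1 < p -> continuous (nonlinearity p).
Proof.
move=> p1 x; apply: cvgM; last exact: cvg_id.
by apply: continuous_powR_normr; lra.
Qed.

Lemma is_derive_potential p x : 1 < p ->
  is_derive x (1 : R) (potential p) (nonlinearity p x).
Proof.
move=> p1; have [->|x0] := eqVneq x 0.
  apply/is_derive1_caratheodory.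
  exists (fun z => (p + 1)^-1 * nonlinearity p z); split.
  - move=> z; rewrite /potential normr0 powR0; last by apply/eqP; lra.
    rewrite mulr0 !subr0 -mulrA [_ * z]mulrC nonlinearityM// mulrA mulVf ?mul1r//.
    by apply/eqP; lra.
  - by apply: cvgM; [exact: cvg_cst|exact: continuous_nonlinearity].
  - by rewrite /nonlinearity mulr0 mulr0.
have pE y : (p + 1)^-1 *: ((p + 1) * y `^ (p + 1 - 1)) = y `^ p.
  rewrite /GRing.scale/= mulrA mulVf ?mul1r; last by apply/eqP; lra.
  by congr (_ `^ _); lra.
have NE : nonlinearity p x = Num.sg x * `|x| `^ p.
  have -> : `|x| `^ p = `|x| `^ (p - 1 + 1) by rewrite subrK.
  rewrite powRD ?normr_eq0 ?x0 ?implybT//.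
  by rewrite powRr1// mulrCA -numEsg.
rewrite NE; have [x_gt0|x_lt0|x_eq0] := ltgtP 0 x; last by rewrite x_eq0 eqxx in x0.
- rewrite gtr0_sg// gtr0_norm// mul1r -pE.
  apply: (@near_eq_is_derive _ _ _ ((p + 1)^-1 \*: (fun y => y `^ (p + 1)))).
    near=> y; rewrite /potential gtr0_norm//.
    by near: y; exact: lt_nbhsr.
  by apply: is_deriveZ; exact: is_derive1_powR.
- rewrite ltr0_sg// ltr0_norm// -pE mulrC.
  apply: (@near_eq_is_derive _ _ _
    ((p + 1)^-1 \*: (fun y => y `^ (p + 1)) \o -%R)).
    near=> y; rewrite /potential /= ltr0_norm//.
    by near: y; exact: lt_nbhsl.
  apply: is_derive1_comp.
  by apply: is_deriveZ; apply: is_derive1_powR; rewrite oppr_gt0.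
Unshelve. all: by end_near. Qed.

Lemma continuous_potential p : 1 < p -> continuous (potential p).
Proof.
move=> p1 x; apply: differentiable_continuous; apply/derivable1_diffP.
by case: (is_derive_potential x p1).
Qed.

End nonlinearity.

(** * The characteristic system and its weighted identities *)

Section characteristic_system.
Context {R : realType}.
Notation mu := (@lebesgue_measure R).
Notation mu2 := (mu \x mu)%E.
Variable p : R.
Hypothesis p1 : 1 < p.
Notation N := (nonlinearity p).
Notation F := (potential p).

Definition box (K T : R) : set (measurableTypeR R * measurableTypeR R) :=
  `[- K, K] `*` `[0, T].

(** The wave equation as a system along characteristics, for [t >= 0]: [a] and
    [b] stand for [u_t + u_x] and [u_t - u_x], so that [a] satisfies an
    equation along [x + t = const] and [u] has derivative [a] along [x - t =
    const]. The slopes are written [-1 * t] and [1 * t] to be instances of one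
    parametric transport lemma. *)
Record char_solution (u a b : R -> R -> R) : Prop := CharSolution {
  cs_cont : continuous (fun z : R * R => u z.1 z.2);
  cs_ma : measurable_fun [set: R * R] (fun z : R * R => a z.1 z.2);
  cs_mb : measurable_fun [set: R * R] (fun z : R * R => b z.1 z.2);
  cs_a2 : forall K T : R, mu2.-integrable (box K T) (fun z => (a z.1 z.2 ^+ 2)%:E);
  cs_b2 : forall K T : R, mu2.-integrable (box K T) (fun z => (b z.1 z.2 ^+ 2)%:E);
  cs_a2t : forall K t : R, 0 <= t ->
    mu.-integrable `[- K, K] (fun x => (a x t ^+ 2)%:E);
  cs_b2t : forall K t : R, 0 <= t ->
    mu.-integrable `[- K, K] (fun x => (b x t ^+ 2)%:E);
  cs_ac_a : forall z T : R, 0 <= T -> ac_on 0 T (fun t => a (z + -1 * t) t)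
    (fun t => - N (u (z + -1 * t) t));
  cs_ac_b : forall z T : R, 0 <= T -> ac_on 0 T (fun t => b (z + 1 * t) t)
    (fun t => - N (u (z + 1 * t) t));
  cs_ac_ua : forall z T : R, 0 <= T -> ac_on 0 T (fun t => u (z + 1 * t) t)
    (fun t => a (z + 1 * t) t);
  cs_ac_ub : forall z T : R, 0 <= T -> ac_on 0 T (fun t => u (z + -1 * t) t)
    (fun t => b (z + -1 * t) t);
  cs_a2_0 : mu.-integrable setT (fun x => (a x 0 ^+ 2)%:E);
  cs_b2_0 : mu.-integrable setT (fun x => (b x 0 ^+ 2)%:E);
  cs_F_0 : mu.-integrable setT (fun x => (F (u x 0))%:E)
}.

(** A weight in null coordinates, [x] standing for [t + x] and [e] for [t -
    x], with densities [Wx], [We] of its restrictions to coordinate lines;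
    weights such as clipped linear functions are not differentiable
    everywhere. *)
Record weight (W Wx We : R -> R -> R) : Prop := Weight {
  wt_m : measurable_fun [set: R * R] (fun z : R * R => W z.1 z.2);
  wt_mx : measurable_fun [set: R * R] (fun z : R * R => Wx z.1 z.2);
  wt_me : measurable_fun [set: R * R] (fun z : R * R => We z.1 z.2);
  wt_bd : forall K : R, exists2 C, 0 <= C & forall x e, `|x| <= K -> `|e| <= K ->
    [/\ `|W x e| <= C, `|Wx x e| <= C & `|We x e| <= C];
  wt_xi : forall e l r, ac_on l r (W^~ e) (Wx^~ e);
  wt_eta : forall x l r, ac_on l r (W x) (We x)
}.

(** Vanishing for large values of either null coordinate; as these have sum [2
    t >= 0], this forces compact support in [x] at each time. *)
Definition supported (r : R) (W : R -> R -> R) :=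
  forall x e, r <= x \/ r <= e -> W x e = 0.

Definition along (W : R -> R -> R) (x t : R) := W (t + x) (t - x).

(** Along [x + t = const] only the second null coordinate moves, at speed 2. *)
Lemma weight_ac_minus W Wx We z T : weight W Wx We ->
  ac_on 0 T (fun t => along W (z + -1 * t) t) (fun t => 2 * along We (z + -1 * t) t).
Proof.
move=> w; have := @ac_on_compaffine _ 0 T 2 (- z) _ _ ltac:(lra)
  (wt_eta w z (2 * 0 + - z) (2 * T + - z)).
apply: eq_ac_on => t _; rewrite /along mulN1r.
  by congr (W _ _); ring.
by congr (2 * We _ _); ring.
Qed.

Lemma weight_ac_plus W Wx We z T : weight W Wx We ->
  ac_on 0 T (fun t => along W (z + 1 * t) t) (fun t => 2 * along Wx (z + 1 * t) t).
Proof.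
move=> w; have := @ac_on_compaffine _ 0 T 2 z _ _ ltac:(lra)
  (wt_xi w (- z) (2 * 0 + z) (2 * T + z)).
apply: eq_ac_on => t _; rewrite /along mul1r.
  by congr (W _ _); ring.
by congr (2 * Wx _ _); ring.
Qed.

Lemma measurable_along (W : R -> R -> R) :
  measurable_fun [set: R * R] (fun z : R * R => W z.1 z.2) ->
  measurable_fun [set: R * R] (fun z : R * R => along W z.1 z.2).
Proof.
move=> mW; apply: (measurableT_comp mW (_ : measurable_fun setT
  (fun z : R * R => (z.2 + z.1, z.2 - z.1)))).
apply/measurable_fun_pairP; split => /=.
  by apply: measurable_funD; [exact: measurable_snd|exact: measurable_fst].
by apply: measurable_funB; [exact: measurable_snd|exact: measurable_fst].
Qed.

Section identities.
Variables (u a b : R -> R -> R) (T : R).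
Hypothesis cs : char_solution u a b.
Hypothesis T0 : 0 <= T.

Let D x t := 1 + a x t ^+ 2 + b x t ^+ 2.

Let D1 x t : 1 <= D x t.
Proof. by rewrite /D -addrA lerDl addr_ge0// sqr_ge0. Qed.

(** Functions vanishing for large [x] and dominated by [1 + a^2 + b^2]: all
    the integrands below are of this kind, which settles their integrability
    on slabs and on time slices at once. *)
Definition admissible (H : R -> R -> R) :=
  measurable_fun [set: R * R] (fun z : R * R => H z.1 z.2) /\
  exists C K, forall x t, 0 <= t <= T ->
    `|H x t| <= C * D x t /\ (K < `|x| -> H x t = 0).

Lemma measurable_slice (H : R -> R -> R) t :
  measurable_fun [set: R * R] (fun z : R * R => H z.1 z.2) ->
  measurable_fun setT (H^~ t).
Proof.
move=> mH; apply: (measurableT_comp mH (_ : measurable_fun setT (fun x : R => (x, t)))).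
exact: measurable_pair2.
Qed.

Lemma admissible_integrable H : admissible H ->
  mu2.-integrable (slab T) (fun z => (H z.1 z.2)%:E).
Proof.
move=> [mH [C [K HC]]].
have mbox : measurable (box K T) by apply: measurableX; exact: measurable_itv.
have iD : mu2.-integrable (box K T) (EFin \o (fun z => C * D z.1 z.2)).
  apply: integrable_EFinZ => //; apply: integrable_EFinD => //; last exact: (cs_b2 cs).
  apply: integrable_EFinD => //; last exact: (cs_a2 cs).
  have finbox : (mu2 (box K T) < +oo)%E.
    have fin (s t : R) : (mu `[s, t]%classic < +oo)%E.
      exact: compact_finite_measure (@segment_compact R s t).
    rewrite product_measure1E//; apply: lte_mul_pinfty; [by []| |exact: fin].
    by rewrite ge0_fin_numE//; exact: fin.
  apply: measurable_bounded_integrable => //.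
  by exists 1; split => // y y1 z _ /=; rewrite normr1 ltW.
have iH : mu2.-integrable (box K T) (EFin \o (fun z => H z.1 z.2)).
  apply: integrable_EFin_le iD => //; first exact: measurable_funTS.
  by move=> [x t] [_ /=]; rewrite in_itv/= => t0T; have [] := HC x t t0T.
move/(integrable_mkcond _ mbox) : iH => iH.
apply/(integrable_mkcond _ (measurable_slab T)); apply: eq_integrable iH => // [[x t]] _.
rewrite /= !patchE; case: ifPn; case: ifPn => //; rewrite ?inE /box /slab/=.
- by move=> + [_]; rewrite notin_setE/= => h h'; exfalso; apply: h.
- move=> [_ /=]; rewrite in_itv/= => t0T; rewrite notin_setE/= => nbox.
  have [_ ->//] := HC x t t0T.
  rewrite ltNge; apply/negP => xK; apply: nbox; split => //=.
  by rewrite in_itv/= -ler_norml.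
Qed.

Lemma admissible_slice H t : admissible H -> 0 <= t <= T ->
  mu.-integrable setT (EFin \o H^~ t).
Proof.
move=> [mH [C [K HC]]] t0T; have t0 : 0 <= t by case/andP: t0T.
have iD : mu.-integrable `[- K, K] (EFin \o (fun x => C * D x t)).
  apply: integrable_EFinZ => //; apply: integrable_EFinD => //; last exact: (cs_b2t cs).
  apply: integrable_EFinD => //; last exact: (cs_a2t cs).
  apply: measurable_bounded_integrable => //.
    exact: compact_finite_measure (@segment_compact R _ _).
  by exists 1; split => // y y1 z _ /=; rewrite normr1 ltW.
have iH : mu.-integrable `[- K, K] (EFin \o (H^~ t)).
  apply: integrable_EFin_le iD => //; first by apply: measurable_funTS; exact: measurable_slice.
  by move=> x _; have [] := HC x t t0T.
move/integrable_mkcond : iH => /(_ (measurable_itv _)) iH.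
apply: eq_integrable iH => // x _.
rewrite /= !patchE; case: ifPn => //; rewrite notin_setE/= in_itv/= => nbox.
have [_ ->//] := HC x t t0T.
by rewrite ltNge; apply/negP => xK; apply: nbox; rewrite -ler_norml.
Qed.

Lemma admissibleD H1 H2 : admissible H1 -> admissible H2 ->
  admissible (fun x t => H1 x t + H2 x t).
Proof.
move=> [m1 [C1 [K1 h1]]] [m2 [C2 [K2 h2]]]; split; first exact: measurable_funD.
exists (C1 + C2), (Num.max K1 K2) => x t t0T.
have [b1 s1] := h1 x t t0T; have [b2 s2] := h2 x t t0T; split.
  by rewrite mulrDl (le_trans (ler_normD _ _))// lerD.
by rewrite gt_max => /andP[k1 k2]; rewrite s1// s2// addr0.
Qed.

Lemma admissibleZ c H : admissible H -> admissible (fun x t => c * H x t).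
Proof.
move=> [m1 [C1 [K1 h1]]]; split; first exact: measurable_funM.
exists (`|c| * C1), K1 => x t t0T; have [b1 s1] := h1 x t t0T; split.
  by rewrite normrM -mulrA ler_wpM2l.
by move=> k1; rewrite s1// mulr0.
Qed.

Lemma eq_admissible H1 H2 : (forall x t, H1 x t = H2 x t) ->
  admissible H1 -> admissible H2.
Proof. by move=> h; congr (admissible _); apply/funext => x; apply/funext => t. Qed.

Definition locally_dominated (q : R -> R -> R) :=
  measurable_fun [set: R * R] (fun z : R * R => q z.1 z.2) /\
  forall K : R, exists2 C, 0 <= C &
    forall x t, `|x| <= K -> 0 <= t <= T -> `|q x t| <= C * D x t.

Lemma admissible_along (W q : R -> R -> R) (r : R) :
  measurable_fun [set: R * R] (fun z : R * R => W z.1 z.2) ->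
  (forall K : R, exists2 C, 0 <= C & forall x e, `|x| <= K -> `|e| <= K -> `|W x e| <= C) ->
  supported r W -> locally_dominated q -> admissible (fun x t => along W x t * q x t).
Proof.
move=> mW /(_ (`|r| + `|T|)) [C C0 WC] sW [mq /(_ r) [C' C'0 qC]]; split.
  by apply: measurable_funM => //; exact: measurable_along.
exists (C * C'), r => x t t0T; have [t0 tT] := andP t0T.
have z0 : r < `|x| -> along W x t = 0.
  rewrite /along lter_normr => /orP[h|h]; apply: sW; [left|right]; lra.
split; last by move=> /z0 ->; rewrite mul0r.
have [xr|/z0 ->] := leP `|x| r.
  rewrite normrM -[leRHS]mulrA; apply: ler_pM => //; last exact: qC.
  have tT' : `|t| <= `|T| by rewrite !ger0_norm.
  have xr' := le_trans xr (ler_norm r).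
  apply: WC; rewrite addrC.
    by rewrite (le_trans (ler_normD _ _))// lerD.
  by rewrite (le_trans (ler_normD _ _))// normrN lerD.
by rewrite mul0r normr0 !mulr_ge0// (le_trans _ (D1 x t)).
Qed.

Lemma bounded_on_box (f : R * R -> R) K : continuous f ->
  exists2 C, 0 <= C & forall x t, `|x| <= K -> 0 <= t <= T -> `|f (x, t)| <= C.
Proof.
move=> cf; have : compact (f @` (`[- K, K] `*` `[0, T])).
  apply: continuous_compact; first exact: continuous_subspaceT.
  by apply: compact_setX; exact: segment_compact.
move=> /compact_bounded [M [_ HM]]; exists (`|M| + 1); first by rewrite addr_ge0.
move=> x t xK t0T; apply: (HM (`|M| + 1)).
  by rewrite (le_lt_trans (ler_norm M))// ltrDl.
by exists (x, t) => //; split; rewrite /= in_itv/= ?t0T// -ler_norml.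
Qed.

Lemma locally_dominated_u (f : R -> R) : continuous f ->
  locally_dominated (fun x t => f (u x t)).
Proof.
move=> cf; have cfu : continuous (fun z : R * R => f (u z.1 z.2)).
  by move=> z; apply: continuous_comp; [exact: cs_cont cs z|exact: cf].
split; first exact: continuous_plane_measurable cfu.
move=> K; have [C C0 HC] := bounded_on_box K cfu; exists C => // x t xK t0T.
by rewrite (le_trans (HC x t xK t0T))// ler_peMr.
Qed.

Lemma locally_dominated_a2 : locally_dominated (fun x t => a x t ^+ 2).
Proof.
split; first by apply: measurable_funX; exact: cs_ma cs.
move=> K; exists 1 => // x t _ _; rewrite mul1r ger0_norm ?sqr_ge0// /D.
by have := sqr_ge0 (b x t); lra.
Qed.

Lemma locally_dominated_ab : locally_dominated (fun x t => a x t * b x t).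
Proof.
split; first by apply: measurable_funM; [exact: cs_ma cs|exact: cs_mb cs].
move=> K; exists 1 => // x t _ _; rewrite mul1r /D ler_norml.
have := sqr_ge0 (a x t + b x t); have := sqr_ge0 (a x t - b x t).
have := sqr_ge0 (a x t); have := sqr_ge0 (b x t).
by rewrite !expr2 => *; apply/andP; split; nra.
Qed.

Lemma locally_dominated_ua (f : R -> R) : continuous f ->
  locally_dominated (fun x t => f (u x t) * a x t).
Proof.
move=> cf; have [mf fK] := locally_dominated_u cf; split.
  by apply: measurable_funM => //; exact: cs_ma cs.
have cfu : continuous (fun z : R * R => f (u z.1 z.2)).
  by move=> z; apply: continuous_comp; [exact: cs_cont cs z|exact: cf].
move=> K; have [C C0 HC] := bounded_on_box K cfu; exists C => // x t xK t0T.
rewrite normrM ler_pM//; first exact: HC.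
rewrite /D ler_norml; have := sqr_ge0 (a x t + 1); have := sqr_ge0 (a x t - 1).
have := sqr_ge0 (a x t); have := sqr_ge0 (b x t).
by rewrite !expr2 => *; apply/andP; split; nra.
Qed.

Lemma admissible_transport (k : R) (h h' : R -> R -> R) :
  admissible h -> admissible h' ->
  (forall z, ac_on 0 T (fun t => h (z + k * t) t) (fun t => h' (z + k * t) t)) ->
  \int[mu]_x h x T - \int[mu]_x h x 0 = \int[mu2]_(z in slab T) h' z.1 z.2.
Proof.
move=> ah ah' ach; apply: transport_integral ach _ => //.
- by case: ah'.
- exact: admissible_integrable.
- by apply: admissible_slice; rewrite ?lexx.
- by apply: admissible_slice; rewrite ?lexx ?T0.
Qed.

Variables (W Wx We : R -> R -> R) (r : R).
Hypothesis wW : weight W Wx We.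
Hypotheses (sW : supported r W) (sWx : supported r Wx) (sWe : supported r We).

Let adm q : locally_dominated q -> admissible (fun x t => along W x t * q x t).
Proof.
move=> lq; apply: (admissible_along _ _ sW lq); first exact: wt_m wW.
by move=> K; have [C C0 HC] := wt_bd wW K; exists C => // x e xK eK; have [] := HC x e xK eK.
Qed.

Let admx q : locally_dominated q -> admissible (fun x t => along Wx x t * q x t).
Proof.
move=> lq; apply: (admissible_along _ _ sWx lq); first exact: wt_mx wW.
by move=> K; have [C C0 HC] := wt_bd wW K; exists C => // x e xK eK; have [] := HC x e xK eK.
Qed.

Let adme q : locally_dominated q -> admissible (fun x t => along We x t * q x t).
Proof.
move=> lq; apply: (admissible_along _ _ sWe lq); first exact: wt_me wW.
by move=> K; have [C C0 HC] := wt_bd wW K; exists C => // x e xK eK; have [] := HC x e xK eK.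
Qed.

Let cN : continuous N. Proof. exact: continuous_nonlinearity. Qed.

Let dF x : is_derive x (1 : R) F (N x). Proof. exact: is_derive_potential. Qed.

Let cF : continuous F. Proof. exact: continuous_potential. Qed.

(** The energy density carried by waves moving to the left. *)
Definition energy_plus x t := a x t ^+ 2 / 4 + F (u x t) / 2.

Let adm_a2 := adm locally_dominated_a2.
Let adm_F := adm (locally_dominated_u cF).
Let adm_Na := adm (locally_dominated_ua cN).
Let adme_a2 := adme locally_dominated_a2.
Let admx_F := admx (locally_dominated_u cF).

Lemma admissible_energy : admissible (fun x t => along W x t * energy_plus x t).
Proof.
apply: eq_admissible (admissibleD (admissibleZ 4^-1 adm_a2) (admissibleZ 2^-1 adm_F)).
by move=> x t; rewrite /energy_plus; ring.
Qed.

Lemma admissible_energy_rate :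
  admissible (fun x t => along We x t * a x t ^+ 2 / 2 + along Wx x t * F (u x t)).
Proof.
apply: eq_admissible (admissibleD (admissibleZ 2^-1 adme_a2) admx_F).
by move=> x t; ring.
Qed.

(** The two halves of the density are differentiated along different families
    of characteristics, [a^2] along the one where its equation lives and [F u]
    along the one where [u] has derivative [a]; the terms [N u * a] cancel.
    The factor 2 in the derivative of the weight absorbs the halves. *)
Lemma energy_identity :
  \int[mu]_x (along W x T * energy_plus x T) -
  \int[mu]_x (along W x 0 * energy_plus x 0) =
  \int[mu2]_(z in slab T)
    (along We z.1 z.2 * a z.1 z.2 ^+ 2 / 2 + along Wx z.1 z.2 * F (u z.1 z.2)).
Proof.
pose Ha x t := 2 * (along We x t * a x t ^+ 2) + - 2 * (along W x t * (N (u x t) * a x t)).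
pose HF x t := 2 * (along Wx x t * F (u x t)) + along W x t * (N (u x t) * a x t).
have aHa : admissible Ha by apply: admissibleD; exact: admissibleZ.
have aHF : admissible HF by apply: admissibleD => //; exact: admissibleZ.
have Ea : \int[mu]_x (along W x T * a x T ^+ 2) - \int[mu]_x (along W x 0 * a x 0 ^+ 2)
    = \int[mu2]_(z in slab T) Ha z.1 z.2.
  apply: (@admissible_transport (-1) (fun x t => along W x t * a x t ^+ 2) Ha) => // z.
  have A := cs_ac_a cs z T0; have := ac_onM (weight_ac_minus z T wW) (ac_onM A A).
  by apply: eq_ac_on => t _; rewrite /Ha; ring.
have EF : \int[mu]_x (along W x T * F (u x T)) - \int[mu]_x (along W x 0 * F (u x 0))
    = \int[mu2]_(z in slab T) HF z.1 z.2.
  apply: (@admissible_transport 1 (fun x t => along W x t * F (u x t)) HF) => // z.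
  have A := ac_on_comp dF cN (cs_ac_ua cs z T0).
  have := ac_onM (weight_ac_plus z T wW) A.
  by apply: eq_ac_on => t _; rewrite /HF; ring.
have sl t : 0 <= t <= T -> \int[mu]_x (along W x t * energy_plus x t) =
    4^-1 * \int[mu]_x (along W x t * a x t ^+ 2) +
    2^-1 * \int[mu]_x (along W x t * F (u x t)).
  move=> t0T; have i1 := admissible_slice adm_a2 t0T; have i2 := admissible_slice adm_F t0T.
  rewrite -!RintegralZl// -RintegralD//; try exact: integrable_EFinZ.
  by apply: eq_Rintegral => x _; rewrite /energy_plus; ring.
rewrite !sl ?lexx ?T0//.
transitivity (4^-1 * \int[mu2]_(z in slab T) Ha z.1 z.2 +
              2^-1 * \int[mu2]_(z in slab T) HF z.1 z.2).
  rewrite -Ea -EF; have alg (x1 x2 x3 x4 : R) : 4^-1 * x1 + 2^-1 * x2 - (4^-1 * x3 + 2^-1 * x4) =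
    4^-1 * (x1 - x3) + 2^-1 * (x2 - x4) by ring.
  exact: alg.
have mS := @measurable_slab R T.
have ia := admissible_integrable aHa; have iF := admissible_integrable aHF.
rewrite -!RintegralZl// -RintegralD//; try exact: integrable_EFinZ.
by apply: eq_Rintegral => z _; rewrite /Ha /HF; field.
Qed.

Lemma admissible_virial : admissible (fun x t => along W x t * (u x t * a x t)).
Proof. exact: adm (@locally_dominated_ua id (fun x => cvg_id)). Qed.

Lemma admissible_virial_rate :
  admissible (fun x t => 2 * along We x t * (u x t * a x t) +
    along W x t * (a x t * b x t) - (p + 1) * along W x t * F (u x t)).
Proof.
have h1 := admissibleZ 2 (adme (@locally_dominated_ua id (fun x => cvg_id))).
have h2 := adm locally_dominated_ab.
apply: eq_admissible (admissibleD (admissibleD h1 h2) (admissibleZ (- (p + 1)) adm_F)).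
by move=> x t; ring.
Qed.

(** Here [u] and [a] are differentiated along [x + t = const], where [u] has
    derivative [b]; the term [u * N u] is [(p + 1) F u]. *)
Lemma virial_identity :
  \int[mu]_x (along W x T * (u x T * a x T)) -
  \int[mu]_x (along W x 0 * (u x 0 * a x 0)) =
  \int[mu2]_(z in slab T) (2 * along We z.1 z.2 * (u z.1 z.2 * a z.1 z.2) +
    along W z.1 z.2 * (a z.1 z.2 * b z.1 z.2) -
    (p + 1) * along W z.1 z.2 * F (u z.1 z.2)).
Proof.
apply: (@admissible_transport (-1) (fun x t => along W x t * (u x t * a x t))
  (fun x t => 2 * along We x t * (u x t * a x t) +
    along W x t * (a x t * b x t) - (p + 1) * along W x t * F (u x t))).
- exact: admissible_virial.
- exact: admissible_virial_rate.
move=> z; have := ac_onM (weight_ac_minus z T wW)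
  (ac_onM (cs_ac_ub cs z T0) (cs_ac_a cs z T0)).
apply: eq_ac_on => t _ //.
by rewrite [(p + 1) * _ * _]mulrAC -nonlinearityM//; ring.
Qed.

End identities.
End characteristic_system.

(** * Cutoffs and weights *)

Section one_variable_weights.
Context {R : realType}.
Implicit Types (f g : R -> R) (s t : R).

(** Bounded functions of one null coordinate, with bounded density; products
    of two of these are the weights used for energy fluxes. *)
Record bounded_ac (f f' : R -> R) : Prop := BoundedAc {
  bac_m : measurable_fun [set: R] f;
  bac_m' : measurable_fun [set: R] f';
  bac_bd : exists2 C, 0 <= C & forall s, `|f s| <= C /\ `|f' s| <= C;
  bac_ac : forall l r, ac_on l r f f'
}.

Lemma bounded_ac_cst c : bounded_ac (fun=> c) (fun=> 0).
Proof.
split=> //; last by move=> l r; exact: ac_on_cst.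
by exists `|c| => // s; rewrite normr0.
Qed.

Lemma bounded_acM f f' g g' : bounded_ac f f' -> bounded_ac g g' ->
  bounded_ac (fun s => f s * g s) (fun s => f' s * g s + f s * g' s).
Proof.
move=> [mf mf' [C C0 fC] fac] [mg mg' [K K0 gK] gac]; split.
- exact: measurable_funM.
- by apply: measurable_funD; exact: measurable_funM.
- exists (C * K + C * K); first by rewrite addr_ge0 ?mulr_ge0.
  move=> s; have [f1 f2] := fC s; have [g1 g2] := gK s; split.
    by rewrite normrM ler_wpDr ?mulr_ge0// ler_pM.
  by rewrite (le_trans (ler_normD _ _))// !normrM lerD// ler_pM.
- by move=> l r; exact: ac_onM.
Qed.

Lemma bounded_ac_lin f f' (c k : R) : bounded_ac f f' ->
  bounded_ac (fun s => c + k * f s) (fun s => k * f' s).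
Proof.
move=> [mf mf' [C C0 fC] fac]; split.
- by apply: measurable_funD => //; exact: measurable_funM.
- exact: measurable_funM.
- exists (`|c| + `|k| * C); first by rewrite addr_ge0 ?mulr_ge0.
  move=> s; have [f1 f2] := fC s; split.
    by rewrite (le_trans (ler_normD _ _))// lerD2l normrM ler_wpM2l.
  by rewrite normrM ler_wpDl// ler_wpM2l.
- move=> l r; have := ac_onD (ac_on_cst l r c) (ac_onZ k (fac l r)).
  by apply: eq_ac_on => // s _; rewrite add0r.
Qed.

(** The ramp from 0 to 1 on the unit interval, as a difference of positive
    parts so that its absolute continuity follows from that of the positive
    part. *)
Definition clip s := Num.max 0 s - Num.max 0 (s - 1).
Definition dclip s : R := ((0 < s <= 1)%R)%:R.

Lemma clip_le0 s : s <= 0 -> clip s = 0.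
Proof. by move=> s0; rewrite /clip !max_l ?subrr//; lra. Qed.

Lemma clip_ge1 s : 1 <= s -> clip s = 1.
Proof. by move=> s1; rewrite /clip !max_r; [ring|lra|lra]. Qed.

Lemma clip_mid s : 0 <= s -> s <= 1 -> clip s = s.
Proof. by move=> s0 s1; rewrite /clip max_r// max_l ?subr0//; lra. Qed.

Lemma clip_ge0 s : 0 <= clip s.
Proof.
have [/clip_le0->//|s0] := leP s 0; have [s1|s1] := leP s 1.
  by rewrite clip_mid// ltW.
by rewrite clip_ge1// ltW.
Qed.

Lemma clip_le1 s : clip s <= 1.
Proof.
have [/clip_le0->//|s0] := leP s 0; have [s1|s1] := leP s 1.
  by rewrite clip_mid// ltW.
by rewrite clip_ge1// ltW.
Qed.

Lemma clip_nd s t : s <= t -> clip s <= clip t.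
Proof.
move=> st; have [/clip_le0->|s0] := leP s 0; first exact: clip_ge0.
have [t1|t1] := leP t 1; first by rewrite !clip_mid; lra.
by rewrite (clip_ge1 (ltW t1)) clip_le1.
Qed.

Lemma dclip_ge0 s : 0 <= dclip s. Proof. exact: ler0n. Qed.

Lemma dclip_le1 s : dclip s <= 1.
Proof. by rewrite /dclip; case: (_ && _). Qed.

Lemma measurable_dclip : measurable_fun [set: R] dclip.
Proof.
rewrite (_ : dclip = \1_(`]0, 1]%classic)); first exact: measurable_indic.
apply/funext => x; rewrite indicE; congr ((nat_of_bool _)%:R).
by apply/idP/idP; rewrite inE/= in_itv/=.
Qed.

Lemma bounded_ac_clip (k c : R) : 0 < k ->
  bounded_ac (fun s => clip (k * s + c)) (fun s => k * dclip (k * s + c)).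
Proof.
move=> k0; have mc : measurable_fun [set: R] clip.
  apply: measurable_funB; first exact: measurable_maxr.
  by apply: measurable_maxr => //; exact: measurable_funB.
split.
- exact: (measurableT_comp mc (measurable_affine k c)).
- apply: measurable_funM => //.
  exact: (measurableT_comp measurable_dclip (measurable_affine k c)).
- exists (1 + k); first by rewrite addr_ge0// ltW.
  move=> s; rewrite normrM !ger0_norm ?clip_ge0 ?dclip_ge0 ?(ltW k0)//; split.
    by rewrite (le_trans (clip_le1 _))// lerDl ltW.
  by rewrite ler_wpDl// ler_piMr ?dclip_le1// ltW.
- move=> l r; apply: (@ac_on_compaffine _ l r k c clip dclip) => //.
  set l' := k * l + c; set r' := k * r + c.
  have h1 := ac_on_posP l' r'.
  have h2 := @ac_on_compaffine _ l' r' 1 (-1) _ _ ltr01 (ac_on_posP (1 * l' + -1) (1 * r' + -1)).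
  have := ac_onD h1 (ac_onZ (-1) h2); apply: eq_ac_on => s _.
    by rewrite /clip mul1r mulN1r.
  rewrite /dclip !mul1r mulN1r subr_gt0; have [s0|s0] := ltP 0 s.
    by have [s1|s1] := ltP 1 s; rewrite /= ?subrr ?subr0.
  by rewrite (ltNge 1 s) (le_trans s0)//= subr0.
Qed.

(** A ramp down from 1 to 0 over [[r - 1, r]]; the trivial factors match the
    affine forms produced by [bounded_ac_lin] and [bounded_ac_clip]. *)
Definition cut (r s : R) := 1 + -1 * clip (1 * s + (1 - r)).
Definition dcut (r s : R) := -1 * (1 * dclip (1 * s + (1 - r))).

Lemma bounded_ac_cut r : bounded_ac (cut r) (dcut r).
Proof. exact: (bounded_ac_lin 1 (-1) (bounded_ac_clip (1 - r) ltr01)). Qed.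

Lemma cut_ge0 r s : 0 <= cut r s.
Proof. by rewrite /cut; have := clip_le1 (1 * s + (1 - r)); lra. Qed.

Lemma cut_le1 r s : cut r s <= 1.
Proof. by rewrite /cut; have := clip_ge0 (1 * s + (1 - r)); lra. Qed.

Lemma cut_eq1 r s : s <= r - 1 -> cut r s = 1.
Proof. by move=> sr; rewrite /cut clip_le0; lra. Qed.

Lemma cut_eq0 r s : r <= s -> cut r s = 0.
Proof. by move=> sr; rewrite /cut clip_ge1; lra. Qed.

Lemma dcut_le0 r s : dcut r s <= 0.
Proof. by rewrite /dcut; have := dclip_ge0 (1 * s + (1 - r)); lra. Qed.

Lemma dcut_eq0 r s : s <= r - 1 -> dcut r s = 0.
Proof.
move=> sr; rewrite /dcut /dclip; have [?|_] := ltP 0 (1 * s + (1 - r)); first lra.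
by rewrite /= !mulr0.
Qed.

Lemma cut_nd r r' s : r <= r' -> cut r s <= cut r' s.
Proof.
by move=> rr; rewrite /cut; have := @clip_nd (1 * s + (1 - r')) (1 * s + (1 - r)) ltac:(lra); lra.
Qed.

Lemma weight_tensor f f' g g' : bounded_ac f f' -> bounded_ac g g' ->
  weight (fun x e => f x * g e) (fun x e => f' x * g e) (fun x e => f x * g' e).
Proof.
move=> [mf mf' [C C0 fC] fac] [mg mg' [K K0 gK] gac]; split => /=.
- by apply: measurable_funM; apply: measurableT_comp.
- by apply: measurable_funM; apply: measurableT_comp.
- by apply: measurable_funM; apply: measurableT_comp.
- move=> r0; exists (C * K); first exact: mulr_ge0.
  move=> x e xr er; have [f1 f2] := fC x; have [g1 g2] := gK e.
  by rewrite !normrM; split; apply: ler_pM.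
- move=> e l r; have := ac_onZ (g e) (fac l r).
  by apply: eq_ac_on => s _; rewrite mulrC.
- by move=> x l r; exact: ac_onZ (gac l r).
Qed.

Lemma weightM (W Wx We V Vx Ve : R -> R -> R) : weight W Wx We -> weight V Vx Ve ->
  weight (fun x e => W x e * V x e)
    (fun x e => Wx x e * V x e + W x e * Vx x e)
    (fun x e => We x e * V x e + W x e * Ve x e).
Proof.
move=> [m1 m2 m3 w1 a1 a2] [n1 n2 n3 w2 b1 b2]; split.
- exact: measurable_funM.
- by apply: measurable_funD; exact: measurable_funM.
- by apply: measurable_funD; exact: measurable_funM.
- move=> r; have [C C0 HC] := w1 r; have [K K0 HK] := w2 r.
  exists (C * K + C * K) => [|x e xr er]; first by rewrite addr_ge0 ?mulr_ge0.
  have [h1 h2 h3] := HC x e xr er; have [k1 k2 k3] := HK x e xr er; split.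
  + by rewrite normrM ler_wpDr ?mulr_ge0// ler_pM.
  + by rewrite (le_trans (ler_normD _ _))// !normrM lerD// ler_pM.
  + by rewrite (le_trans (ler_normD _ _))// !normrM lerD// ler_pM.
- by move=> e l r; exact: (ac_onM (a1 e l r) (b1 e l r)).
- by move=> x l r; exact: (ac_onM (a2 x l r) (b2 x l r)).
Qed.

Lemma weight_lin (W Wx We : R -> R -> R) (c k : R) : weight W Wx We ->
  weight (fun x e => c + k * W x e) (fun x e => k * Wx x e) (fun x e => k * We x e).
Proof.
move=> [m1 m2 m3 w1 a1 a2]; split.
- by apply: measurable_funD => //; exact: measurable_funM.
- exact: measurable_funM.
- exact: measurable_funM.
- move=> r; have [C C0 HC] := w1 r.
  exists (`|c| + `|k| * C) => [|x e xr er]; first by rewrite addr_ge0 ?mulr_ge0.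
  have [h1 h2 h3] := HC x e xr er; split.
  + by rewrite (le_trans (ler_normD _ _))// lerD2l normrM ler_wpM2l.
  + by rewrite normrM ler_wpDl// ler_wpM2l.
  + by rewrite normrM ler_wpDl// ler_wpM2l.
- move=> e l r; have := ac_onD (ac_on_cst l r c) (ac_onZ k (a1 e l r)).
  by apply: eq_ac_on => // s _; rewrite add0r.
- move=> e l r; have := ac_onD (ac_on_cst l r c) (ac_onZ k (a2 e l r)).
  by apply: eq_ac_on => // s _; rewrite add0r.
Qed.

End one_variable_weights.

Section exhaustion.
Local Open Scope ereal_scope.

(** Monotone convergence for cutoffs [c n] increasing to 1, in the form of a
    transfer of upper bounds: the identities hold for compactly supported
    weights and the bounds are then freed from the cutoff. *)
Lemma le_integral_exhaustion d (X : measurableType d) (R : realType)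
    (m : {measure set X -> \bar R}) (D : set X) (c : nat -> X -> R) (g : X -> R)
    (B : \bar R) : measurable D -> measurable_fun D g ->
  (forall n, measurable_fun D (c n)) -> (forall x, D x -> 0 <= g x)%R ->
  (forall n x, D x -> 0 <= c n x)%R ->
  (forall n k x, D x -> (n <= k)%N -> c n x <= c k x)%R ->
  (forall x, D x -> exists n, forall k, (n <= k)%N -> c k x = 1%R) ->
  (forall n, \int[m]_(x in D) (c n x * g x)%:E <= B) ->
  \int[m]_(x in D) (g x)%:E <= B.
Proof.
move=> mD mg mc g0 c0 cnd c1 HB.
pose G n x := (c n x * g x)%:E.
have G0 n x : D x -> 0 <= G n x by move=> Dx; rewrite lee_fin mulr_ge0 ?c0 ?g0.
have ndG x : D x -> {homo G^~ x : n k / (n <= k)%N >-> n <= k}.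
  by move=> Dx n k nk; rewrite lee_fin ler_wpM2r ?g0// cnd.
have mG n : measurable_fun D (G n).
  by apply/measurable_EFinP; exact: measurable_funM.
have -> : \int[m]_(x in D) (g x)%:E = \int[m]_(x in D) limn (G^~ x).
  apply: eq_integral => x; rewrite inE => Dx; apply/esym/cvg_lim => //.
  have [n cn] := c1 x Dx; apply: cvg_near_cst; exists n => // k /= nk.
  by rewrite /G cn// mul1r.
rewrite monotone_convergence//; apply: lime_le; last by apply: nearW => n; exact: HB.
apply: ereal_nondecreasing_is_cvgn => n k nk; apply: ge0_le_integral => //.
- by move=> x Dx; exact: G0.
- by move=> x Dx; exact: ndG.
Qed.

End exhaustion.

(** * Reflection, monotone weights and energy flux *)

Section reflection.
Context {R : realType}.
Notation mu := (@lebesgue_measure R).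
Notation mu2 := (mu \x mu)%E.
Variable p : R.

Lemma measurable_reflect (H : R -> R -> R) :
  measurable_fun [set: R * R] (fun z : R * R => H z.1 z.2) ->
  measurable_fun [set: R * R] (fun z : R * R => H (- z.1) z.2).
Proof.
move=> mH; apply: (measurableT_comp mH (_ : measurable_fun setT
  (fun z : R * R => (- z.1, z.2)))).
apply/measurable_fun_pairP; split => /=; last exact: measurable_snd.
by apply: measurable_funN; exact: measurable_fst.
Qed.

Lemma integrable_reflect (f : R -> R) :
  mu.-integrable setT (EFin \o f) -> mu.-integrable setT (EFin \o (fun x => f (- x))).
Proof.
have k0 : -1 != 0 :> R by rewrite oppr_eq0 oner_eq0.
move=> /(integrable_affine 0 k0).
by apply: eq_integrable => // x _; rewrite /= mulN1r addr0.
Qed.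

Lemma Rintegral_reflect (f : R -> R) : mu.-integrable setT (EFin \o f) ->
  \int[mu]_x f (- x) = \int[mu]_x f x.
Proof.
move=> h; have k0 : -1 != 0 :> R by rewrite oppr_eq0 oner_eq0.
rewrite /Rintegral [in RHS](integral_affine 0 k0 h) normrN1 mul1e.
by congr fine; apply: eq_integral => x _; rewrite /= mulN1r addr0.
Qed.

Lemma ge0_integral_reflect (f : R -> \bar R) : measurable_fun setT f ->
  (forall x, 0 <= f x)%E -> (\int[mu]_x f (- x)%R = \int[mu]_x f x)%E.
Proof.
move=> mf f0; have k0 : -1 != 0 :> R by rewrite oppr_eq0 oner_eq0.
rewrite [in RHS](ge0_integral_affine 0 k0 mf f0) normrN1 mul1e.
by apply: eq_integral => x _; rewrite /= mulN1r addr0.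
Qed.

Lemma integrable_slab_reflect (H : R -> R -> R) T :
  mu2.-integrable (slab T) (fun z => (H z.1 z.2)%:E) ->
  mu2.-integrable (slab T) (fun z => (H (- z.1) z.2)%:E).
Proof.
have mS := @measurable_slab R T; have k0 : -1 != 0 :> R by rewrite oppr_eq0 oner_eq0.
move=> /(integrable_mkcond _ mS) /(integrable_shear 0 k0) h.
apply/(integrable_mkcond _ mS); apply: eq_integrable h => // [[x t]] _ /=.
rewrite !patchE mul0r addr0 mulN1r.
by congr (if _ then _ else _); apply/idP/idP; rewrite !inE /slab/= => -[].
Qed.

Lemma Rintegral_slab_reflect (H : R -> R -> R) T :
  mu2.-integrable (slab T) (fun z => (H z.1 z.2)%:E) ->
  \int[mu2]_(z in slab T) H (- z.1) z.2 = \int[mu2]_(z in slab T) H z.1 z.2.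
Proof.
have mS := @measurable_slab R T.
move=> /(integrable_mkcond _ mS) /(integral_shear 0 (normrN1 R)) E.
rewrite /Rintegral; congr fine.
rewrite [RHS]integral_mkcond -E [LHS]integral_mkcond; apply: eq_integral => -[x t] _ /=.
rewrite !patchE mul0r addr0 mulN1r.
by congr (if _ then _ else _); apply/idP/idP; rewrite !inE /slab/= => -[].
Qed.

Lemma integrable_box_reflect (h : R -> R -> R) K T :
  mu2.-integrable (box K T) (fun z => (h z.1 z.2)%:E) ->
  mu2.-integrable (box K T) (fun z => (h (- z.1) z.2)%:E).
Proof.
have k0 : -1 != 0 :> R by rewrite oppr_eq0 oner_eq0.
have mB : measurable (box K T) by apply: measurableX; exact: measurable_itv.
move=> /(integrable_mkcond _ mB) /(integrable_shear 0 k0) h1.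
apply/(integrable_mkcond _ mB); apply: eq_integrable h1 => // [[x t]] _ /=.
rewrite !patchE mul0r addr0 mulN1r; congr (if _ then _ else _).
apply/idP/idP; rewrite !inE /box/= !in_itv/= => -[/andP[? ?] ?]; split => //;
  by apply/andP; split; lra.
Qed.

Lemma integrable_slice_reflect (h : R -> R) K :
  mu.-integrable `[- K, K] (fun x => (h x)%:E) ->
  mu.-integrable `[- K, K] (fun x => (h (- x))%:E).
Proof.
have k0 : -1 != 0 :> R by rewrite oppr_eq0 oner_eq0.
move=> /integrable_mkcond => /(_ (measurable_itv _)) /(integrable_affine 0 k0) h1.
apply/integrable_mkcond => //; apply: eq_integrable h1 => // x _ /=.
rewrite !patchE addr0 mulN1r; congr (if _ then _ else _).
apply/idP/idP; rewrite !inE/= !in_itv/= => /andP[? ?];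
  by apply/andP; split; lra.
Qed.

(** Reflection in space exchanges the two families of characteristics, hence
    [a] and [b]. *)
Lemma char_solution_reflect (u a b : R -> R -> R) : char_solution p u a b ->
  char_solution p (fun x => u (- x)) (fun x => b (- x)) (fun x => a (- x)).
Proof.
move=> cs; split.
- move=> z; apply: (@continuous2_cvg _ _ _ _ _ _ (fun z => - z.1) snd u (- z.1) z.2).
  + have cu : continuous (fun z : R * R => u z.1 z.2) := cs_cont cs.
    exact: cu (- z.1, z.2).
  + by apply: cvgN; exact: cvg_fst.
  + exact: cvg_snd.
- exact: measurable_reflect (cs_mb cs).
- exact: measurable_reflect (cs_ma cs).
- by move=> K T; exact: (@integrable_box_reflect (fun x t => b x t ^+ 2)) (cs_b2 cs K T).
- by move=> K T; exact: (@integrable_box_reflect (fun x t => a x t ^+ 2)) (cs_a2 cs K T).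
- by move=> K t t0; exact: (@integrable_slice_reflect (fun x => b x t ^+ 2)) (cs_b2t cs K t0).
- by move=> K t t0; exact: (@integrable_slice_reflect (fun x => a x t ^+ 2)) (cs_a2t cs K t0).
- move=> z T T0; have := cs_ac_b cs (- z) T0.
  by apply: eq_ac_on => t _; rewrite mulN1r mul1r opprD opprK.
- move=> z T T0; have := cs_ac_a cs (- z) T0.
  by apply: eq_ac_on => t _; rewrite mulN1r mul1r opprD.
- move=> z T T0; have := cs_ac_ub cs (- z) T0.
  by apply: eq_ac_on => t _; rewrite mulN1r mul1r opprD.
- move=> z T T0; have := cs_ac_ua cs (- z) T0.
  by apply: eq_ac_on => t _; rewrite mulN1r mul1r opprD opprK.
- exact: integrable_reflect (cs_b2_0 cs).
- exact: integrable_reflect (cs_a2_0 cs).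
- exact: integrable_reflect (cs_F_0 cs).
Qed.

End reflection.

Section monotone_weights.
Context {R : realType}.
Notation mu := (@lebesgue_measure R).
Notation mu2 := (mu \x mu)%E.
Variables (p : R) (u a b : R -> R -> R).
Hypotheses (p1 : 1 < p) (cs : char_solution p u a b).
Notation F := (potential p).
Notation ep := (energy_plus p u a).

Let kappa (n : nat) (x t : R) := cut n%:R (t + x) * cut n%:R (t - x).

Let kappa_nd n k x t : (n <= k)%N -> kappa n x t <= kappa k x t.
Proof.
move=> nk; have nk' : n%:R <= k%:R :> R by rewrite ler_nat.
by apply: ler_pM; rewrite ?cut_ge0// cut_nd.
Qed.

Let kappa_eq1 x t : exists n, forall k, (n <= k)%N -> kappa k x t = 1.
Proof.
exists (Num.bound (`|t| + `|x| + 1)) => k nk.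
have h : `|t| + `|x| + 1 < k%:R.
  apply: (lt_le_trans (archi_boundP _)); last by rewrite ler_nat.
  by rewrite !addr_ge0.
have := ler_norm t; have := ler_norm x; have := ler_norm (- x); rewrite normrN => *.
by rewrite /kappa !cut_eq1 ?mulr1//; lra.
Qed.

Let kappa_ge0 n x t : 0 <= kappa n x t.
Proof. by rewrite mulr_ge0// cut_ge0. Qed.

Let kappa_le1 n x t : kappa n x t <= 1.
Proof. by rewrite mulr_ile1// ?cut_ge0 ?cut_le1. Qed.

Let mcut n : measurable_fun [set: R] (@cut R n).
Proof. exact: bac_m (bounded_ac_cut n). Qed.

Lemma measurable_kappa n : measurable_fun [set: R * R] (fun z : R * R => kappa n z.1 z.2).
Proof.
apply: (@measurable_along _ (fun x e => cut n%:R x * cut n%:R e)).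
by apply: measurable_funM; apply: measurableT_comp => //; exact: mcut.
Qed.

Lemma energy_plus_ge0 x t : 0 <= ep x t.
Proof.
by rewrite /energy_plus addr_ge0// divr_ge0// ?sqr_ge0// potential_ge0.
Qed.

Lemma measurable_potential : measurable_fun [set: R] F.
Proof.
by apply: continuous_measurable_fun; exact: continuous_potential.
Qed.

Lemma measurable_Fu : measurable_fun [set: R * R] (fun z : R * R => F (u z.1 z.2)).
Proof.
apply: measurableT_comp; first exact: measurable_potential.
exact: continuous_plane_measurable (cs_cont cs).
Qed.

Lemma measurable_energy_plus :
  measurable_fun [set: R * R] (fun z : R * R => ep z.1 z.2).
Proof.
apply: measurable_funD; apply: measurable_funM => //.
  by apply: measurable_funX; exact: cs_ma cs.
exact: measurable_Fu.
Qed.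

Variables (T : R) (T0 : 0 <= T).

Let W0 (r : R) (f g : R -> R) (x e : R) := (f x * cut r x) * (g e * cut r e).

Let W0_supported r f g : supported (r + 1) (W0 r f g).
Proof.
move=> x e [h|h]; rewrite /W0; [rewrite (@cut_eq0 _ _ x)|rewrite (@cut_eq0 _ _ e)];
  by rewrite ?mulr0 ?mul0r//; lra.
Qed.

Let W0_admissible r (f g : R -> R) : measurable_fun [set: R] f -> measurable_fun [set: R] g ->
  (exists2 C, 0 <= C & forall s, `|f s| <= C) ->
  (exists2 C, 0 <= C & forall s, `|g s| <= C) ->
  admissible a b T (fun x t => along (W0 r f g) x t * F (u x t)).
Proof.
move=> mf mg [C C0 fC] [K K0 gK].
apply: (@admissible_along _ a b T T0 (W0 r f g) (fun x t => F (u x t)) (r + 1)) => //.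
- have mc := mcut r.
  by apply: measurable_funM; apply: measurable_funM; apply: measurableT_comp.
- have nc s : `|cut r s| <= 1 by rewrite ger0_norm ?cut_ge0 ?cut_le1.
  move=> r0; exists (C * K) => [|x e xr er]; first exact: mulr_ge0.
  rewrite /W0 !normrM.
  by apply: ler_pM; rewrite ?mulr_ge0// -[leRHS]mulr1; apply: ler_pM.
- exact: (locally_dominated_u T cs (continuous_potential p1)).
Qed.

Let W0_le r (f g : R -> R) x e : 0 <= f x -> 0 <= g e -> W0 r f g x e <= f x * g e.
Proof.
move=> f0 g0; rewrite /W0 mulrACA -[leRHS]mulr1; apply: ler_wpM2l; first by rewrite mulr_ge0.
by rewrite mulr_ile1// ?cut_ge0 ?cut_le1.
Qed.

Let dcut_eq0' (r s : R) : r < s -> dcut r s = 0.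
Proof.
move=> rs; rewrite /dcut /dclip; have [_|?] := ltP 0 (1 * s + (1 - r)); last lra.
by have [?|_] := leP (1 * s + (1 - r)) 1; [lra|rewrite !mulr0].
Qed.

(** If [f] increases and [g] decreases, the weight [f (t + x) g (t - x)] can
    only gain energy through the potential term: the cutoffs decrease in both
    null coordinates, so the remaining terms of the energy identity have a
    favourable sign. *)
Lemma monotone_energy (f f' g g' : R -> R) :
  bounded_ac f f' -> bounded_ac g g' ->
  (forall s, 0 <= f s) -> (forall s, 0 <= f' s) ->
  (forall s, 0 <= g s) -> (forall s, g' s <= 0) ->
  (\int[mu]_x (f (T + x) * g (T - x) * ep x T)%:E <=
   \int[mu]_x (f x * g (- x) * ep x 0)%:E +
   \int[mu2]_(z in slab T) (f' (z.2 + z.1) * g (z.2 - z.1) * F (u z.1 z.2))%:E)%E.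
Proof.
move=> bf bg f0 f'0 g0 g'0.
have mfg t : measurable_fun setT (fun x : R => f (t + x) * g (t - x)).
  apply: measurable_funM; apply: measurableT_comp; [exact: bac_m bf| |exact: bac_m bg|].
    exact: measurable_funD.
  exact: measurable_funB.
have mep t : measurable_fun setT (fun x : R => ep x t).
  exact: (measurable_slice t measurable_energy_plus).
have mS := @measurable_slab R T.
have mfg2 : measurable_fun [set: R * R] (fun z : R * R => f' (z.2 + z.1) * g (z.2 - z.1)).
  apply: (@measurable_along _ (fun x e => f' x * g e)).
  by apply: measurable_funM; apply: measurableT_comp => //;
    [exact: bac_m' bf|exact: bac_m bg].
apply: (@le_integral_exhaustion _ _ _ mu setT (fun n x => kappa n x T)) => //.
- by apply: measurable_funM; [exact: mfg|exact: mep].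
- by move=> n; exact: (measurable_slice T (measurable_kappa n)).
- by move=> x _; rewrite !mulr_ge0// energy_plus_ge0.
- by move=> n k x _; exact: kappa_nd.
move=> n; pose r : R := n%:R.
have bfc := bounded_acM bf (bounded_ac_cut r).
have bgc := bounded_acM bg (bounded_ac_cut r).
have wW := weight_tensor bfc bgc.
set W := (X in weight X _ _) in wW; set Wx := (X in weight _ X _) in wW.
set We := (X in weight _ _ X) in wW.
have c0 s : r <= s -> cut r s = 0 by exact: cut_eq0.
have dc0 s : r < s -> dcut r s = 0 by exact: dcut_eq0'.
have sW : supported (r + 1) W by exact: W0_supported.
have sWx : supported (r + 1) Wx.
  move=> x e [h|h]; have h' : r < x \/ r < e by [left; lra|right; lra].
    by rewrite /Wx (dc0 x) ?(c0 x) ?mulr0 ?addr0 ?mulr0 ?mul0r//; lra.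
  by rewrite /Wx (c0 e) ?mulr0//; lra.
have sWe : supported (r + 1) We.
  move=> x e [h|h].
    by rewrite /We (c0 x) ?mulr0 ?mul0r//; lra.
  by rewrite /We (dc0 e) ?(c0 e) ?mulr0 ?addr0 ?mulr0//; lra.
(* The part of the derivative of the weight that falls on [f]; what falls on
   the cutoff is nonpositive and is dropped. *)
pose W' := W0 r f' g.
have adW' : admissible a b T (fun x t => along W' x t * F (u x t)).
  apply: W0_admissible; [exact: bac_m' bf|exact: bac_m bg| |].
    by have [C C0 fC] := bac_bd bf; exists C => // s; have [] := fC s.
  by have [C C0 gC] := bac_bd bg; exists C => // s; have [] := gC s.
have E := energy_identity p1 cs T0 wW sW sWx sWe.
have aW := admissible_energy p1 cs T0 wW sW.
have iW t : 0 <= t <= T -> mu.-integrable setT (EFin \o (fun x => along W x t * ep x t)).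
  by move=> t0T; exact: (admissible_slice cs aW t0T).
have iR := admissible_integrable cs (admissible_energy_rate p1 cs T0 wW sWx sWe).
have iW' := admissible_integrable cs adW'.
have le1 : \int[mu]_x (along W x T * ep x T) <= \int[mu]_x (along W x 0 * ep x 0) +
    \int[mu2]_(z in slab T) (along W' z.1 z.2 * F (u z.1 z.2)).
  rewrite -lerBlDl E; apply: le_Rintegral => // -[x t] _ /=.
  have := potential_ge0 (u x t) p1; have := sqr_ge0 (a x t).
  rewrite /along; move: (t + x) (t - x) => X E'; move: (F _) (a x t ^+ 2) => Fu A A0 F0.
  rewrite -[leRHS]add0r lerD//.
    rewrite -mulrA; apply: mulr_le0_ge0; last by rewrite divr_ge0.
    rewrite /We; apply: mulr_ge0_le0; first by rewrite mulr_ge0// cut_ge0.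
    rewrite -[leRHS]addr0 lerD//; first by rewrite mulr_le0_ge0// cut_ge0.
    by rewrite mulr_ge0_le0// dcut_le0.
  apply: ler_wpM2r => //; rewrite /Wx /W' /W0; apply: ler_wpM2r.
    by rewrite mulr_ge0// cut_ge0.
  by rewrite gerDl mulr_ge0_le0// dcut_le0.
have -> : (\int[mu]_x (kappa n x T * (f (T + x) * g (T - x) * ep x T))%:E)%E =
    (\int[mu]_x (along W x T * ep x T))%:E.
  rewrite /Rintegral fineK; last first.
    by apply: integrable_fin_num => //; apply: iW; rewrite lexx T0.
  by apply: eq_integral => x _; congr EFin; rewrite /W /along /kappa; ring.
move: le1; rewrite -lee_fin => /le_trans; apply; rewrite EFinD.
apply: leeD.
- rewrite /Rintegral fineK; last first.
    by apply: integrable_fin_num => //; apply: iW; rewrite lexx T0.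
  apply: ge0_le_integral => //.
  + move=> x _; rewrite lee_fin /along /W; apply: mulr_ge0; last exact: energy_plus_ge0.
    by rewrite !mulr_ge0// cut_ge0.
  + by apply: measurable_int (iW 0 _); rewrite lexx T0.
  + apply/measurable_EFinP; apply: measurable_funM; last exact: mep.
    by have := mfg 0; apply: eq_measurable_fun => x _; rewrite add0r sub0r.
  + move=> x _; rewrite lee_fin /along /W add0r sub0r; apply: ler_wpM2r; first exact: energy_plus_ge0.
    rewrite mulrACA -[leRHS]mulr1; apply: ler_wpM2l; first by rewrite mulr_ge0.
    by rewrite mulr_ile1// ?cut_ge0 ?cut_le1.
- rewrite /Rintegral fineK; last by apply: integrable_fin_num.
  apply: ge0_le_integral => //.
  + move=> z _; rewrite lee_fin /along /W' /W0; apply: mulr_ge0; last exact: potential_ge0.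
    by rewrite !mulr_ge0// cut_ge0.
  + exact: measurable_int iW'.
  + apply/measurable_EFinP; apply: measurable_funTS; apply: measurable_funM => //.
    exact: measurable_Fu.
  + move=> z _; rewrite lee_fin /along /W'; apply: ler_wpM2r; first exact: potential_ge0.
    exact: W0_le.
Qed.

(** The energy crossing the strip where [f'] lives is at most the total
    energy: apply the identity to the weight [f - 1], whose value at the final
    time is nonpositive and at the initial time at least -1. *)
Lemma flux_bound (f f' : R -> R) : bounded_ac f f' ->
  (forall s, 0 <= f s <= 1) -> (forall s, 0 <= f' s) ->
  (\int[mu2]_(z in slab T) (f' (z.2 + z.1) * F (u z.1 z.2))%:E <=
   \int[mu]_x (ep x 0)%:E)%E.
Proof.
move=> bf f01 f'0; have mS := @measurable_slab R T.
have mf2 : measurable_fun [set: R * R] (fun z : R * R => f' (z.2 + z.1)).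
  apply: (@measurable_along _ (fun x e => f' x)).
  by apply: measurableT_comp => //; exact: bac_m' bf.
apply: (@le_integral_exhaustion _ _ _ mu2 (slab T) (fun n z => kappa n z.1 z.2)) => //.
- apply: measurable_funTS; apply: measurable_funM => //; exact: measurable_Fu.
- by move=> n; apply: measurable_funTS; exact: measurable_kappa.
- by move=> z _; rewrite mulr_ge0// potential_ge0.
- by move=> n k z _; exact: kappa_nd.
move=> n; pose r : R := n%:R.
have bfc := bounded_acM (bounded_ac_lin (-1) 1 bf) (bounded_ac_cut r).
have wW := weight_tensor bfc (bounded_acM (bounded_ac_cst 1) (bounded_ac_cut r)).
set W := (X in weight X _ _) in wW; set Wx := (X in weight _ X _) in wW.
set We := (X in weight _ _ X) in wW.
have sW : supported (r + 1) W by exact: W0_supported.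
have sWx : supported (r + 1) Wx.
  move=> x e [h|h].
    by rewrite /Wx (@dcut_eq0' _ x) ?(@cut_eq0 _ _ x) ?mulr0 ?addr0 ?mulr0 ?mul0r//; lra.
  by rewrite /Wx (@cut_eq0 _ _ e) ?mulr0//; lra.
have sWe : supported (r + 1) We.
  move=> x e [h|h].
    by rewrite /We (@cut_eq0 _ _ x) ?mulr0 ?mul0r//; lra.
  by rewrite /We (@dcut_eq0' _ e) ?mul0r ?mulr0 ?addr0 ?mulr0//; lra.
pose W' := W0 r f' (fun=> 1).
have adW' : admissible a b T (fun x t => along W' x t * F (u x t)).
  apply: W0_admissible => //; first exact: bac_m' bf.
    by have [C C0 fC] := bac_bd bf; exists C => // s; have [] := fC s.
  by exists 1 => // s; rewrite normr1.
have E := energy_identity p1 cs T0 wW sW sWx sWe.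
have aW := admissible_energy p1 cs T0 wW sW.
have iW t : 0 <= t <= T -> mu.-integrable setT (EFin \o (fun x => along W x t * ep x t)).
  by move=> t0T; exact: (admissible_slice cs aW t0T).
have iR := admissible_integrable cs (admissible_energy_rate p1 cs T0 wW sWx sWe).
have iW' := admissible_integrable cs adW'.
have fm s : -1 + 1 * f s <= 0.
  by rewrite mul1r addrC subr_le0; case/andP: (f01 s).
have Wle0 x e : W x e <= 0.
  rewrite /W; apply: mulr_le0_ge0; last by rewrite mul1r cut_ge0.
  by apply: mulr_le0_ge0 => //; exact: cut_ge0.
have Wge1 x e : -1 <= W x e.
  rewrite -lerN2 opprK (_ : - W x e = (1 - f x) * (cut r x * cut r e)); last first.
    by rewrite /W; ring.
  have /andP[f0 f1] := f01 x.
  rewrite mulr_ile1 ?subr_ge0 ?gerBl// ?mulr_ge0 ?cut_ge0//.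
  by rewrite mulr_ile1 ?cut_ge0 ?cut_le1.
have le1 : \int[mu2]_(z in slab T) (along W' z.1 z.2 * F (u z.1 z.2)) <=
    - \int[mu]_x (along W x 0 * ep x 0).
  apply: (@le_trans _ _ (\int[mu]_x (along W x T * ep x T) - \int[mu]_x (along W x 0 * ep x 0))).
    rewrite E; apply: le_Rintegral => // -[x t] _ /=.
    have := potential_ge0 (u x t) p1; have := sqr_ge0 (a x t).
    rewrite /along; move: (t + x) (t - x) => X E'; move: (F _) (a x t ^+ 2) => Fu A A0 F0.
    rewrite -[leLHS]add0r lerD//.
      rewrite -mulrA; apply: mulr_ge0; last by rewrite divr_ge0.
      rewrite /We mul0r add0r; apply: mulr_le0; last by rewrite mul1r dcut_le0.
      by apply: mulr_le0_ge0 => //; exact: cut_ge0.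
    apply: ler_wpM2r => //; rewrite /Wx /W' /W0; apply: ler_wpM2r.
      by rewrite mul1r cut_ge0.
    by rewrite (mul1r (f' X)) lerDl mulr_le0//; exact: dcut_le0.
  rewrite gerDr.
  rewrite -oppr_ge0; have iWT : mu.-integrable setT (EFin \o (fun x => along W x T * ep x T)).
    by apply: iW; rewrite lexx T0.
  rewrite -mulN1r -RintegralZl//; apply: Rintegral_ge0 => x _.
  by rewrite mulN1r oppr_ge0 mulr_le0_ge0// ?energy_plus_ge0//; exact: Wle0.
have -> : (\int[mu2]_(z in slab T) (kappa n z.1 z.2 * (f' (z.2 + z.1) * F (u z.1 z.2)))%:E)%E =
    (\int[mu2]_(z in slab T) (along W' z.1 z.2 * F (u z.1 z.2)))%:E.
  rewrite /Rintegral fineK; last by apply: integrable_fin_num.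
  by apply: eq_integral => z _; congr EFin; rewrite /W' /W0 /along /kappa; ring.
move: le1; rewrite -lee_fin => /le_trans; apply.
have iW0 : mu.-integrable setT (EFin \o (fun x => along W x 0 * ep x 0)).
  by apply: iW; rewrite lexx T0.
rewrite -mulN1r -RintegralZl// /Rintegral fineK; last first.
  by apply: integrable_fin_num => //; exact: integrable_EFinZ.
apply: ge0_le_integral => //.
- move=> x _; rewrite lee_fin mulN1r oppr_ge0 mulr_le0_ge0// ?energy_plus_ge0//; exact: Wle0.
- by apply: measurable_int; exact: integrable_EFinZ iW0.
- by apply/measurable_EFinP; exact: (measurable_slice 0 measurable_energy_plus).
- move=> x _; rewrite lee_fin mulrA -[leRHS]mul1r ler_wpM2r ?energy_plus_ge0//.
  by rewrite mulN1r lerNl; exact: Wge1.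
Qed.

Lemma energy_bound : (\int[mu]_x (ep x T)%:E <= \int[mu]_x (ep x 0)%:E)%E.
Proof.
have := @monotone_energy _ _ _ _ (bounded_ac_cst 1) (bounded_ac_cst 1) (fun=> ler01)
  (fun=> lexx _) (fun=> ler01) (fun=> lexx _).
have e t : (\int[mu]_x (1 * 1 * ep x t)%:E = \int[mu]_x (ep x t)%:E)%E.
  by apply: eq_integral => x _; rewrite !mul1r.
rewrite !e; congr (_ <= _)%E; rewrite -[RHS]adde0; congr (_ + _)%E.
by apply: integral0_eq => z _; rewrite !mul0r.
Qed.

End monotone_weights.

(** * Morawetz multipliers *)

Section morawetz_weights.
Context {R : realType}.
Implicit Types x e : R.

(** The inverse of [rho = sqrt (1 + xi^2 + eta^2)]; the 1 under the root keeps
    it smooth at the origin. *)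
Definition ir x e : R := (Num.sqrt (1 + x ^+ 2 + e ^+ 2))^-1.

Let rad_gt0 x e : 0 < 1 + x ^+ 2 + e ^+ 2.
Proof. by rewrite -addrA ltr_pwDl// addr_ge0// sqr_ge0. Qed.

Lemma ir_gt0 x e : 0 < ir x e.
Proof. by rewrite invr_gt0 sqrtr_gt0. Qed.

Lemma ir_sqr x e : ir x e ^+ 2 * (1 + x ^+ 2 + e ^+ 2) = 1.
Proof.
rewrite /ir exprVn sqr_sqrtr; last exact: ltW.
by rewrite mulVf// gt_eqF.
Qed.

Lemma ir_sqr_le1 x e : ir x e ^+ 2 <= 1.
Proof.
rewrite -(ir_sqr x e) ler_peMr ?sqr_ge0//.
by rewrite -addrA lerDl addr_ge0// sqr_ge0.
Qed.

Lemma ir_le1 x e : ir x e <= 1.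
Proof. by have := ir_sqr_le1 x e; rewrite expr_le1// ltW// ir_gt0. Qed.

Lemma ir_sym x e : ir x e = ir e x.
Proof. by rewrite /ir addrAC. Qed.

Lemma ir_sqrx x e : ir x e ^+ 2 * x ^+ 2 <= 1.
Proof.
rewrite -(ir_sqr x e) ler_wpM2l ?sqr_ge0//.
by have := sqr_ge0 x; have := sqr_ge0 e; lra.
Qed.

Lemma ir_normx x e : `|x * ir x e| <= 1.
Proof.
rewrite -(@ler_sqr _ `|_|) ?nnegrE// expr1n -normrX ger0_norm ?sqr_ge0//.
by rewrite exprMn mulrC ir_sqrx.
Qed.

Lemma is_derive_ir x e : is_derive x (1 : R) (ir^~ e) (- x * ir x e ^+ 3).
Proof.
have h1 : is_derive x (1 : R) (fun y : R => 1 + y ^+ 2 + e ^+ 2) (2 * x).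
  have h2 : is_derive x (1 : R) (fun y : R => y ^+ 2) (2 * x).
    have := is_deriveM (is_derive_id x (1 : R)) (is_derive_id x (1 : R)).
    move/is_derive_eq => /(_ (2 * x)); apply.
    by rewrite /GRing.scale/= mulr1 mulr_natl.
  rewrite (_ : (fun y : R => _) = cst (1 + e ^+ 2) + (fun y : R => y ^+ 2)); last first.
    by apply/funext => y; rewrite /cst fctE addrAC.
  have := is_deriveD (is_derive_cst (1 + e ^+ 2) x (1 : R)) h2.
  by rewrite add0r.
have h2 := @is_derive1_comp _ Num.sqrt (fun y : R => 1 + y ^+ 2 + e ^+ 2) _ _ _
  (is_derive1_sqrt (rad_gt0 x e)) h1.
have s0 : Num.sqrt (1 + x ^+ 2 + e ^+ 2) != 0 by rewrite gt_eqF// sqrtr_gt0.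
have /is_derive_eq := @is_deriveV _ (fun y : R => Num.sqrt (1 + y ^+ 2 + e ^+ 2)) _ _ _ s0 h2.
apply.
rewrite /ir /GRing.scale/=; set s := Num.sqrt _; have s0' : s != 0 by [].
by field.
Qed.

Lemma continuous_ir e : continuous (ir^~ e).
Proof.
move=> x; apply: differentiable_continuous; apply/derivable1_diffP.
by case: (is_derive_ir x e).
Qed.

Lemma measurable_ir : measurable_fun [set: R * R] (fun z : R * R => ir z.1 z.2).
Proof.
apply: continuous_plane_measurable => z; apply: cvgV.
  by rewrite gt_eqF// sqrtr_gt0.
apply: (@continuous_comp _ _ _ (fun z : R * R => 1 + z.1 ^+ 2 + z.2 ^+ 2)); last exact: sqrt_continuous.
apply: cvgD; first apply: cvgD; first exact: cvg_cst.
  by apply: cvgM; exact: cvg_fst.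
by apply: cvgM; exact: cvg_snd.
Qed.

Lemma weight_ir : weight ir (fun x e => - x * ir x e ^+ 3) (fun x e => - e * ir x e ^+ 3).
Proof.
have ac x e l r : ac_on l r (ir^~ e) (fun x => - x * ir x e ^+ 3).
  have cN : continuous (fun x => - x * ir x e ^+ 3).
    move=> y; apply: cvgM; first by apply: cvgN; exact: cvg_id.
    by apply: cvgM; [|apply: cvgM]; exact: continuous_ir.
  have := ac_on_comp (fun x => is_derive_ir x e) cN (ac_on_affine l r 1 0).
  by apply: eq_ac_on => y _; rewrite mul1r addr0 ?mulr1.
have bd x e : `|- x * ir x e ^+ 3| <= 1.
  rewrite mulNr normrN exprSr mulrA mulrAC normrM mulr_ile1// ?ir_normx//.
  by rewrite ger0_norm ?sqr_ge0// ir_sqr_le1.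
have mx3 : measurable_fun [set: R * R] (fun z : R * R => ir z.1 z.2 ^+ 3).
  by apply: measurable_funX; exact: measurable_ir.
split.
- exact: measurable_ir.
- by apply: measurable_funM => //; apply: measurable_funN; exact: measurable_fst.
- by apply: measurable_funM => //; apply: measurable_funN; exact: measurable_snd.
- move=> K; exists 1 => // x e _ _; split; last by rewrite ir_sym bd.
  + by rewrite ger0_norm ?ir_le1// ltW// ir_gt0.
  + exact: bd.
- by move=> e l r; exact: ac.
- move=> x l r; have := ac 0 x l r; apply: eq_ac_on => e _; first by rewrite ir_sym.
  by rewrite ir_sym.
Qed.

Lemma weight_fst (f f' : R -> R) : measurable_fun setT f -> measurable_fun setT f' ->
  (forall K : R, exists2 C, 0 <= C & forall x, `|x| <= K -> `|f x| <= C /\ `|f' x| <= C) ->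
  (forall l r, ac_on l r f f') ->
  weight (fun x _ => f x) (fun x _ => f' x) (fun _ _ => 0).
Proof.
move=> mf mf' bd ac; split => //.
- exact: measurableT_comp.
- exact: measurableT_comp.
- move=> K; have [C C0 HC] := bd K; exists C => // x e /HC[h1 h2] _.
  by rewrite normr0.
- by move=> x l r; exact: ac_on_cst.
Qed.

Lemma weight_swap (W Wx We : R -> R -> R) : weight W Wx We ->
  weight (fun x e => W e x) (fun x e => We e x) (fun x e => Wx e x).
Proof.
move=> [m1 m2 m3 bd ac1 ac2]; have ms : measurable_fun [set: R * R] (fun z : R * R => (z.2, z.1)).
  by apply/measurable_fun_pairP; split; [exact: measurable_snd|exact: measurable_fst].
split.
- exact: (measurableT_comp m1 ms).
- exact: (measurableT_comp m3 ms).
- exact: (measurableT_comp m2 ms).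
- move=> K; have [C C0 HC] := bd K; exists C => // x e xK eK.
  by have [] := HC e x eK xK.
- by move=> e l r; exact: ac2.
- by move=> e l r; exact: ac1.
Qed.

Lemma weight_id : weight (fun x _ : R => x) (fun _ _ => 1) (fun _ _ => 0).
Proof.
apply: (@weight_fst (fun x => x) (fun _ => 1)) => //.
- move=> K; exists (`|K| + 1); first by rewrite addr_ge0.
  by move=> x xK; have := ler_norm K; have := normr_ge0 K; rewrite normr1; split; lra.
- move=> l r; have := ac_on_affine l r 1 0.
  by apply: eq_ac_on => x _ //; rewrite mul1r addr0.
Qed.

Lemma weight_pos : weight (fun x _ : R => Num.max 0 x) (fun x _ => ((0 < x)%R)%:R)
  (fun _ _ => 0).
Proof.
apply: (@weight_fst (Num.max 0) (fun x => ((0 < x)%R)%:R)).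
- exact: measurable_maxr.
- rewrite (_ : (fun _ => _) = \1_(`]0, +oo[%classic)); first exact: measurable_indic.
  apply/funext => x; rewrite indicE; congr ((nat_of_bool _)%:R).
  by apply/idP/idP; rewrite inE/= in_itv/= andbT.
- move=> K; exists (`|K| + 1); first by rewrite addr_ge0.
  move=> x xK; have := ler_norm K; have := normr_ge0 K; have := ler_norm x => xx K0 KK; split.
    by have [x0|x0] := leP x 0; [rewrite normr0|rewrite ger0_norm]; lra.
  by case: (0 < x); rewrite ?normr1 ?normr0; lra.
- by move=> l r; exact: ac_on_posP.
Qed.

Definition mora_w x e := (-1 + 1 * (e * ir x e)).

Lemma mora_w_le0 x e : mora_w x e <= 0.
Proof.
have := ir_normx e x; rewrite ir_sym /mora_w ler_norml; lra.
Qed.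

Lemma mora_w_ge x e : -2 <= mora_w x e.
Proof.
have := ir_normx e x; rewrite ir_sym /mora_w ler_norml; lra.
Qed.

(** The multiplier inequality behind the Morawetz estimate inside the light
    cone: [X], [E], [i] are the null coordinates and [1 / rho], and [A], [B],
    [P] stand for [u_t + u_x], [u_t - u_x] and [F u]. The terms in [A^2],
    [B^2] and [A * B] form a nonnegative quadratic form, and [(p + 1) - 2 = p
    - 1] copies of [P] are left. *)
Lemma morawetz_interior (p X E i v A B P : R) : 0 < i -> 0 < X -> 0 < E ->
  i ^+ 2 * (1 + X ^+ 2 + E ^+ 2) = 1 -> 0 <= P ->
  (p - 1) * (X * E * i ^+ 3) * P - 4 * i ^+ 2 * `|v * A| <=
  (i - E ^+ 2 * i ^+ 3) * A ^+ 2 / 2 + (i - X ^+ 2 * i ^+ 3) * B ^+ 2 / 2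
  - 2 * (X * E * i ^+ 3) * P
  - (2 * (X * (i ^+ 3 - 3 * E ^+ 2 * i ^+ 5)) * (v * A) + X * E * i ^+ 3 * (A * B)
     - (p + 1) * (X * E * i ^+ 3) * P).
Proof.
move=> i0 X0 E0 iE P0.
have i1 : i = i ^+ 3 * (1 + X ^+ 2 + E ^+ 2) by rewrite exprSr mulrAC iE mul1r.
have sq : (i - E ^+ 2 * i ^+ 3) * A ^+ 2 / 2 + (i - X ^+ 2 * i ^+ 3) * B ^+ 2 / 2
    - X * E * i ^+ 3 * (A * B) = i ^+ 3 * ((X * A - E * B) ^+ 2 + A ^+ 2 + B ^+ 2) / 2.
  by rewrite {1 3}i1; field.
have sq0 : 0 <= i ^+ 3 * ((X * A - E * B) ^+ 2 + A ^+ 2 + B ^+ 2) / 2.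
  by rewrite divr_ge0// mulr_ge0 ?exprn_ge0 ?(ltW i0)// !addr_ge0// sqr_ge0.
have xi : X * i <= 1.
  have : (X * i) ^+ 2 <= 1.
    rewrite exprMn mulrC -[leRHS]iE ler_wpM2l ?sqr_ge0//.
    by rewrite addrAC lerDr addr_ge0// sqr_ge0.
  by rewrite expr_le1// mulr_ge0// ltW.
have ei : E ^+ 2 * i ^+ 2 <= 1.
  by rewrite mulrC -[leRHS]iE ler_wpM2l ?sqr_ge0// lerDr addr_ge0// sqr_ge0.
have ei0 : 0 <= E ^+ 2 * i ^+ 2 by rewrite mulr_ge0// sqr_ge0.
pose k := X * i * (1 - 3 * (E ^+ 2 * i ^+ 2)).
have k2 : `|k| <= 2.
  rewrite /k normrM; apply: (@le_trans _ _ (1 * 2)); last by rewrite mul1r.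
  apply: ler_pM => //; first by rewrite ger0_norm// mulr_ge0// ltW.
  by rewrite ler_norml; apply/andP; split; lra.
have kE : X * (i ^+ 3 - 3 * E ^+ 2 * i ^+ 5) * (v * A) = i ^+ 2 * (k * (v * A)).
  by rewrite /k; ring.
have kb : k * (v * A) <= 2 * `|v * A|.
  by rewrite (le_trans (ler_norm _))// normrM ler_wpM2r.
have kb' : i ^+ 2 * (k * (v * A)) <= i ^+ 2 * (2 * `|v * A|).
  by rewrite ler_wpM2l// sqr_ge0.
have -> : 2 * (X * (i ^+ 3 - 3 * E ^+ 2 * i ^+ 5)) * (v * A) = 2 * (i ^+ 2 * (k * (v * A))).
  by rewrite -kE; ring.
have alg (a1 a2 a3 a4 a5 : R) : a1 + a2 - a4 = a5 -> 0 <= a5 -> forall m1 m2 m3 n1 n2 : R,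
  n1 <= n2 -> m1 = m3 - m2 -> m1 - 2 * n2 <= a1 + a2 - m2 - (2 * n1 + a4 - m3).
  by move=> *; lra.
have := alg _ _ 0 _ _ sq sq0 ((p - 1) * (X * E * i ^+ 3) * P)
  (2 * (X * E * i ^+ 3) * P) ((p + 1) * (X * E * i ^+ 3) * P) _ _ kb' ltac:(ring).
by rewrite (_ : 2 * (i ^+ 2 * (2 * `|v * A|)) = 4 * i ^+ 2 * `|v * A|)//; ring.
Qed.

(** Outside the light cone [X * E <= 0], where every term is nonnegative by
    itself. *)
Lemma morawetz_exterior (X E i A B P : R) : 0 <= i -> X * E <= 0 ->
  i ^+ 2 * (1 + X ^+ 2 + E ^+ 2) = 1 -> 0 <= P ->
  0 <= (i - E ^+ 2 * i ^+ 3) * A ^+ 2 / 2 + (i - X ^+ 2 * i ^+ 3) * B ^+ 2 / 2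
  - 2 * (X * E * i ^+ 3) * P.
Proof.
move=> i0 XE iE P0.
have i1 : i = i ^+ 3 * (1 + X ^+ 2 + E ^+ 2) by rewrite exprSr mulrAC iE mul1r.
have -> : (i - E ^+ 2 * i ^+ 3) * A ^+ 2 / 2 + (i - X ^+ 2 * i ^+ 3) * B ^+ 2 / 2
  - 2 * (X * E * i ^+ 3) * P = i ^+ 3 * ((1 + X ^+ 2) * A ^+ 2 / 2 +
    (1 + E ^+ 2) * B ^+ 2 / 2 + 2 * (- (X * E) * P)).
  by rewrite {1 3}i1; field.
rewrite mulr_ge0 ?exprn_ge0// !addr_ge0//.
- by rewrite divr_ge0// mulr_ge0 ?sqr_ge0// addr_ge0 ?sqr_ge0.
- by rewrite divr_ge0// mulr_ge0 ?sqr_ge0// addr_ge0 ?sqr_ge0.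
- by rewrite !mulr_ge0// oppr_ge0.
Qed.

End morawetz_weights.

Section morawetz.
Context {R : realType}.
Notation mu := (@lebesgue_measure R).
Notation mu2 := (mu \x mu)%E.

Lemma dcut_eq0_gt (r s : R) : r < s -> dcut r s = 0.
Proof.
move=> rs; rewrite /dcut /dclip; have [_|?] := ltP 0 (1 * s + (1 - r)); last lra.
by have [?|_] := leP (1 * s + (1 - r)) 1; [lra|rewrite !mulr0].
Qed.

Section weights.
Variable r : R.

(** The weight [eta / rho - 1] with cutoffs. Subtracting 1 makes it
    nonpositive, so that the cutoffs, which decrease, contribute with the
    right sign to both derivatives. *)
Definition mW (x e : R) := (-1 + 1 * (e * ir x e)) * (cut r x * cut r e).
Definition mWx (x e : R) := (1 * (0 * ir x e + e * (- x * ir x e ^+ 3))) * (cut r x * cut r e) +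
  (-1 + 1 * (e * ir x e)) * (dcut r x * cut r e).
Definition mWe (x e : R) := (1 * (1 * ir x e + e * (- e * ir x e ^+ 3))) * (cut r x * cut r e) +
  (-1 + 1 * (e * ir x e)) * (cut r x * dcut r e).

(** The function [xi_+ eta_+ / rho^3] with cutoffs, the weight of the virial
    term. *)
Definition mC (x e : R) := Num.max 0 x * Num.max 0 e * (ir x e * (ir x e * ir x e)) *
  (cut r x * cut r e).
(** The density of the virial weight in its second variable, in the form
    produced by the product rule. *)
Definition mCe (x e : R) :=
  ((0 * Num.max 0 e + Num.max 0 x * ((0 < e)%R)%:R) * (ir x e * (ir x e * ir x e)) +
   Num.max 0 x * Num.max 0 e *
   ((- e * ir x e ^+ 3) * (ir x e * ir x e) +
    ir x e * ((- e * ir x e ^+ 3) * ir x e + ir x e * (- e * ir x e ^+ 3)))) *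
  (cut r x * cut r e) +
  Num.max 0 x * Num.max 0 e * (ir x e * (ir x e * ir x e)) * (cut r x * dcut r e).

Lemma weight_mW : weight mW mWx mWe.
Proof.
exact: (weightM (weight_lin (-1) 1 (weightM (weight_swap (@weight_id R)) (@weight_ir R)))
  (weight_tensor (bounded_ac_cut r) (bounded_ac_cut r))).
Qed.

Lemma weight_mC : exists Cx, weight mC Cx mCe.
Proof.
eexists; exact: (weightM (weightM (weightM (@weight_pos R) (weight_swap (@weight_pos R)))
    (weightM (@weight_ir R) (weightM (@weight_ir R) (@weight_ir R))))
  (weight_tensor (bounded_ac_cut r) (bounded_ac_cut r))).
Qed.

Let z0 s : r < s -> cut r s = 0 /\ dcut r s = 0.
Proof. by move=> rs; rewrite cut_eq0 ?ltW// dcut_eq0_gt. Qed.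

Let supp (W : R -> R -> R) (f g h : R -> R -> R) :
  (forall x e, W x e = f x e * (cut r x * cut r e) + g x e * (dcut r x * cut r e) +
    h x e * (cut r x * dcut r e)) -> supported (r + 1) W.
Proof.
have r1 : r < r + 1 by rewrite ltrDl.
move=> WE x e [h1|h1]; have [c0 d0] := z0 (lt_le_trans r1 h1).
  by rewrite WE c0 d0 !(mul0r, mulr0, addr0).
by rewrite WE c0 d0 !(mul0r, mulr0, addr0).
Qed.

Lemma supported_mW : supported (r + 1) mW.
Proof.
by apply: (@supp _ (fun x e => -1 + 1 * (e * ir x e)) (fun _ _ => 0) (fun _ _ => 0)) => // x e;
  rewrite /mW; ring.
Qed.

Lemma supported_mWx : supported (r + 1) mWx.
Proof.
by apply: (@supp _ (fun x e => 1 * (0 * ir x e + e * (- x * ir x e ^+ 3)))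
  (fun x e => -1 + 1 * (e * ir x e)) (fun _ _ => 0)) => // x e; rewrite /mWx; ring.
Qed.

Lemma supported_mWe : supported (r + 1) mWe.
Proof.
by apply: (@supp _ (fun x e => 1 * (1 * ir x e + e * (- e * ir x e ^+ 3)))
  (fun _ _ => 0) (fun x e => -1 + 1 * (e * ir x e))) => // x e; rewrite /mWe; ring.
Qed.

Lemma supported_mC : supported (r + 1) mC.
Proof.
by apply: (@supp _ (fun x e => Num.max 0 x * Num.max 0 e * (ir x e * (ir x e * ir x e)))
  (fun _ _ => 0) (fun _ _ => 0)) => // x e; rewrite /mC; ring.
Qed.

Lemma supported_mCe : supported (r + 1) mCe.
Proof.
apply: (@supp _ (fun x e => ((0 * Num.max 0 e + Num.max 0 x * ((0 < e)%R)%:R) * (ir x e * (ir x e * ir x e)) +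
   Num.max 0 x * Num.max 0 e *
   ((- e * ir x e ^+ 3) * (ir x e * ir x e) +
    ir x e * ((- e * ir x e ^+ 3) * ir x e + ir x e * (- e * ir x e ^+ 3)))))
  (fun _ _ => 0) (fun x e => Num.max 0 x * Num.max 0 e * (ir x e * (ir x e * ir x e)))) => // x e.
by rewrite /mCe (mul0r (dcut r x * _)) addr0.
Qed.

Let cc0 x e : 0 <= cut r x * cut r e. Proof. by rewrite mulr_ge0// cut_ge0. Qed.

Lemma mWx_ge x e : - (x * e * ir x e ^+ 3) * (cut r x * cut r e) <= mWx x e.
Proof.
rewrite /mWx (_ : 1 * (0 * _ + _) = - (x * e * ir x e ^+ 3)); last by ring.
rewrite lerDl mulr_le0 ?mora_w_le0//.
by rewrite mulr_le0_ge0 ?dcut_le0 ?cut_ge0.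
Qed.

Lemma mWe_ge x e : (ir x e - e ^+ 2 * ir x e ^+ 3) * (cut r x * cut r e) <= mWe x e.
Proof.
rewrite /mWe (_ : 1 * (1 * _ + _) = ir x e - e ^+ 2 * ir x e ^+ 3); last by ring.
rewrite lerDl mulr_le0 ?mora_w_le0//.
by rewrite mulr_ge0_le0 ?dcut_le0 ?cut_ge0.
Qed.

Lemma mW_le0 x e : mW x e <= 0.
Proof. by rewrite /mW mulr_le0_ge0 ?mora_w_le0. Qed.

Lemma mW_ge x e : -2 <= mW x e.
Proof.
rewrite /mW; have := mora_w_ge x e; have := mora_w_le0 x e; rewrite /mora_w.
have : cut r x * cut r e <= 1 by rewrite mulr_ile1 ?cut_ge0 ?cut_le1.
have := cc0 x e; move: (cut r x * _) (-1 + _) => c w *; nra.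
Qed.

Lemma mC_ge0 x e : 0 <= mC x e.
Proof.
by rewrite /mC !mulr_ge0 ?cut_ge0 ?(ltW (ir_gt0 _ _))// le_max lexx.
Qed.

Lemma mC_eq0 x e : x <= 0 \/ e <= 0 -> mC x e = 0.
Proof. by move=> [h|h]; rewrite /mC (max_l h) !(mul0r, mulr0). Qed.

Lemma mC_cone x e : 0 < x -> 0 < e -> x <= r - 1 -> e <= r - 1 ->
  mC x e = x * e * ir x e ^+ 3.
Proof.
move=> x0 e0 xr er; rewrite /mC !cut_eq1// !max_r ?ltW//; ring.
Qed.

Lemma mC_le x e : mC x e <= ir x e.
Proof.
have i0 := ltW (ir_gt0 x e).
have [x0|x0] := leP x 0; first by rewrite mC_eq0//; left.
have [e0|e0] := leP e 0; first by rewrite mC_eq0//; right.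
rewrite /mC (max_r (ltW x0)) (max_r (ltW e0)).
have -> : x * e * (ir x e * (ir x e * ir x e)) * (cut r x * cut r e) =
  ir x e * (ir x e * x * (ir x e * e) * (cut r x * cut r e)) by ring.
have h1 := le_trans (ler_norm _) (ir_normx x e).
have h2 := le_trans (ler_norm _) (ir_normx e x).
rewrite ler_piMr// mulr_ile1//.
- by rewrite !mulr_ge0// ltW.
- by rewrite mulr_ile1 ?mulr_ge0 ?(ltW x0) ?(ltW e0)// mulrC// ir_sym.
- by rewrite mulr_ile1 ?cut_ge0 ?cut_le1.
Qed.

(** In [0 <= x + e <= r - 1], that is for times at most [(r - 1) / 2], the
    cutoffs equal 1 inside the light cone. Outside it they need not, but there
    the virial weight vanishes and the other terms are nonnegative multiples
    of the cutoff. *)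
Lemma mora_pointwise (p x e v A B P : R) : 0 <= x + e -> x + e <= r - 1 -> 0 <= P ->
  (p - 1) * mC x e * P - 4 * (ir x e ^+ 2 * `|v * A| * ((0 < x) && (0 < e))%R%:R) <=
  mWe x e * A ^+ 2 / 2 + mWx x e * P + (mWe e x * B ^+ 2 / 2 + mWx e x * P)
  - (2 * mCe x e * (v * A) + mC x e * (A * B) - (p + 1) * mC x e * P).
Proof.
move=> xe0 xer P0.
have lo : (ir x e - e ^+ 2 * ir x e ^+ 3) * (cut r x * cut r e) * A ^+ 2 / 2 +
   - (x * e * ir x e ^+ 3) * (cut r x * cut r e) * P +
   ((ir x e - x ^+ 2 * ir x e ^+ 3) * (cut r x * cut r e) * B ^+ 2 / 2 +
   - (x * e * ir x e ^+ 3) * (cut r x * cut r e) * P) <=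
   mWe x e * A ^+ 2 / 2 + mWx x e * P + (mWe e x * B ^+ 2 / 2 + mWx e x * P).
  have h1 := mWe_ge e x; have h2 := mWx_ge e x; rewrite ir_sym (mulrC (cut r e)) in h1 h2.
  rewrite (mulrC e x) in h2.
  apply: lerD; apply: lerD.
  - by rewrite ler_pM2r// ler_wpM2r ?sqr_ge0// mWe_ge.
  - by apply: ler_wpM2r => //; exact: mWx_ge.
  - by rewrite ler_pM2r// ler_wpM2r ?sqr_ge0.
  - by apply: ler_wpM2r.
have [/andP[x0 e0]|ext] := boolP ((0 < x) && (0 < e)).
  have xr : x <= r - 1 by lra.
  have er : e <= r - 1 by lra.
  rewrite mulr1 mC_cone//.
  have -> : mCe x e = x * (ir x e ^+ 3 - 3 * e ^+ 2 * ir x e ^+ 5).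
    rewrite /mCe !cut_eq1// dcut_eq0// e0 (_ : true%:R = 1)// !max_r ?ltW//; ring.
  move: lo; rewrite !cut_eq1// => lo.
  have := morawetz_interior p v A B (ir_gt0 x e) x0 e0 (ir_sqr x e) P0.
  have -> : 4 * (ir x e ^+ 2 * `|v * A|) = 4 * ir x e ^+ 2 * `|v * A| by rewrite mulrA.
  move=> /le_trans; apply; apply: lerB => //; move: lo; rewrite !mulr1; apply: le_trans.
  rewrite le_eqVlt; apply/orP; left; apply/eqP; ring.
have c0 : mC x e = 0.
  apply: mC_eq0; move: ext; rewrite negb_and -!leNgt => /orP[]; by [left|right].
have ce0 : mCe x e = 0.
  rewrite /mCe; move: ext; rewrite negb_and -!leNgt => /orP[h|h].
    by rewrite (max_l h) !(mul0r, mulr0, addr0).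
  by rewrite (max_l h) ltNge h !(mul0r, mulr0, addr0).
rewrite c0 ce0 !(mul0r, mulr0, subr0, addr0).
apply: le_trans lo.
have xe : x * e <= 0.
  move: ext; rewrite negb_and -!leNgt => /orP[h|h].
    by apply: mulr_le0_ge0 => //; lra.
  by apply: mulr_ge0_le0 => //; lra.
have := morawetz_exterior A B (ltW (ir_gt0 x e)) xe (ir_sqr x e) P0.
move/(mulr_ge0 (cc0 x e)) => /le_trans; apply.
rewrite le_eqVlt; apply/orP; left; apply/eqP; ring.
Qed.

End weights.
End morawetz.

(** * Decay in time *)

Section decay.
Context {R : realType}.
Notation mu := (@lebesgue_measure R).
Notation mu2 := (mu \x mu)%E.

(** The rate [(1 + t)^(-1/2)], defined for all real [t] so as to be
    continuous: its third power is integrable and bounds the space integrals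
    of the Morawetz error. *)
Definition decay (t : R) := (Num.sqrt (1 + `|t|))^-1.

Lemma decay_gt0 t : 0 < decay t.
Proof. by rewrite invr_gt0 sqrtr_gt0 ltr_pwDl. Qed.

Lemma decay_sqr t : 0 <= t -> decay t ^+ 2 * (1 + t) = 1.
Proof.
move=> t0; rewrite /decay exprVn sqr_sqrtr; last by rewrite addr_ge0.
by rewrite ger0_norm// mulVf// gt_eqF// ltr_pwDl.
Qed.

Lemma decay_sqr_le1 t : decay t ^+ 2 <= 1.
Proof.
rewrite /decay exprVn sqr_sqrtr; last by rewrite addr_ge0.
by rewrite invf_le1 ?lerDl// ltr_pwDl.
Qed.

Lemma continuous_decay : continuous decay.
Proof.
move=> t; apply: cvgV; first by rewrite gt_eqF// sqrtr_gt0 ltr_pwDl.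
apply: (@continuous_comp _ _ _ (fun z : R => 1 + `|z|)); last exact: sqrt_continuous.
by apply: cvgD; [exact: cvg_cst|exact: norm_continuous].
Qed.

(** A primitive of [(1 + t)^(-3/2)] is [- 2 (1 + t)^(-1/2)]. *)
Lemma integral_decay3 (T : R) : 0 <= T ->
  (\int[mu]_(t in `[0%R, T]) (decay t ^+ 3)%:E <= 2%:E)%E.
Proof.
rewrite le_eqVlt => /predU1P[<-|T0].
  by rewrite set_itv1 integral_set1.
pose W (t : R) := (Num.sqrt (1 + t))^-1.
have dW (t : R) : 0 < t -> is_derive t (1 : R) (fun s => -2 * W s) (decay t ^+ 3).
  move=> t0; have t1 : 0 < 1 + t by lra.
  have h1 : is_derive t (1 : R) (fun s : R => 1 + s) 1.
    have := is_deriveD (is_derive_cst (1 : R) t (1 : R)) (is_derive_id t (1 : R)).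
    by rewrite add0r.
  have h2 := @is_derive1_comp _ Num.sqrt (fun y : R => 1 + y) _ _ _ (is_derive1_sqrt t1) h1.
  have s0 : Num.sqrt (1 + t) != 0 by rewrite gt_eqF// sqrtr_gt0.
  have h3 := @is_deriveV _ (fun y : R => Num.sqrt (1 + y)) _ _ _ s0 h2.
  have /is_derive_eq := is_deriveZ (-2) h3; apply.
  rewrite /decay /GRing.scale/= mulr1 (ger0_norm (ltW t0)).
  by set s := Num.sqrt _; have s0' : s != 0 by []; field.
have cW (t : R) : 0 <= t -> {for t, continuous (fun s => -2 * W s)}.
  move=> t0; apply: cvgM; first exact: cvg_cst.
  apply: cvgV; first by rewrite gt_eqF// sqrtr_gt0 ltr_pwDl.
  apply: (@continuous_comp _ _ _ (fun z : R => 1 + z)); last exact: sqrt_continuous.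
  by apply: cvgD; [exact: cvg_cst|exact: cvg_id].
rewrite (@continuous_FTC2 _ (fun t => decay t ^+ 3) (fun s => -2 * W s) 0 T T0).
- rewrite -EFinD lee_fin /W addr0 sqrtr1 invr1.
  have : 0 <= (Num.sqrt (1 + T))^-1 by rewrite invr_ge0 sqrtr_ge0.
  lra.
- apply: continuous_subspaceT => t; rewrite /continuous_at.
  by apply: cvgM; [|apply: cvgM]; exact: continuous_decay.
- split.
  + by move=> t; rewrite in_itv/= => /andP[t0 _]; case: (dW t t0).
  + by apply: cvg_at_right_filter; exact: cW.
  + by apply: cvg_at_left_filter; apply: cW; exact: ltW.
- move=> t; rewrite in_itv/= => /andP[t0 _].
  by rewrite derive1E; have h := dW t t0; rewrite derive_val.
Qed.

Lemma ge0_integral_slab (f : R * R -> \bar R) T : measurable_fun [set: R * R] f ->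
  (forall z, 0 <= f z)%E ->
  (\int[mu2]_(z in slab T) f z = \int[mu]_(t in `[0%R, T]) \int[mu]_x f (x, t))%E.
Proof.
move=> mf f0; have mS := @measurable_slab R T.
rewrite integral_mkcond fubini_tonelli2//; last 2 first.
- exact/(measurable_restrictT _ mS)/measurable_funTS.
- by move=> z; rewrite erestrict_ge0.
rewrite [RHS]integral_mkcond; apply: eq_integral => t _; rewrite /fubini_G patchE.
case: ifPn => tT.
  apply: eq_integral => x _; rewrite patchE ifT// inE /slab; split => //=.
  by rewrite inE in tT.
apply: integral0_eq => x _; rewrite patchE ifF//; apply/negbTE; rewrite notin_setE /slab => -[_ /=].
by move=> h; move: tT; rewrite notin_setE.
Qed.

Lemma sqr_le_potential (p x : R) : 1 < p -> x ^+ 2 <= 1 + (p + 1) * potential p x.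
Proof.
move=> p1; rewrite /potential mulrA mulfV ?mul1r; last by rewrite gt_eqF//; lra.
rewrite -real_normK ?num_real//.
have [x1|x1] := leP `|x| 1.
  by rewrite ler_wpDr ?powR_ge0// expr_le1.
rewrite ler_wpDl// -powR_mulrn//; apply: ler_powR; first exact: ltW.
lra.
Qed.

End decay.

(** * The Morawetz estimate *)

Section morawetz_estimate.
Context {R : realType}.
Notation mu := (@lebesgue_measure R).
Notation mu2 := (mu \x mu)%E.
Variable p : R.
Hypothesis p1 : 1 < p.
Notation F := (potential p).
Let pp : 0 <= p + 1. Proof. by have := p1; lra. Qed.
Implicit Types u a b : R -> R -> R.

Lemma integrable_energy0 u a b : char_solution p u a b ->
  mu.-integrable setT (EFin \o (energy_plus p u a)^~ 0).
Proof.
move=> cs; apply: eq_integrable (integrable_EFinD measurableT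
  (integrable_EFinZ measurableT 4^-1 (cs_a2_0 cs))
  (integrable_EFinZ measurableT 2^-1 (cs_F_0 cs))) => // x _.
by rewrite /energy_plus /=; congr EFin; ring.
Qed.

Lemma integrable_energy u a b (t : R) : char_solution p u a b -> 0 <= t ->
  mu.-integrable setT (EFin \o (energy_plus p u a)^~ t).
Proof.
move=> cs t0; apply/integrableP; split.
  by apply/measurable_EFinP; exact: (measurable_slice t (measurable_energy_plus p1 cs)).
under eq_integral => x _ do rewrite /= ger0_norm ?energy_plus_ge0//.
apply: le_lt_trans (energy_bound p1 cs t0) _.
have /integrableP[_] := integrable_energy0 cs.
by under eq_integral => x _ do rewrite /= ger0_norm ?energy_plus_ge0//.
Qed.

Lemma energy_le u a b (t : R) : char_solution p u a b -> 0 <= t ->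
  \int[mu]_x energy_plus p u a x t <= \int[mu]_x energy_plus p u a x 0.
Proof.
move=> cs t0; apply: fine_le; last exact: (energy_bound p1 cs t0).
- by apply: integrable_fin_num => //; exact: integrable_energy cs t0.
- by apply: integrable_fin_num => //; exact: integrable_energy cs (lexx 0).
Qed.

(** By the inequality of arithmetic and geometric means [|v A| / rho] is
    controlled by [A^2] and [v^2 / rho^2], and [v^2 <= 1 + (p + 1) F v]; in
    the cone at time [T] the constant 1 contributes [1 / (2 rho^2)], with
    [rho^2 >= 1 + 2 T^2]. *)
Lemma boundary_pointwise (r T x v A : R) :
  - (mC r (T + x) (T - x) * (v * A)) <=
  (p + 1) * (A ^+ 2 / 4 + F v / 2) + (2 * (1 + 2 * T ^+ 2))^-1 * \1_(`[- T, T]%classic) x.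
Proof.
have [k kE] : exists k, k = (2 * (1 + 2 * T ^+ 2))^-1 by eexists.
rewrite -kE.
have F0 := potential_ge0 v p1; have uF := sqr_le_potential v p1.
have A0 := sqr_ge0 A.
have T20 := sqr_ge0 T; have T2 : 0 < 1 + 2 * T ^+ 2 by lra.
have k0 : 0 <= k by rewrite kE invr_ge0 mulr_ge0// ltW.
have rhs0 : 0 <= (p + 1) * (A ^+ 2 / 4 + F v / 2) + k * \1_(`[- T, T]%classic) x.
  by rewrite addr_ge0// mulr_ge0// addr_ge0// divr_ge0.
have [x0|x0] := leP (T + x) 0; first by rewrite mC_eq0 ?mul0r ?oppr0//; left.
have [e0|e0] := leP (T - x) 0; first by rewrite mC_eq0 ?mul0r ?oppr0//; right.
rewrite indicE mem_set ?mulr1; last by rewrite /= in_itv/=; apply/andP; split; lra.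
have i0 := ltW (ir_gt0 (T + x) (T - x)); have i1 := ir_sqr_le1 (T + x) (T - x).
have iE := ir_sqr (T + x) (T - x); have Ci := mC_le r (T + x) (T - x).
have C0 := mC_ge0 r (T + x) (T - x).
move: iE i0 i1 Ci C0; set i := ir _ _; set C := mC _ _ _ => iE i0 i1 Ci C0.
have ik : i ^+ 2 / 2 <= k.
  rewrite kE invfM [leRHS]mulrC ler_pM2r// -[leRHS]mul1r ler_pdivlMr//.
  rewrite -[leRHS]iE; apply: ler_wpM2l; first exact: sqr_ge0.
  have := sqr_ge0 x; rewrite !expr2; lra.
move: F0 uF; set P := F v => F0 uF.
apply: (@le_trans _ _ (i * `|v * A|)).
  by rewrite (le_trans (ler_norm _))// normrN normrM ger0_norm// ler_wpM2r.
have h1 : i * `|v * A| <= (i ^+ 2 * v ^+ 2 + A ^+ 2) / 2.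
  have := sqr_ge0 (i * `|v| - `|A|); rewrite normrM.
  rewrite sqrrB exprMn !real_normK ?num_real// -mulr_natr; lra.
have h2 : i ^+ 2 * v ^+ 2 <= i ^+ 2 + (p + 1) * P.
  apply: (@le_trans _ _ (i ^+ 2 * (1 + (p + 1) * P))).
    by apply: ler_wpM2l => //; exact: sqr_ge0.
  by rewrite mulrDr mulr1 lerD2l ler_piMl// mulr_ge0.
have h3 : A ^+ 2 / 2 <= (p + 1) * (A ^+ 2 / 4).
  have : 0 <= (p - 1) * (A ^+ 2 / 4) by rewrite mulr_ge0 ?subr_ge0 ?divr_ge0// ltW.
  lra.
lra.
Qed.

Section one_time.
Variables (T : R) (T0 : 0 <= T).
(* With this radius the cutoffs are equal to 1 in the light cone up to time
   [T], where both null coordinates are at most [2 * T]. *)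
Let r := 2 * T + 1.

(** The weight lies between -2 and 0, so its energy at the final time may be
    dropped and at the initial time costs twice the energy. *)
Lemma morawetz_energy_rate u a b : char_solution p u a b ->
  \int[mu2]_(z in slab T) (along (mWe r) z.1 z.2 * a z.1 z.2 ^+ 2 / 2 +
     along (mWx r) z.1 z.2 * F (u z.1 z.2)) <= 2 * \int[mu]_x energy_plus p u a x 0.
Proof.
move=> cs; have w := weight_mW r; have sW := @supported_mW _ r.
rewrite -(energy_identity p1 cs T0 w sW (@supported_mWx _ r) (@supported_mWe _ r)).
have aW := admissible_energy p1 cs T0 w sW.
have iT : mu.-integrable setT (EFin \o (fun x => along (mW r) x T * energy_plus p u a x T)).
  by apply: (admissible_slice cs aW); rewrite T0 lexx.
have i0 : mu.-integrable setT (EFin \o (fun x => along (mW r) x 0 * energy_plus p u a x 0)).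
  by apply: (admissible_slice cs aW); rewrite T0 lexx.
have h1 : \int[mu]_x (along (mW r) x T * energy_plus p u a x T) <= 0.
  rewrite -oppr_ge0 -mulN1r -RintegralZl//; apply: Rintegral_ge0 => x _.
  by rewrite mulN1r oppr_ge0 mulr_le0_ge0 ?energy_plus_ge0// mW_le0.
have h2 : - (2 * \int[mu]_x energy_plus p u a x 0) <=
    \int[mu]_x (along (mW r) x 0 * energy_plus p u a x 0).
  have ie := integrable_energy0 cs.
  rewrite -mulNr -RintegralZl//; apply: le_Rintegral => //.
    exact: integrable_EFinZ.
  by move=> x _; rewrite ler_wpM2r ?energy_plus_ge0// mW_ge.
by rewrite -[leRHS]add0r; apply: lerD => //; rewrite lerNl.
Qed.

Lemma morawetz_boundary u a b : char_solution p u a b ->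
  - (\int[mu]_x (along (mC r) x T * (u x T * a x T))) <=
  (p + 1) * \int[mu]_x energy_plus p u a x 0 + 1.
Proof.
move=> cs; have [Cx w] := weight_mC r; have sC := @supported_mC _ r.
have aC := admissible_virial cs T0 w sC.
have iC : mu.-integrable setT (EFin \o (fun x => along (mC r) x T * (u x T * a x T))).
  by apply: (admissible_slice cs aC); rewrite T0 lexx.
have ie := integrable_energy cs T0.
pose k := (2 * (1 + 2 * T ^+ 2))^-1.
have k0 : 0 <= k by rewrite invr_ge0 mulr_ge0// addr_ge0// mulr_ge0// sqr_ge0.
have mI : measurable (`[- T, T]%classic : set R) by exact: measurable_itv.
have finI : mu (`[- T, T]%classic : set R) = (2 * T)%:E.
  move: T0; rewrite le_eqVlt => /predU1P[<-|T1].
    by rewrite oppr0 set_itv1 lebesgue_measure_set1 mulr0.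
  rewrite lebesgue_measure_itv/= ifT; last by rewrite lte_fin gtrN.
  by rewrite -EFinD opprK mulr_natl mulr2n.
have iI : mu.-integrable setT (EFin \o (\1_(`[- T, T]%classic) : R -> R)).
  by apply: integrable_indic_itv.
have le1 : - (\int[mu]_x (along (mC r) x T * (u x T * a x T))) <=
    \int[mu]_x ((p + 1) * energy_plus p u a x T + k * \1_(`[- T, T]%classic) x).
  rewrite -mulN1r -RintegralZl//; apply: le_Rintegral => //.
  - exact: integrable_EFinZ.
  - by apply: integrable_EFinD => //; exact: integrable_EFinZ.
  by move=> x _; rewrite mulN1r; exact: boundary_pointwise.
apply: (le_trans le1); rewrite RintegralD//; last 2 first.
- exact: integrable_EFinZ.
- exact: integrable_EFinZ.
rewrite !RintegralZl//; apply: lerD.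
  by have := energy_le cs T0; apply: (ler_wpM2l pp).
have -> : \int[mu]_x (\1_(`[- T, T]%classic) x : R) = 2 * T.
  by rewrite /Rintegral integral_indic// setIT; exact: (congr1 fine finI).
rewrite /k mulrC ler_pdivrMr; last by rewrite mulr_gt0// ltr_pwDl// mulr_ge0// sqr_ge0.
have : forall t : R, 2 * t <= 1 * (2 * (1 + 2 * t ^+ 2)).
  by move=> t; have := sqr_ge0 (t - 1); rewrite sqrrB1 expr2; nra.
exact.
Qed.

End one_time.
End morawetz_estimate.

Section morawetz_error.
Context {R : realType}.
Notation mu := (@lebesgue_measure R).
Notation mu2 := (mu \x mu)%E.
Variable p : R.
Hypothesis p1 : 1 < p.
Notation F := (potential p).
Implicit Types u a b : R -> R -> R.

Let pp : 0 <= p + 1. Proof. by have := p1; lra. Qed.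

Definition cone (t : R) : set R := `[- t, t].

(** A bound of [4 rho^-2 |u a|] in the light cone, made of a multiple of the
    energy density and of an indicator function; its integral over the time
    slice is [O ((1 + t)^(-3/2))], as the section of the cone has length [2
    t]. *)
Definition morawetz_error u a (x t : R) : R :=
  decay t ^+ 3 * (8 * (p + 1) * energy_plus p u a x t) +
  decay t ^+ 5 * (4 * \1_[set z : R * R | - z.2 <= z.1 /\ z.1 <= z.2] (x, t)).

(** In the cone [rho^-2 <= 2 (1 + t)^-2]; writing [w = (1 + t)^(-1/2)], the
    product [w^4 |u a|] is split as [w^3 a^2 + w^5 u^2]. *)
Lemma morawetz_error_pointwise u a (x t : R) : 0 <= t ->
  4 * (ir (t + x) (t - x) ^+ 2 * `|u x t * a x t| * ((0 < t + x) && (0 < t - x))%R%:R) <=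
  morawetz_error u a x t.
Proof.
move=> t0; rewrite /morawetz_error /energy_plus.
move: (u x t) (a x t) => v A.
have F0 := potential_ge0 v p1; have uF := sqr_le_potential v p1.
have A0 := sqr_ge0 A; have w0 := ltW (decay_gt0 t); have w2 := decay_sqr t0.
have w1 := decay_sqr_le1 t; have pp' := pp.
move: F0 uF w0 w2 w1; set P := F v; set w := decay t => F0 uF w0 w2 w1.
have w30 : 0 <= w ^+ 3 by exact: exprn_ge0.
have w50 : 0 <= w ^+ 5 by exact: exprn_ge0.
have rhs0 : 0 <= w ^+ 3 * (8 * (p + 1) * (A ^+ 2 / 4 + P / 2)).
  by rewrite mulr_ge0// mulr_ge0 ?mulr_ge0// addr_ge0// divr_ge0.
have [/andP[x0 e0]|_] := boolP ((0 < t + x) && (0 < t - x)); last first.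
  by rewrite !mulr0 addr_ge0// !mulr_ge0.
rewrite indicE mem_set ?mulr1; last by split => /=; lra.
have iE := ir_sqr (t + x) (t - x).
set i := ir _ _ in iE *.
have iw : i ^+ 2 <= 2 * w ^+ 4.
  have W : w ^+ 4 * (1 + t) ^+ 2 = 1 by rewrite (_ : w ^+ 4 = w ^+ 2 ^+ 2) -?exprM// exprM -exprMn w2 expr1n.
  have D0 : 0 < (1 + t) ^+ 2 by rewrite exprn_gt0// ltr_pwDl.
  rewrite -(ler_pM2r D0) -[leRHS]mulrA W mulr1.
  have : (1 + t) ^+ 2 <= 2 * (1 + (t + x) ^+ 2 + (t - x) ^+ 2).
    have := sqr_ge0 x; have := sqr_ge0 (t - 1); rewrite !expr2; nra.
  move=> /(ler_wpM2l (sqr_ge0 i)) /le_trans; apply.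
  by rewrite mulrCA iE mulr1.
have h1 : 2 * (w ^+ 4 * `|v * A|) <= w ^+ 3 * A ^+ 2 + w ^+ 5 * v ^+ 2.
  have : 0 <= w ^+ 3 * (w * `|v| - `|A|) ^+ 2 by rewrite mulr_ge0// sqr_ge0.
  rewrite normrM -(real_normK (num_real A)) -(real_normK (num_real v)).
  rewrite (_ : w ^+ 3 * (w * `|v| - `|A|) ^+ 2 = w ^+ 3 * `|A| ^+ 2 + w ^+ 5 * `|v| ^+ 2
     - 2 * (w ^+ 4 * (`|v| * `|A|))); last by ring.
  by rewrite subr_ge0.
have h2 : w ^+ 5 * v ^+ 2 <= w ^+ 5 + w ^+ 3 * ((p + 1) * P).
  apply: (@le_trans _ _ (w ^+ 5 * (1 + (p + 1) * P))); first exact: ler_wpM2l.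
  have Q0 : 0 <= (p + 1) * P by exact: mulr_ge0.
  rewrite mulrDr mulr1 lerD2l; apply: ler_wpM2r => //.
  have -> : w ^+ 5 = w ^+ 3 * w ^+ 2 by rewrite -exprD.
  exact: ler_piMr.
have h3 : A ^+ 2 + (p + 1) * P <= 2 * (p + 1) * (A ^+ 2 / 4 + P / 2).
  have : 0 <= (p - 1) * (A ^+ 2 / 2) by rewrite mulr_ge0 ?subr_ge0 ?divr_ge0// ltW.
  lra.
have h4 : i ^+ 2 * `|v * A| <= 2 * (w ^+ 4 * `|v * A|) by rewrite mulrA ler_wpM2r.
have h5 := ler_wpM2l w30 h3.
have h6 : w ^+ 3 * (8 * (p + 1) * (A ^+ 2 / 4 + P / 2)) =
  4 * (w ^+ 3 * (2 * (p + 1) * (A ^+ 2 / 4 + P / 2))) by ring.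
rewrite h6; lra.
Qed.

Lemma measurable_morawetz_error u a b : char_solution p u a b ->
  measurable_fun [set: R * R] (fun z : R * R => morawetz_error u a z.1 z.2).
Proof.
move=> cs; have mw : measurable_fun [set: R * R] (fun z : R * R => decay z.2).
  apply: measurableT_comp; last exact: measurable_snd.
  by apply: continuous_measurable_fun; exact: continuous_decay.
apply: measurable_funD; apply: measurable_funM; try exact: measurable_funX.
  by apply: measurable_funM => //; exact: measurable_energy_plus cs.
apply: measurable_funM => //; apply: measurableT_comp => //.
  apply: measurable_indic.
  rewrite (_ : [set z | _] = [set z : R * R | 0 <= z.1 + z.2] `&` [set z : R * R | 0 <= z.2 - z.1]).
    by apply: measurableI; rewrite -[X in measurable X]setTI;
      apply: (@measurable_fun_le _ _ _ _ (cst 0)) => //;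
      [apply: measurable_funD|apply: measurable_funB]; exact: measurable_fst || exact: measurable_snd.
  by apply/seteqP; split => -[x t] /= [h1 h2]; split; lra.
by apply/measurable_fun_pairP; split; [exact: measurable_fst|exact: measurable_snd].
Qed.

Lemma integral_morawetz_error u a b (T : R) : char_solution p u a b -> 0 <= T ->
  (\int[mu2]_(z in slab T) (morawetz_error u a z.1 z.2)%:E <=
   (2 * (8 * (p + 1) * \int[mu]_x energy_plus p u a x 0 + 8))%:E)%E.
Proof.
move=> cs T0; have me0 x t : 0 <= morawetz_error u a x t.
  rewrite /morawetz_error; have w0 := ltW (decay_gt0 t).
  by rewrite addr_ge0// !mulr_ge0 ?exprn_ge0 ?energy_plus_ge0.
have mme := measurable_morawetz_error cs.
have mmeE : measurable_fun [set: R * R] (fun z : R * R => (morawetz_error u a z.1 z.2)%:E).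
  exact/measurable_EFinP.
rewrite (ge0_integral_slab T mmeE)/=; last by move=> z; rewrite lee_fin.
set E0 := (\int[mu]_x _); pose K := 8 * (p + 1) * E0 + 8.
have E00 : 0 <= E0 by apply: Rintegral_ge0 => x _; exact: energy_plus_ge0.
have K0 : 0 <= K by rewrite addr_ge0// mulr_ge0// mulr_ge0.
apply: (@le_trans _ _ (\int[mu]_(t in `[0%R, T]) (K * decay t ^+ 3)%:E)%E); last first.
  under eq_integral => t _ do rewrite EFinM.
  rewrite ge0_integralZl//; last 2 first.
  - apply/measurable_EFinP; apply: measurable_funTS; apply: measurable_funX.
    by apply: continuous_measurable_fun; exact: continuous_decay.
  - by move=> t _; rewrite lee_fin exprn_ge0// ltW// decay_gt0.
  by rewrite mulrC EFinM lee_wpmul2l ?lee_fin//; exact: integral_decay3.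
apply: ge0_le_integral => //.
- by move=> t _; apply: integral_ge0 => x _; rewrite lee_fin.
- apply: measurable_funTS.
  apply: (@measurable_fun_fubini_tonelli_G _ _ _ _ _ mu (fun z : R * R => (morawetz_error u a z.1 z.2)%:E)).
    exact/measurable_EFinP.
  by move=> z; rewrite lee_fin.
- apply/measurable_EFinP; apply: measurable_funTS; apply: measurable_funM => //; apply: measurable_funX.
  by apply: continuous_measurable_fun; exact: continuous_decay.
move=> t; rewrite /= in_itv/= => /andP[t0 tT].
have iE := integrable_energy p1 cs t0.
have mI : measurable (cone t) by exact: measurable_itv.
have iI : mu.-integrable setT (EFin \o (\1_(cone t) : R -> R)) by apply: integrable_indic_itv.
have w0 := ltW (decay_gt0 t).
rewrite (_ : (\int[mu]_x (morawetz_error u a x t)%:E)%E =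
  (decay t ^+ 3 * (8 * (p + 1) * \int[mu]_x energy_plus p u a x t) +
   decay t ^+ 5 * (4 * (2 * t)))%:E); last first.
  have finI : \int[mu]_x (\1_(cone t) x : R) = 2 * t.
    rewrite /Rintegral integral_indic// setIT /cone.
    move: t0; rewrite le_eqVlt => /predU1P[<-|t1].
      by rewrite oppr0 set_itv1 [X in fine X]lebesgue_measure_set1 mulr0.
    rewrite [X in fine X]lebesgue_measure_itv/= ifT; last by rewrite lte_fin gtrN.
    by rewrite -EFinD opprK mulr_natl mulr2n.
  have i1 : mu.-integrable setT (EFin \o (fun x => decay t ^+ 3 * (8 * (p + 1) * energy_plus p u a x t))).
    by do 2 apply: integrable_EFinZ => //.
  have i2 : mu.-integrable setT (EFin \o (fun x => decay t ^+ 5 * (4 * \1_(cone t) x))).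
    by do 2 apply: integrable_EFinZ => //.
  rewrite -finI -!RintegralZl//; try exact: integrable_EFinZ.
  rewrite -RintegralD// /Rintegral fineK; last first.
    by apply: integrable_fin_num => //; exact: integrable_EFinD.
  apply: eq_integral => x _; rewrite /morawetz_error; congr (_ + _ * (4 * _))%:E.
  rewrite !indicE; congr (nat_of_bool _)%:R; apply/idP/idP; rewrite /cone !inE/= in_itv/=.
    by move=> [-> ->].
  by move/andP.
have tw : decay t ^+ 2 * t <= 1.
  by rewrite -(decay_sqr t0) ler_wpM2l ?sqr_ge0// lerDr.
rewrite lee_fin /K [leRHS]mulrC [leRHS]mulrDr; apply: lerD.
  apply: ler_wpM2l; first exact: exprn_ge0.
  apply: ler_wpM2l; first exact: mulr_ge0.
  by have := energy_le p1 cs t0; apply.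
have -> : decay t ^+ 5 * (4 * (2 * t)) = decay t ^+ 3 * (8 * (decay t ^+ 2 * t)) by ring.
by rewrite ler_wpM2l ?exprn_ge0// ler_piMr.
Qed.

End morawetz_error.

Section morawetz_theorem.
Context {R : realType}.
Notation mu := (@lebesgue_measure R).
Notation mu2 := (mu \x mu)%E.
Variable p : R.
Hypothesis p1 : 1 < p.
Notation F := (potential p).
Implicit Types u a b : R -> R -> R.

Let pp : 0 <= p + 1. Proof. by have := p1; lra. Qed.

Definition morawetz_density u (x t : R) : R :=
  Num.max 0 (t + x) * Num.max 0 (t - x) * ir (t + x) (t - x) ^+ 3 * F (u x t).

Lemma morawetz_density_ge0 u x t : 0 <= morawetz_density u x t.
Proof.
apply: mulr_ge0; last exact: potential_ge0.
apply: mulr_ge0; last by apply: exprn_ge0; exact: ltW (ir_gt0 _ _).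
by apply: mulr_ge0; rewrite le_max lexx.
Qed.

Lemma measurable_morawetz_density u a b : char_solution p u a b ->
  measurable_fun [set: R * R] (fun z : R * R => morawetz_density u z.1 z.2).
Proof.
move=> cs; apply: measurable_funM; last exact: measurable_Fu cs.
apply: (@measurable_along _ (fun x e => Num.max 0 x * Num.max 0 e * ir x e ^+ 3)).
apply: measurable_funM; last by apply: measurable_funX; exact: measurable_ir.
by apply: measurable_funM; apply: measurable_maxr.
Qed.

(** The bound depends on the initial energies only, not on [T]: this is the
    global space-time estimate. *)
Lemma integral_morawetz_density u a b (T : R) : char_solution p u a b -> 0 <= T ->
  (\int[mu2]_(z in slab T) (morawetz_density u z.1 z.2)%:E <=
   ((p - 1)^-1 * (2 * \int[mu]_x energy_plus p u a x 0 +
     2 * \int[mu]_x energy_plus p (fun x => u (- x)) (fun x => b (- x)) x 0 +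
     ((p + 1) * \int[mu]_x energy_plus p u a x 0 + 1) +
     2 * (8 * (p + 1) * \int[mu]_x energy_plus p u a x 0 + 8)))%:E)%E.
Proof.
move=> cs T0; have cs' := char_solution_reflect cs.
set Ea := (\int[mu]_x energy_plus p u a x 0).
set Eb := (\int[mu]_x energy_plus p (fun x => u (- x)) _ x 0).
have arith (t x : R) : 0 <= t -> t <= T ->
    0 <= t + x + (t - x) /\ t + x + (t - x) <= 2 * T + 1 - 1.
  by rewrite addrACA subrr addr0 addrK; split; lra.
have arith2 (t x : R) : t <= T ->
    (0 < t - x -> t + x <= 2 * T + 1 - 1) /\ (0 < t + x -> t - x <= 2 * T + 1 - 1).
  by move=> tT; rewrite addrK; split => h; lra.
have arith3 (d c e x y A B C D : R) : x <= A -> y <= B -> - c <= C -> e <= D ->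
    d - e <= x + y - c -> d <= A + B + C + D by move=> *; lra.
pose r := 2 * T + 1; have mS := @measurable_slab R T.
have w := weight_mW r; have sWx := @supported_mWx _ r; have sWe := @supported_mWe _ r.
have [Cx wC] := weight_mC r; have sC := @supported_mC _ r; have sCe := @supported_mCe _ r.
pose HA x t := along (mWe r) x t * a x t ^+ 2 / 2 + along (mWx r) x t * F (u x t).
pose HB x t := along (mWe r) x t * b (- x) t ^+ 2 / 2 + along (mWx r) x t * F (u (- x) t).
pose HC x t := 2 * along (mCe r) x t * (u x t * a x t) +
  along (mC r) x t * (a x t * b x t) - (p + 1) * along (mC r) x t * F (u x t).
have iA : mu2.-integrable (slab T) (EFin \o (fun z => HA z.1 z.2)).
  exact: (admissible_integrable cs (admissible_energy_rate p1 cs T0 w sWx sWe)).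
have iB : mu2.-integrable (slab T) (EFin \o (fun z => HB z.1 z.2)).
  exact: (admissible_integrable cs' (admissible_energy_rate p1 cs' T0 w sWx sWe)).
have iB' : mu2.-integrable (slab T) (EFin \o (fun z => HB (- z.1) z.2)).
  exact: integrable_slab_reflect iB.
have iC : mu2.-integrable (slab T) (EFin \o (fun z => HC z.1 z.2)).
  exact: (admissible_integrable cs (admissible_virial_rate p1 cs T0 wC sC sCe)).
have iD : mu2.-integrable (slab T) (EFin \o (fun z => morawetz_density u z.1 z.2)).
  have aD : admissible a b T (fun x t => along (mC r) x t * F (u x t)).
    apply: (admissible_along T0 (wt_m wC) _ sC (locally_dominated_u T cs (continuous_potential p1))).
    move=> K; have [C C0 CK] := wt_bd wC K; exists C => // x e xK eK.
    by have [] := CK x e xK eK.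
  apply: eq_integrable (admissible_integrable cs aD) => //.
  move=> [x t] /[!inE] -[_ /=]; rewrite in_itv/= => /andP[t0 tT].
  congr EFin; rewrite /along /morawetz_density; congr (_ * _).
  have [x0|x0] := leP (t + x) 0; first by rewrite mC_eq0 ?mul0r//; left.
  have [e0|e0] := leP (t - x) 0; first by rewrite mC_eq0 ?mulr0 ?mul0r//; right.
  by rewrite mC_cone// /r; lra.
have iE : mu2.-integrable (slab T) (EFin \o (fun z => morawetz_error p u a z.1 z.2)).
  apply/integrableP; split.
    by apply/measurable_EFinP; apply: measurable_funTS; exact: measurable_morawetz_error cs.
  have e0 x t : 0 <= morawetz_error p u a x t.
    rewrite /morawetz_error; have w0 := ltW (decay_gt0 t).
    by rewrite addr_ge0// !mulr_ge0 ?exprn_ge0 ?energy_plus_ge0.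
  under eq_integral => z _ do rewrite /= ger0_norm//.
  by apply: le_lt_trans (integral_morawetz_error p1 cs T0) _; rewrite ltry.
have SA : \int[mu2]_(z in slab T) HA z.1 z.2 <= 2 * Ea by exact: morawetz_energy_rate cs.
have SB : \int[mu2]_(z in slab T) HB (- z.1) z.2 <= 2 * Eb.
  have SB' := morawetz_energy_rate p1 T0 cs'; rewrite (Rintegral_slab_reflect iB); exact: SB'.
have SC : - (\int[mu2]_(z in slab T) HC z.1 z.2) <= (p + 1) * Ea + 1.
  have := morawetz_boundary p1 T0 cs; congr (- _ <= _).
  rewrite -(virial_identity p1 cs T0 wC sC sCe) (_ : \int[mu]_x (_ * (u x 0 * _)) = 0) ?subr0//.
  rewrite /Rintegral integral0_eq// => x _; rewrite /along add0r sub0r mC_eq0 ?mul0r//.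
  by have [x0|x0] := leP x 0; [left|right; rewrite oppr_le0 ltW].
have SE : \int[mu2]_(z in slab T) morawetz_error p u a z.1 z.2 <= 2 * (8 * (p + 1) * Ea + 8).
  rewrite -lee_fin /Rintegral fineK; last by apply: integrable_fin_num.
  by have SE' := integral_morawetz_error p1 cs T0; apply: SE'.
have main : (p - 1) * \int[mu2]_(z in slab T) morawetz_density u z.1 z.2 -
    \int[mu2]_(z in slab T) morawetz_error p u a z.1 z.2 <=
    \int[mu2]_(z in slab T) HA z.1 z.2 + \int[mu2]_(z in slab T) HB (- z.1) z.2 -
    \int[mu2]_(z in slab T) HC z.1 z.2.
  rewrite -RintegralZl// -RintegralB//; last exact: integrable_EFinZ.
  rewrite -RintegralD// -RintegralB//; last exact: integrable_EFinD.
  apply: le_Rintegral => //.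
  - by apply: integrable_EFinB => //; exact: integrable_EFinZ.
  - by apply: integrable_EFinB => //; exact: integrable_EFinD.
  move=> [x t] [_ /=]; rewrite in_itv/= => /andP[t0 tT].
  have er := morawetz_error_pointwise p1 u a x t0.
  have := @mora_pointwise _ r p (t + x) (t - x) (u x t) (a x t) (b x t) (F (u x t)) _ _
    (potential_ge0 _ p1).
  have [ar1 ar2] := arith t x t0 tT; move=> /(_ ar1 ar2).
  move: er; rewrite /HA /HB /HC /along opprK /morawetz_density => er mp.
  apply: le_trans (le_trans mp _); last first.
    by [].
  apply: lerB => //.
  have [x0|x0] := leP (t + x) 0.
    by rewrite mC_eq0 ?(mul0r, mulr0)//; left.
  have [e0|e0] := leP (t - x) 0.
    by rewrite mC_eq0 ?(mul0r, mulr0)//; right.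
  have [ar3 ar4] := arith2 t x tT; rewrite mC_cone ?ar3 ?ar4 ?mulrA//.
rewrite (_ : (\int[mu2]_(z in slab T) _)%E =
  (\int[mu2]_(z in slab T) morawetz_density u z.1 z.2)%:E); last first.
  by rewrite /Rintegral fineK//; apply: integrable_fin_num.
rewrite lee_fin ler_pdivlMl ?subr_gt0//.
exact: arith3 SA SB SC SE main.
Qed.

End morawetz_theorem.

(** * Decay of the left-moving energy *)

Section decay_of_energy.
Context {R : realType}.
Notation mu := (@lebesgue_measure R).
Notation mu2 := (mu \x mu)%E.
Variable p : R.
Hypothesis p1 : 1 < p.
Notation F := (potential p).
Variables u a b : R -> R -> R.
Hypothesis cs : char_solution p u a b.
Notation ep := (energy_plus p u a).
Notation D := (morawetz_density p u).

(** The initial energy to the right of the origin, weighted so as to become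
    small as [T] grows. *)
Definition initial_tail (T : R) : R := \int[mu]_x (clip (T^-1 * x) * ep x 0).

Definition morawetz_total (T : R) : R := \int[mu2]_(z in slab T) D z.1 z.2.

Lemma clipC (s : R) : 1 + -1 * clip (- s + 1) = clip s.
Proof.
have [s0|s0] := leP s 0; first by rewrite clip_ge1 ?clip_le0//; lra.
have [s1|s1] := leP s 1; first by rewrite !clip_mid; lra.
by rewrite clip_le0 ?clip_ge1//; lra.
Qed.

Lemma dclip_eq1 (s : R) : 0 < s -> s <= 1 -> dclip s = 1.
Proof. by move=> s0 s1; rewrite /dclip s0 s1. Qed.

Lemma dclip_eq0 (s : R) : ~~ (0 < s <= 1) -> dclip s = 0.
Proof. by rewrite /dclip => /negbTE->. Qed.

(** Up to time [T] in the strip, [rho <= 3 T]; if both null coordinates exceed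
    [d T], then [xi eta / rho^3 >= d^2 / (27 T)]. *)
Lemma morawetz_far (d T t x P : R) : 0 < d -> 1 <= T -> 0 <= t -> t <= T ->
  d * T < t + x -> d * T < t - x -> t + x <= T -> 0 <= P ->
  T^-1 * P <= 27 / d ^+ 2 *
    (Num.max 0 (t + x) * Num.max 0 (t - x) * ir (t + x) (t - x) ^+ 3 * P).
Proof.
move=> d0 T1 t0 tT; have : t - x = 2 * t - (t + x) by ring.
move: (t + x) (t - x) => X E XE; have T0 : 0 < T by lra.
have dT0 : 0 < d * T by rewrite mulr_gt0.
move=> dX dE XT P0; have X0 : 0 < X by lra.
have E0 : 0 < E by lra.
have ET : E <= 2 * T by lra.
rewrite (max_r (ltW X0)) (max_r (ltW E0)) !mulrA; apply: ler_wpM2r => //.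
have iE := ir_sqr X E; have i0 := ir_gt0 X E; set i := ir X E in iE i0 *.
have iT : 1 <= 3 * T * i.
  have : 1 <= (3 * T * i) ^+ 2.
    rewrite -[leLHS]iE exprMn mulrC; apply: ler_wpM2r; first exact: sqr_ge0.
    rewrite !expr2; nra.
  by rewrite -{1}(expr1n _ 2) ler_pXn2r ?nnegrE ?mulr_ge0// ltW.
have iT3 : 1 <= 27 * T ^+ 3 * i ^+ 3.
  have := @exprn_ege1 _ 3 _ iT; rewrite (_ : (3 * T * i) ^+ 3 = 27 * T ^+ 3 * i ^+ 3)//; ring.
rewrite -[leLHS]mulr1; apply: (@le_trans _ _ (T^-1 * (27 * T ^+ 3 * i ^+ 3))).
  by apply: ler_wpM2l => //; rewrite invr_ge0 ltW.
have -> : T^-1 * (27 * T ^+ 3 * i ^+ 3) = 27 / d ^+ 2 * ((d * T) * (d * T)) * i ^+ 3.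
  by field; rewrite !gt_eqF.
rewrite (_ : _ * X * E * i * i * i = 27 / d ^+ 2 * (X * E) * i ^+ 3); last by rewrite !mulrA.
apply: ler_wpM2r; first by rewrite exprn_ge0// ltW.
apply: ler_wpM2l; first by rewrite divr_ge0// exprn_ge0// ltW.
by apply: ler_pM; rewrite // ltW.
Qed.

(** The strip [0 < t + x <= T] splits into a thin layer near each
    characteristic through the origin, the exterior of the light cone, and its
    deep interior, where the Morawetz density dominates [F / T]. The clipped
    weights are those for which the flux and exterior bounds are available. *)
Lemma strip_pointwise (d T t x P : R) : 0 < d -> 1 <= T -> 0 <= t -> t <= T ->
  0 <= P ->
  T^-1 * dclip (T^-1 * (t + x) + 0) * P <=
  d * ((d * T)^-1 * dclip ((d * T)^-1 * (t + x) + 0) * P) +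
  2 * d * ((2 * (d * T))^-1 * dclip ((2 * (d * T))^-1 * (t - x) + 2^-1) * P) +
  T^-1 * ((1 + -1 * clip ((d * T)^-1 * (t - x) + 1)) * P) +
  27 / d ^+ 2 * ((d * T < t)%R%:R *
    (Num.max 0 (t + x) * Num.max 0 (t - x) * ir (t + x) (t - x) ^+ 3 * P)).
Proof.
move=> d0 T1 t0 tT P0; have T0 : 0 < T by lra.
have dT0 : 0 < d * T by rewrite mulr_gt0.
have Ti0 : 0 < T^-1 by rewrite invr_gt0.
have TK : d * (d * T)^-1 = T^-1 by field; rewrite !gt_eqF.
have TK2 : 2 * d * (2 * (d * T))^-1 = T^-1 by field; rewrite !gt_eqF.
have KK : (d * T)^-1 * (d * T) = 1 by rewrite mulVf// gt_eqF.
have KK2 : (2 * (d * T))^-1 * (d * T) = 2^-1 by field; rewrite !gt_eqF.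
have far := @morawetz_far d T t x P d0 T1 t0 tT.
rewrite !(mulrA d) !(mulrA (2 * d)) TK TK2.
have iK : 0 < (d * T)^-1 by rewrite invr_gt0.
have iK2 : 0 < (2 * (d * T))^-1 by rewrite invr_gt0 mulr_gt0.
set A4 := 27 / _ * (_ * _).
have A40 : 0 <= A4.
  rewrite mulr_ge0 ?divr_ge0 ?exprn_ge0 ?(ltW d0)// mulr_ge0//.
  apply: mulr_ge0 => //; apply: mulr_ge0; last by apply: exprn_ge0; exact: ltW (ir_gt0 _ _).
  by apply: mulr_ge0; rewrite le_max lexx.
have D1 := dclip_ge0 ((d * T)^-1 * (t + x) + 0).
have D2 := dclip_ge0 ((2 * (d * T))^-1 * (t - x) + 2^-1).
have D3 := clip_le1 ((d * T)^-1 * (t - x) + 1).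
pose S : R := dclip ((d * T)^-1 * (t + x) + 0) +
  dclip ((2 * (d * T))^-1 * (t - x) + 2^-1) + (1 - clip ((d * T)^-1 * (t - x) + 1)).
have D30 : 0 <= 1 - clip ((d * T)^-1 * (t - x) + 1) by rewrite subr_ge0.
have S0 : 0 <= S by apply: addr_ge0 => //; apply: addr_ge0.
suff : dclip (T^-1 * (t + x) + 0) <= S \/ T^-1 * P <= A4.
  have SE : T^-1 * dclip ((d * T)^-1 * (t + x) + 0) * P +
    T^-1 * dclip ((2 * (d * T))^-1 * (t - x) + 2^-1) * P +
    T^-1 * ((1 + -1 * clip ((d * T)^-1 * (t - x) + 1)) * P) = T^-1 * S * P.
    by rewrite /S; ring.
  rewrite SE => -[h|h].
    rewrite -[leLHS]addr0; apply: lerD => //; apply: ler_wpM2r => //.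
    by rewrite ler_pM2l.
  rewrite -[leLHS]add0r; apply: lerD; first by rewrite !mulr_ge0// ltW.
  apply: le_trans h; apply: ler_wpM2r => //.
  by rewrite -[leRHS]mulr1 ler_pM2l// dclip_le1.
have [/andP[x0 xT]|xo] := boolP (0 < T^-1 * (t + x) + 0 <= 1); last first.
  by left; rewrite dclip_eq0.
move: (x0) (xT); rewrite !addr0 pmulr_rgt0// ler_pdivrMl// mulr1 => x0' xT'.
have [xd|xd] := leP (t + x) (d * T).
  left; rewrite /S (_ : dclip ((d * T)^-1 * (t + x) + 0) = 1); last first.
    by rewrite dclip_eq1 ?addr0 ?mulr_gt0// -KK ler_pM2l.
  by rewrite -addrA (le_trans (dclip_le1 _))// lerDl addr_ge0// subr_ge0.
have [ed|ed] := leP (t - x) (- (d * T)).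
  left; rewrite /S (_ : clip ((d * T)^-1 * (t - x) + 1) = 0); last first.
    by rewrite clip_le0// -lerBrDr sub0r -KK -mulrN ler_pM2l.
  by rewrite subr0 (le_trans (dclip_le1 _))// lerDr addr_ge0.
have [ed'|ed'] := leP (t - x) (d * T).
  left; rewrite /S (_ : dclip ((2 * (d * T))^-1 * (t - x) + 2^-1) = 1); last first.
    rewrite dclip_eq1//.
    - by rewrite -ltrBlDr sub0r -KK2 -mulrN ltr_pM2l.
    - have h : (2 * (d * T))^-1 * (t - x) <= 2^-1 by rewrite -KK2 ler_pM2l.
      by rewrite (le_trans (lerD h (lexx _)))// -(mul1r 2^-1) -splitr.
  by rewrite addrAC (le_trans (dclip_le1 _))// lerDr addr_ge0// subr_ge0.
right; rewrite /A4 (_ : (d * T < t) = true); last by apply/idP; lra.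
by rewrite mul1r; exact: far.
Qed.

Lemma initial_tail_fin (K : R) : 0 < K ->
  (\int[mu]_x (clip (K^-1 * x) * ep x 0)%:E = (initial_tail K)%:E)%E.
Proof.
move=> K0; rewrite /initial_tail /Rintegral fineK//; apply: integrable_fin_num => //.
apply: (@integrable_EFinM _ _ _ _ _ _ 1) (integrable_energy0 cs) => //.
  have := bac_m (bounded_ac_clip 0 (_ : 0 < K^-1)); rewrite invr_gt0 => /(_ K0).
  by apply: eq_measurable_fun => x _; rewrite addr0.
by move=> x _; rewrite ger0_norm ?clip_ge0 ?clip_le1.
Qed.

(** Finite speed of propagation: the weight [1 - clip (eta / K + 1)] decreases
    in [eta], so its energy does not exceed the initial one, where it equals
    [clip (x / K)]. *)
Lemma exterior_bound (K t : R) : 0 < K -> 0 <= t ->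
  (\int[mu]_x ((1 + -1 * clip (K^-1 * (t - x) + 1)) * F (u x t))%:E <=
   (2 * initial_tail K)%:E)%E.
Proof.
move=> K0 t0; have iK0 : 0 < K^-1 by rewrite invr_gt0.
pose g s := 1 + -1 * clip (K^-1 * s + 1).
have bg : bounded_ac g (fun s => -1 * (K^-1 * dclip (K^-1 * s + 1))).
  exact: (bounded_ac_lin 1 (-1) (bounded_ac_clip 1 iK0)).
have g0 s : 0 <= g s by rewrite /g mulN1r subr_ge0 clip_le1.
have := monotone_energy p1 cs t0 (bounded_ac_cst 1) bg (fun=> ler01) (fun=> lexx _) g0.
move=> /(_ (fun s => _)).
have g'0 s : -1 * (K^-1 * dclip (K^-1 * s + 1)) <= 0.
  by rewrite mulN1r oppr_le0 mulr_ge0 ?dclip_ge0// ltW.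
move=> /(_ g'0) main.
have mg : measurable_fun setT g := bac_m bg.
have mgt : measurable_fun setT (fun x : R => g (t - x)).
  by apply: measurableT_comp => //; exact: measurable_funB.
apply: (@le_trans _ _ (\int[mu]_x (2%:E * (1 * g (t - x) * ep x t)%:E))%E).
  apply: ge0_le_integral => //.
  - by move=> x _; rewrite lee_fin mulr_ge0 ?potential_ge0//; exact: g0.
  - apply/measurable_EFinP; apply: measurable_funM => //.
    exact: (@measurable_slice _ (fun x t => F (u x t)) t (measurable_Fu p1 cs)).
  - apply: measurable_funeM; apply/measurable_EFinP; apply: measurable_funM.
      exact: measurable_funM.
    exact: measurable_slice t (measurable_energy_plus p1 cs).
  - move=> x _; rewrite -EFinM lee_fin mul1r [leRHS]mulrCA; apply: (ler_wpM2l (g0 (t - x))).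
    rewrite /energy_plus; have := sqr_ge0 (a x t); lra.
rewrite ge0_integralZl//; last 2 first.
- apply/measurable_EFinP; apply: measurable_funM; first exact: measurable_funM.
  exact: measurable_slice t (measurable_energy_plus p1 cs).
- by move=> x _; rewrite lee_fin mul1r mulr_ge0 ?energy_plus_ge0//; exact: g0.
rewrite EFinM lee_pmul2l//; apply: (le_trans main).
rewrite [X in (_ + X)%E]integral0_eq ?adde0; last by move=> z _; rewrite !mul0r.
rewrite -initial_tail_fin// le_eqVlt; apply/orP; left; apply/eqP.
apply: eq_integral => x _; congr (_ * _)%:E; rewrite mul1r /g mulrN.
by move: (K^-1 * x) => s; rewrite clipC.
Qed.

Lemma integrable_morawetz_density (T : R) : 0 <= T ->
  mu2.-integrable (slab T) (EFin \o (fun z => D z.1 z.2)).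
Proof.
move=> T0; have mS := @measurable_slab R T; apply/integrableP; split.
  apply/measurable_EFinP; apply: measurable_funTS; exact: (measurable_morawetz_density p1 cs).
have D0 := morawetz_density_ge0 p1 u.
under eq_integral => z _ do rewrite /= ger0_norm//.
apply: le_lt_trans; first exact: (integral_morawetz_density p1 cs T0).
by rewrite ltry.
Qed.

Lemma morawetz_total_diff (s T : R) : 0 <= s -> s <= T ->
  (\int[mu2]_(z in slab T) ((s < z.2)%R%:R * D z.1 z.2)%:E =
   (morawetz_total T - morawetz_total s)%:E)%E.
Proof.
move=> s0 sT; have T0 := le_trans s0 sT.
have mST := @measurable_slab R T; have mSs := @measurable_slab R s.
have mD := measurable_morawetz_density p1 cs.
have D0 := morawetz_density_ge0 p1 u.
have mi : measurable_fun [set: R * R] (fun z : R * R => (s < z.2)%R%:R : R).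
  rewrite (_ : (fun _ => _) = (fun z : R * R => \1_(`]s, +oo[%classic) z.2)).
    by apply: measurableT_comp; [exact: measurable_indic|exact: measurable_snd].
  apply/funext => z; rewrite indicE; congr ((nat_of_bool _)%:R).
  by apply/idP/idP; rewrite inE/= in_itv/= andbT.
have fin T' : 0 <= T' -> (\int[mu2]_(z in slab T') (D z.1 z.2)%:E = (morawetz_total T')%:E)%E.
  move=> T'0; rewrite /morawetz_total /Rintegral fineK//; apply: integrable_fin_num.
    exact: measurable_slab.
  exact: integrable_morawetz_density.
set X := (\int[mu2]_(z in slab T) _)%E.
have sum : (X + (morawetz_total s)%:E = (morawetz_total T)%:E)%E.
  rewrite -!fin// /X.
  have -> : (\int[mu2]_(z in slab s) (D z.1 z.2)%:E =
      \int[mu2]_(z in slab T) ((1 - (s < z.2)%R%:R) * D z.1 z.2)%:E)%E.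
    rewrite integral_mkcond [RHS]integral_mkcond; apply: eq_integral => -[x t] _ /=.
    rewrite !patchE /=; case: ifPn; case: ifPn; rewrite ?inE ?notin_setE /slab /= !in_itv/=.
    - by move=> [_ /andP[t0 tT]] [_ /andP[_ ts]]; rewrite ltNge ts subr0 mul1r.
    - by move=> h [_ /andP[t0 ts]]; exfalso; apply: h; split => //; rewrite t0 (le_trans ts).
    - move=> [_ /andP[t0 tT]] h; have st : s < t.
        by rewrite ltNge; apply/negP => ts; apply: h; split => //; rewrite t0 ts.
      by rewrite st subrr mul0r.
    - by [].
  rewrite -ge0_integralD//.
  - by apply: eq_integral => z _; rewrite -EFinD; congr EFin; ring.
  - by move=> z _; rewrite lee_fin mulr_ge0.
  - by apply/measurable_EFinP; apply: measurable_funTS; exact: measurable_funM.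
  - by move=> z _; rewrite lee_fin mulr_ge0// subr_ge0; case: (s < z.2).
  - by apply/measurable_EFinP; apply: measurable_funTS; apply: measurable_funM => //; exact: measurable_funB.
by rewrite EFinB -sum addeK.
Qed.

End decay_of_energy.

Lemma ge0_integral_slab_reflect (R : realType) (H : R -> R -> R) (T : R) :
  measurable_fun [set: R * R] (fun z : R * R => H z.1 z.2) -> (forall x t, 0 <= H x t) ->
  (\int[@lebesgue_measure R \x @lebesgue_measure R]_(z in slab T) (H (- z.1)%R z.2)%:E =
   \int[@lebesgue_measure R \x @lebesgue_measure R]_(z in slab T) (H z.1 z.2)%:E)%E.
Proof.
move=> mH H0; have mH' := measurable_reflect mH.
have mE : measurable_fun [set: R * R] (fun z : R * R => (H z.1 z.2)%:E) by exact/measurable_EFinP.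
have mE' : measurable_fun [set: R * R] (fun z : R * R => (H (- z.1) z.2)%:E).
  exact/measurable_EFinP.
rewrite (ge0_integral_slab T mE') ?(ge0_integral_slab T mE); try by move=> z; rewrite lee_fin.
apply: eq_integral => t _ /=; apply: (@ge0_integral_reflect _ (fun x => (H x t)%:E)).
  by apply/measurable_EFinP; exact: measurable_slice.
by move=> x; rewrite lee_fin.
Qed.

Lemma cvg_harmonicM (R : realType) (k : R) : (n.+1%:R^-1 * k) @[n --> \oo] --> (0 : R).
Proof.
have h := cvgM (@cvg_harmonic R) (cvg_cst k : (fun=> k) n @[n --> \oo] --> k).
by rewrite mul0r in h; apply: h.
Qed.

Section energy_limit.
Context {R : realType}.
Notation mu := (@lebesgue_measure R).
Notation mu2 := (mu \x mu)%E.
Variable p : R.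
Hypothesis p1 : 1 < p.
Notation F := (potential p).
Variables u a b : R -> R -> R.
Hypothesis cs : char_solution p u a b.
Notation ep := (energy_plus p u a).
Notation D := (morawetz_density p u).
Notation tail := (initial_tail p u a).
Notation G := (morawetz_total p u).

Let Ea := \int[mu]_x ep x 0.
Let Eb := \int[mu]_x energy_plus p (fun x => u (- x)) (fun x => b (- x)) x 0.

Let energy_fin u' a' b' : char_solution p u' a' b' ->
  (\int[mu]_x (energy_plus p u' a' x 0)%:E = (\int[mu]_x energy_plus p u' a' x 0)%:E)%E.
Proof.
move=> cs'; rewrite /Rintegral fineK//; apply: integrable_fin_num => //.
exact: integrable_energy0 cs'.
Qed.

Let mF : measurable_fun [set: R * R] (fun z : R * R => F (u z.1 z.2)).
Proof. exact: measurable_Fu cs. Qed.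

Lemma flux_near_plus (k c T : R) : 0 < k -> 0 <= T ->
  (\int[mu2]_(z in slab T) (k * dclip (k * (z.2 + z.1) + c) * F (u z.1 z.2))%:E <= Ea%:E)%E.
Proof.
move=> k0 T0; have fb := flux_bound p1 cs T0 (bounded_ac_clip c k0).
rewrite -(energy_fin cs); apply: fb => s; first by rewrite clip_ge0 clip_le1.
by rewrite mulr_ge0 ?dclip_ge0// ltW.
Qed.

Lemma flux_near_minus (k c T : R) : 0 < k -> 0 <= T ->
  (\int[mu2]_(z in slab T) (k * dclip (k * (z.2 - z.1) + c) * F (u z.1 z.2))%:E <= Eb%:E)%E.
Proof.
move=> k0 T0; have cs' := char_solution_reflect cs.
have fb := flux_bound p1 cs' T0 (bounded_ac_clip c k0).
rewrite -(energy_fin cs').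
pose H x t := k * dclip (k * (t - x) + c) * F (u x t).
rewrite -(@ge0_integral_slab_reflect _ H T).
- have -> : (\int[mu2]_(z in slab T) (H (- z.1) z.2)%:E =
     \int[mu2]_(z in slab T) (k * dclip (k * (z.2 + z.1) + c) * F (u (- z.1) z.2))%:E)%E.
    by apply: eq_integral => z _; rewrite /H opprK.
  apply: fb => s; first by rewrite clip_ge0 clip_le1.
  by rewrite mulr_ge0 ?dclip_ge0// ltW.
- apply: measurable_funM => //; apply: measurable_funM => //.
  apply: measurableT_comp; first exact: measurable_dclip.
  apply: measurable_funD => //; apply: measurable_funM => //.
  by apply: measurable_funB; [exact: measurable_snd|exact: measurable_fst].
- by move=> x t; rewrite /H mulr_ge0 ?potential_ge0// mulr_ge0 ?dclip_ge0// ltW.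
Qed.

Lemma exterior_flux (K T : R) : 0 < K -> 0 < T ->
  (\int[mu2]_(z in slab T) (T^-1 * ((1 + -1 * clip (K^-1 * (z.2 - z.1) + 1)) * F (u z.1 z.2)))%:E
   <= (2 * tail K)%:E)%E.
Proof.
move=> K0 T0; have iT0 : 0 <= T^-1 by rewrite invr_ge0 ltW.
have iK0 : 0 < K^-1 by rewrite invr_gt0.
have bg := bounded_ac_lin 1 (-1) (bounded_ac_clip 1 iK0).
have mg : measurable_fun [set: R * R]
    (fun z : R * R => ((1 + -1 * clip (K^-1 * (z.2 - z.1) + 1)) * F (u z.1 z.2))%:E).
  apply/measurable_EFinP; apply: measurable_funM => //.
  apply: (@measurable_along _ (fun _ e => 1 + -1 * clip (K^-1 * e + 1))).
  by apply: (measurableT_comp (bac_m bg)); exact: measurable_snd.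
have g0 z : (0 <= ((1 + -1 * clip (K^-1 * (z.2 - z.1) + 1)) * F (u z.1 z.2))%:E)%E.
  by rewrite lee_fin mulr_ge0 ?potential_ge0// mulN1r subr_ge0 clip_le1.
under eq_integral => z _ do rewrite EFinM.
rewrite ge0_integralZl//; [|exact: measurable_slab|exact: measurable_funTS].
rewrite ge0_integral_slab//.
have h : (\int[mu]_(t in `[0%R, T]) \int[mu]_x
    ((1 + -1 * clip (K^-1 * ((x, t).2 - (x, t).1) + 1)) * F (u (x, t).1 (x, t).2))%:E
    <= \int[mu]_(t in `[0%R, T]) (2 * tail K)%:E)%E.
  apply: ge0_le_integral => //.
  - by move=> t _; apply: integral_ge0 => x _; exact: (g0 (x, t)).
  - by apply: measurable_funTS; exact: (@measurable_fun_fubini_tonelli_G _ _ _ _ _ mu _ mg g0).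
  - by move=> t; rewrite /= in_itv/= => /andP[t0 _]; exact: (exterior_bound p1 cs K0 t0).
apply: (le_trans (lee_wpmul2l _ h)); first by rewrite lee_fin.
rewrite integral_cst// [X in (_ * (_ * X))%E]lebesgue_measure_itv/= lte_fin T0 sube0 -!EFinM lee_fin.
by rewrite mulrCA mulVf ?mulr1// gt_eqF.
Qed.

(** Integrating the pointwise splitting of the strip; the last term involves
    the Morawetz density at times later than [d * T] only. *)
Lemma strip_bound (d T : R) : 0 < d -> d <= 1 -> 1 <= T ->
  (\int[mu2]_(z in slab T) (T^-1 * dclip (T^-1 * (z.2 + z.1) + 0) * F (u z.1 z.2))%:E <=
   (d * Ea + 2 * d * Eb + 2 * tail (d * T) + 27 / d ^+ 2 * (G T - G (d * T)))%:E)%E.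
Proof.
move=> d0 d1 T1; have T0 : 0 < T by lra.
have dT0 : 0 < d * T by rewrite mulr_gt0.
have dTT : d * T <= T by rewrite ler_piMl// ltW.
have mS := @measurable_slab R T.
have k1 : 0 < (d * T)^-1 by rewrite invr_gt0.
have k2 : 0 < (2 * (d * T))^-1 by rewrite invr_gt0 mulr_gt0.
have mdc (k c : R) (W : R -> R -> R) :
    measurable_fun [set: R * R] (fun z : R * R => W z.1 z.2) ->
    measurable_fun [set: R * R] (fun z : R * R => k * dclip (k * W z.1 z.2 + c) * F (u z.1 z.2)).
  move=> mW; apply: measurable_funM => //; apply: measurable_funM => //.
  apply: measurableT_comp; first exact: measurable_dclip.
  by apply: measurable_funD => //; exact: measurable_funM.
have mplus : measurable_fun [set: R * R] (fun z : R * R => z.2 + z.1).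
  by apply: measurable_funD; [exact: measurable_snd|exact: measurable_fst].
have mminus : measurable_fun [set: R * R] (fun z : R * R => z.2 - z.1).
  by apply: measurable_funB; [exact: measurable_snd|exact: measurable_fst].
pose A1 (z : R * R) := d * ((d * T)^-1 * dclip ((d * T)^-1 * (z.2 + z.1) + 0) * F (u z.1 z.2)).
pose A2 (z : R * R) := 2 * d *
  ((2 * (d * T))^-1 * dclip ((2 * (d * T))^-1 * (z.2 - z.1) + 2^-1) * F (u z.1 z.2)).
pose A3 (z : R * R) := T^-1 * ((1 + -1 * clip ((d * T)^-1 * (z.2 - z.1) + 1)) * F (u z.1 z.2)).
pose A4 (z : R * R) := 27 / d ^+ 2 * ((d * T < z.2)%R%:R * D z.1 z.2).
have F0 z : 0 <= F (u z.1 z.2) by exact: potential_ge0.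
have A10 z : 0 <= A1 z by rewrite mulr_ge0 ?(ltW d0)// mulr_ge0// mulr_ge0 ?dclip_ge0// ltW.
have A20 z : 0 <= A2 z.
  apply: mulr_ge0; first by rewrite mulr_ge0// ltW.
  by rewrite mulr_ge0// mulr_ge0 ?dclip_ge0// ltW.
have A30 z : 0 <= A3 z.
  by rewrite mulr_ge0 ?invr_ge0 ?(ltW T0)// mulr_ge0// mulN1r subr_ge0 clip_le1.
have D0 z : 0 <= (d * T < z.2)%R%:R * D z.1 z.2.
  by apply: mulr_ge0 => //; exact: morawetz_density_ge0.
have A40 z : 0 <= A4 z.
  by apply: mulr_ge0 => //; rewrite divr_ge0// exprn_ge0// ltW.
have m1 : measurable_fun [set: R * R] A1.
  by apply: measurable_funM => //; exact: (mdc _ _ (fun x t => t + x)).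
have m2 : measurable_fun [set: R * R] A2.
  by apply: measurable_funM => //; exact: (mdc _ _ (fun x t => t - x)).
have m3 : measurable_fun [set: R * R] A3.
  apply: measurable_funM => //; apply: measurable_funM => //.
  apply: (@measurable_along _ (fun _ e => 1 + -1 * clip ((d * T)^-1 * e + 1))).
  have mg := bac_m (bounded_ac_lin 1 (-1) (bounded_ac_clip 1 k1)).
  by apply: (measurableT_comp mg); exact: measurable_snd.
have mD4 : measurable_fun [set: R * R] (fun z : R * R => (d * T < z.2)%R%:R * D z.1 z.2).
  apply: measurable_funM; last exact: measurable_morawetz_density cs.
  rewrite (_ : (fun _ => _) = (fun z : R * R => \1_(`](d * T), +oo[%classic) z.2)).
    by apply: measurableT_comp; [exact: measurable_indic|exact: measurable_snd].
  apply/funext => z; rewrite indicE; congr ((nat_of_bool _)%:R).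
  by apply/idP/idP; rewrite inE/= in_itv/= andbT.
have m4 : measurable_fun [set: R * R] A4 by exact: measurable_funM.
apply: (@le_trans _ _ (\int[mu2]_(z in slab T) ((A1 z)%:E + (A2 z)%:E + (A3 z)%:E + (A4 z)%:E))%E).
  apply: ge0_le_integral => //.
  - move=> z _; rewrite lee_fin mulr_ge0// mulr_ge0 ?dclip_ge0// invr_ge0 ltW//.
  - by apply/measurable_EFinP; apply: measurable_funTS; exact: (mdc _ _ (fun x t => t + x)).
  - by apply: measurable_funTS; do 3 (apply: emeasurable_funD; last exact/measurable_EFinP);
      exact/measurable_EFinP.
  - move=> [x t] [_ /=]; rewrite in_itv/= => /andP[t0 tT].
    by rewrite -!EFinD lee_fin; apply: strip_pointwise => //; exact: potential_ge0.
have me (f : R * R -> R) : measurable_fun [set: R * R] f ->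
    measurable_fun (slab T) (fun z => (f z)%:E).
  by move=> mf; apply: measurable_funTS; exact/measurable_EFinP.
rewrite ge0_integralD//; last 4 first.
- by move=> z _; rewrite -!EFinD lee_fin !addr_ge0.
- by do 2 (apply: emeasurable_funD; last exact: me); exact: me.
- by move=> z _; rewrite lee_fin.
- exact: me.
rewrite ge0_integralD//; last 4 first.
- by move=> z _; rewrite -!EFinD lee_fin !addr_ge0.
- by apply: emeasurable_funD; exact: me.
- by move=> z _; rewrite lee_fin.
- exact: me.
rewrite ge0_integralD//; last 4 first.
- by move=> z _; rewrite lee_fin.
- exact: me.
- by move=> z _; rewrite lee_fin.
- exact: me.
rewrite !EFinD; apply: leeD; first apply: leeD; first apply: leeD.
- rewrite /A1; under eq_integral => z _ do rewrite EFinM.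
  rewrite ge0_integralZl//; last 3 first.
  + by apply: me; exact: (mdc _ _ (fun x t => t + x)).
  + by move=> z _; rewrite lee_fin mulr_ge0// mulr_ge0 ?dclip_ge0// ltW.
  + by rewrite lee_fin ltW.
  by rewrite EFinM lee_wpmul2l ?lee_fin ?(ltW d0)//; apply: flux_near_plus => //; exact: ltW.
- rewrite /A2; under eq_integral => z _ do rewrite EFinM.
  have d20 : 0 <= 2 * d by rewrite mulr_ge0// ltW.
  rewrite ge0_integralZl//; last 2 first.
  + by apply: me; exact: (mdc _ _ (fun x t => t - x)).
  + by move=> z _; rewrite lee_fin mulr_ge0// mulr_ge0 ?dclip_ge0// ltW.
  by rewrite [leRHS]EFinM lee_wpmul2l ?lee_fin//; apply: flux_near_minus => //; exact: ltW.
- exact: exterior_flux.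
- rewrite /A4; under eq_integral => z _ do rewrite EFinM.
  have c0 : 0 <= 27 / d ^+ 2 by rewrite divr_ge0// exprn_ge0// ltW.
  rewrite ge0_integralZl//; last 2 first.
  + exact: me.
  + by move=> z _; rewrite lee_fin.
  rewrite (morawetz_total_diff p1 cs (ltW dT0) dTT) -EFinM; exact: lexx.
Qed.

Lemma initial_tail_ni (S T : R) : 0 < S -> S <= T -> tail T <= tail S.
Proof.
move=> S0 ST; have T0 : 0 < T := lt_le_trans S0 ST.
rewrite -lee_fin -!(initial_tail_fin cs)//.
have m (K : R) : 0 < K -> measurable_fun setT (fun x : R => (clip (K^-1 * x) * ep x 0)%:E).
  move=> K0; apply/measurable_EFinP; apply: measurable_funM.
    have := bac_m (bounded_ac_clip 0 (_ : 0 < K^-1)); rewrite invr_gt0 => /(_ K0).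
    by apply: eq_measurable_fun => x _; rewrite addr0.
  exact: measurable_slice 0 (measurable_energy_plus p1 cs).
apply: ge0_le_integral => //; [|exact: m|exact: m|].
  by move=> x _; rewrite lee_fin mulr_ge0 ?clip_ge0 ?energy_plus_ge0.
move=> x _; rewrite lee_fin ler_wpM2r ?energy_plus_ge0//.
have [x0|x0] := leP x 0.
  by rewrite clip_le0 ?clip_ge0// mulr_ge0_le0// invr_ge0 ltW.
by apply: clip_nd; rewrite ler_pM2r// lef_pV2 ?posrE.
Qed.

Lemma initial_tail_small (e : R) : 0 < e ->
  exists2 K : R, 0 < K & forall T, K <= T -> tail T < e.
Proof.
move=> e0.
have mf n : measurable_fun setT (fun x : R => (clip (n.+1%:R^-1 * x) * ep x 0)%:E).
  apply/measurable_EFinP; apply: measurable_funM.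
    have := bac_m (bounded_ac_clip 0 (_ : 0 < n.+1%:R^-1 :> R)); rewrite invr_gt0 => /(_ (ltr0Sn _ _)).
    by apply: eq_measurable_fun => x _; rewrite addr0.
  exact: measurable_slice 0 (measurable_energy_plus p1 cs).
have ie := integrable_energy0 cs.
have lim0 (x : R) : (fun n => (clip (n.+1%:R^-1 * x) * ep x 0)%:E) @ \oo --> 0%:E.
  apply: cvg_EFin; first by near=> n.
  have h : (n.+1%:R^-1 * (`|x| * ep x 0)) @[n --> \oo] --> (0 : R) by exact: cvg_harmonicM.
  apply: (squeeze_cvgr _ (cvg_cst 0) h); near=> n => /=.
  rewrite mulr_ge0 ?clip_ge0 ?energy_plus_ge0//= mulrA ler_wpM2r ?energy_plus_ge0//.
  have [x0|x0] := leP x 0.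
    by rewrite clip_le0 ?mulr_ge0// mulr_ge0_le0.
  rewrite (gtr0_norm x0); have [s1|s1] := leP (n.+1%:R^-1 * x) 1.
    by rewrite clip_mid// mulr_ge0// ltW.
  by rewrite (le_trans (clip_le1 _))// ltW.
have := @dominated_cvg _ _ _ mu setT measurableT _ (cst 0%:E) (fun x => (ep x 0)%:E) mf
  (fun x _ => lim0 x) (fun x _ => erefl) ie _.
rewrite integral0 => /(_ _) h.
have {}h : (\int[mu]_x (clip (n.+1%:R^-1 * x) * ep x 0)%:E)%E @[n --> \oo] --> 0%E.
  apply: h => n x _; rewrite lee_fin ger0_norm ?mulr_ge0 ?clip_ge0 ?energy_plus_ge0//.
  by rewrite ler_piMl ?clip_le1 ?energy_plus_ge0.
have /fine_cvgP[_] : (tail n.+1%:R)%:E @[n --> \oo] --> 0%:E.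
  by apply: cvg_trans h; apply: near_eq_cvg; near=> n; rewrite (initial_tail_fin cs (ltr0Sn _ _)).
move=> /cvgrPdist_lt/(_ _ e0)[n _ /(_ n (leqnn n))] /=; rewrite sub0r normrN => tn.
exists n.+1%:R => // T nT; apply: le_lt_trans tn.
by rewrite (le_trans _ (ler_norm _))// initial_tail_ni.
Unshelve. all: by end_near. Qed.

Lemma morawetz_total_nd (S T : R) : 0 <= S -> S <= T -> G S <= G T.
Proof.
move=> S0 ST; rewrite -subr_ge0 -lee_fin -(morawetz_total_diff p1 cs S0 ST).
apply: integral_ge0 => z _; rewrite lee_fin; apply: mulr_ge0 => //.
exact: morawetz_density_ge0.
Qed.

(** The total is nondecreasing and bounded, hence converges. *)
Lemma morawetz_total_cauchy (e : R) : 0 < e ->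
  exists2 K : R, 0 < K & forall S T, K <= S -> S <= T -> G T - G S < e.
Proof.
move=> e0; pose A := [set G T | T in [set T | 0 <= T]].
have bd : exists C, forall T : R, 0 <= T -> G T <= C.
  eexists => T T0; rewrite -lee_fin /morawetz_total /Rintegral fineK.
    exact: (integral_morawetz_density p1 cs T0).
  apply: integrable_fin_num; [exact: measurable_slab|].
  by have i := integrable_morawetz_density p1 cs T0; apply: i.
have [C GC] := bd.
have sA : has_sup A.
  split; first by exists (G 0), 0 => /=.
  by exists C => _ [T T0 <-]; exact: GC.
have [_ [K0 /= K0ge <-] hK] := sup_adherent e0 sA.
exists (K0 + 1); first by lra.
move=> S T KS ST; have S0 : K0 <= S by lra.
have h1 := morawetz_total_nd K0ge S0.
have h2 : G T <= sup A.
  apply: ub_le_sup; first by case: sA.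
  by exists T => //=; apply: le_trans ST; apply: le_trans S0.
lra.
Qed.

(** The weight [clip ((t + x) / T)] is at least [1 - c] where [x >= - c T] at
    time [T], and gains energy in the strip [0 < t + x <= T] only. *)
Lemma energy_interior_bound (c d T : R) : 0 < c -> c < 1 -> 0 < d -> d <= 1 -> 1 <= T ->
  (\int[mu]_(x in `[(- (c * T))%R, +oo[) (ep x T)%:E <=
   ((1 - c)^-1 * (tail T + (d * Ea + 2 * d * Eb + 2 * tail (d * T) +
     27 / d ^+ 2 * (G T - G (d * T)))))%:E)%E.
Proof.
move=> c0 c1 d0 d1 T1; have T0 : 0 < T by lra.
have c10 : 0 < 1 - c by rewrite subr_gt0.
have iT0 : 0 < T^-1 by rewrite invr_gt0.
have mep := measurable_slice T (measurable_energy_plus p1 cs).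
have bf := bounded_ac_clip 0 iT0; have mf := bac_m bf.
have := monotone_energy p1 cs (ltW T0) bf (bounded_ac_cst 1) (fun s => clip_ge0 _) _ (fun=> ler01)
  (fun=> lexx _).
have f'0 s : 0 <= T^-1 * dclip (T^-1 * s + 0) by rewrite mulr_ge0 ?dclip_ge0// ltW.
move=> /(_ f'0) main.
rewrite EFinM lee_pdivlMl//; apply: (le_trans _ (le_trans main _)).
  apply: (@le_trans _ _ (\int[mu]_(x in `[(- (c * T))%R, +oo[)
      (clip (T^-1 * (T + x) + 0) * 1 * ep x T)%:E)%E).
    rewrite -ge0_integralZl//; last 3 first.
    - by apply/measurable_EFinP; exact: measurable_funTS.
    - by move=> x _; rewrite lee_fin energy_plus_ge0.
    - by rewrite lee_fin ltW.
    apply: ge0_le_integral => //.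
    - by move=> x _; rewrite -EFinM lee_fin mulr_ge0 ?energy_plus_ge0// ltW.
    - by apply: measurable_funeM; apply/measurable_EFinP; exact: measurable_funTS.
    - apply/measurable_EFinP; apply: measurable_funTS; apply: measurable_funM => //.
      apply: measurable_funM => //; apply: (measurableT_comp mf); exact: measurable_funD.
    - move=> x; rewrite /= in_itv/= andbT => cx; rewrite -EFinM lee_fin mulr1.
      rewrite ler_wpM2r ?energy_plus_ge0//.
      have -> : 1 - c = clip (1 - c) by rewrite clip_mid; lra.
      by apply: clip_nd; rewrite addr0 ler_pdivlMl//; lra.
  apply: ge0_subset_integral => //.
  - apply/measurable_EFinP; apply: measurable_funM => //.
    by apply: measurable_funM => //; apply: (measurableT_comp mf); exact: measurable_funD.
  - by move=> x _; rewrite lee_fin mulr_ge0 ?energy_plus_ge0// mulr1 clip_ge0.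
rewrite EFinD; apply: leeD.
  rewrite -(initial_tail_fin cs T0) le_eqVlt; apply/orP; left; apply/eqP.
  by apply: eq_integral => x _; rewrite addr0 mulr1.
have := strip_bound d0 d1 T1; apply: le_trans.
rewrite le_eqVlt; apply/orP; left; apply/eqP.
by apply: eq_integral => z _; rewrite mulr1.
Qed.

Lemma energy_limit (c : R) : 0 < c -> c < 1 ->
  (\int[mu]_(x in `[(- (c * t))%R, +oo[) (ep x t)%:E)%E @[t --> +oo] --> 0%E.
Proof.
have alg (x1 x2 x3 x4 x5 y : R) : x1 < y -> x2 + x3 <= y -> x3 <= y -> x4 < y -> x5 < y ->
    0 <= x2 -> x1 + (x2 + 2 * x3 + 2 * x4 + x5) <= 6 * y by move=> *; lra.
move=> c0 c1; have c10 : 0 < 1 - c by rewrite subr_gt0.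
have E0 : 0 <= Ea by apply: Rintegral_ge0 => x _; exact: energy_plus_ge0.
have E1 : 0 <= Eb by apply: Rintegral_ge0 => x _; exact: energy_plus_ge0.
have key (e : R) : 0 < e -> exists2 K : R, 0 < K & forall T, K <= T ->
    (\int[mu]_(x in `[(- (c * T))%R, +oo[) (ep x T)%:E <= e%:E)%E.
  move=> e0; pose e' := (1 - c) * e / 6.
  have e'0 : 0 < e' by rewrite divr_gt0// mulr_gt0.
  (* The parameter [d] is chosen first, to make the flux terms small, and the
     time afterwards, depending on [d], for the tails. *)
  pose d := Num.min 1 (e' / (Ea + Eb + 1)).
  have EE : 0 < Ea + Eb + 1 by rewrite ltr_wpDl// addr_ge0.
  have d0 : 0 < d by rewrite lt_min ltr01 divr_gt0.
  have d1 : d <= 1 by rewrite ge_min lexx.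
  have dE : d * (Ea + Eb + 1) <= e'.
    by rewrite -ler_pdivlMr// ge_min lexx orbT.
  have [K1 K10 HK1] := initial_tail_small e'0.
  have f0 : 0 < e' / (27 / d ^+ 2) by rewrite divr_gt0// divr_gt0// exprn_gt0.
  have [K2 K20 HK2] := morawetz_total_cauchy f0.
  exists (1 + (K1 + K2) / d); first by rewrite addr_gt0// divr_gt0// addr_gt0.
  move=> T KT; have T1 : 1 <= T.
    by apply: le_trans KT; rewrite lerDl divr_ge0 ?addr_ge0// ltW.
  have dT : K1 + K2 <= d * T.
    rewrite -ler_pdivrMl// mulrC; apply: le_trans KT; by rewrite lerDr.
  have T0 : 0 <= T by rewrite (le_trans _ T1).
  have dTT : d * T <= T by rewrite ler_piMl.
  have h1 : tail (d * T) < e' by apply: HK1; rewrite (le_trans _ dT)// lerDl ltW.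
  have h2 : tail T < e'.
    by apply: HK1; rewrite (le_trans _ dTT)// (le_trans _ dT)// lerDl ltW.
  have h3 : 27 / d ^+ 2 * (G T - G (d * T)) < e'.
    rewrite -ltr_pdivlMl ?divr_gt0 ?exprn_gt0// [ltRHS]mulrC; apply: HK2 => //.
    by rewrite (le_trans _ dT)// lerDr ltW.
  apply: (le_trans (energy_interior_bound c0 c1 d0 d1 T1)).
  rewrite lee_fin ler_pdivrMl//.
  have dEb : d * Eb <= e' by apply: le_trans dE; rewrite ler_pM2l// -addrA addrCA lerDl addr_ge0.
  have dEa : d * Ea + d * Eb <= e' by apply: le_trans dE; rewrite -mulrDr ler_pM2l// lerDl.
  have e5 : (1 - c) * e = 6 * e' by rewrite /e'; field.
  rewrite e5 -(mulrA 2 d Eb).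
  exact: alg h2 dEa dEb h1 h3 (mulr_ge0 (ltW d0) E0).
apply/fine_cvgP; split.
  have [K K0 HK] := key 1 ltr01; exists K; split; first exact: num_real.
  move=> T KT; rewrite fin_numElt; apply/andP; split.
    by apply: (@lt_le_trans _ _ 0%E) => //; apply: integral_ge0 => x _; rewrite lee_fin energy_plus_ge0.
  by apply: le_lt_trans (HK T (ltW KT)) _; rewrite ltry.
apply/cvgrPdist_le => e e0; have [K K0 HK] := key e e0.
exists K; split; first exact: num_real.
move=> T KT /=; rewrite sub0r normrN ger0_norm; last first.
  by apply: fine_ge0; apply: integral_ge0 => x _; rewrite lee_fin energy_plus_ge0.
have h := HK T (ltW KT); rewrite -[e]/(fine e%:E); apply: fine_le h => //.
rewrite fin_numElt; apply/andP; split; last by apply: le_lt_trans (HK T (ltW KT)) _; rewrite ltry.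
by apply: (@lt_le_trans _ _ 0%E) => //; apply: integral_ge0 => x _; rewrite lee_fin energy_plus_ge0.
Qed.

End energy_limit.

(** * Smooth functions with compact support *)

Section test_functions.
Context {R : realType}.
Implicit Types (k a b c s x : R) (m n : nat).

(** The functions [s^-m exp (- k / s)], extended by 0: the linear span of this
    family is stable under differentiation. *)
Definition flat k m s : R := if 0 < s then s^-1 ^+ m * expR (- k / s) else 0.

Lemma flat_le0 k m s : s <= 0 -> flat k m s = 0.
Proof. by rewrite /flat leNgt => /negbTE->. Qed.

Lemma flat_ge0 k m s : 0 <= flat k m s.
Proof.
by rewrite /flat; case: ifPn => // s0; rewrite mulr_ge0 ?expR_ge0// exprn_ge0// invr_ge0 ltW.
Qed.

Lemma flat_bound k m s : 0 < k -> flat k m s <= (m.+1%:R / k) ^+ m.+1 * `|s|.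
Proof.
move=> k0; have C0 : 0 <= (m.+1%:R / k) ^+ m.+1 by rewrite exprn_ge0// divr_ge0// ltW.
have [s0|s0] := leP s 0; first by rewrite flat_le0// mulr_ge0.
rewrite /flat s0 gtr0_norm//.
set n := m.+1; have n0 : 0 < n%:R :> R by rewrite ltr0n.
have y0 : 0 < k / (s * n%:R) by rewrite divr_gt0// mulr_gt0.
have h1 : (k / (s * n%:R)) ^+ n <= expR (k / s).
  have -> : k / s = n%:R * (k / (s * n%:R)) by field; rewrite !gt_eqF.
  rewrite expRM_natl; apply: lerXn2r; rewrite ?nnegrE ?expR_ge0 ?(ltW y0)//.
  by apply: le_trans (expR_ge1Dx _); rewrite lerDr.
rewrite mulNr expRN -[leLHS]mulr1.
have e0 : 0 < expR (k / s) by exact: expR_gt0.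
rewrite mulr1 ler_pdivrMr//.
apply: (@le_trans _ _ ((n%:R / k) ^+ n * s * (k / (s * n%:R)) ^+ n)); last first.
  by apply: ler_wpM2l => //; rewrite mulr_ge0// ltW.
rewrite mulrAC -exprMn (_ : n%:R / k * _ = s^-1); last by field; rewrite !gt_eqF.
by rewrite /n exprSr -mulrA mulVf ?mulr1// gt_eqF.
Qed.

Lemma continuous_flat0 k m : 0 < k -> {for 0, continuous (flat k m)}.
Proof.
move=> k0; rewrite /prop_for /continuous_at [flat k m 0]flat_le0//.
have h : (m.+1%:R / k) ^+ m.+1 * `|s| @[s --> (0:R)] --> (0 : R).
  have := cvgM (cvg_cst ((m.+1%:R / k) ^+ m.+1) : _ @[s --> (0 : R)] --> _)
    (@norm_continuous _ R 0).
  by rewrite normr0 mulr0; apply.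
apply: (squeeze_cvgr _ (cvg_cst 0) h); near=> s.
by rewrite flat_ge0 flat_bound.
Unshelve. all: by end_near. Qed.

Lemma is_derive_flat k m s : 0 < k ->
  is_derive s (1 : R) (flat k m) (k * flat k m.+2 s - m%:R * flat k m.+1 s).
Proof.
move=> k0; have [s0|s0|<-] := ltgtP 0 s.
- apply: (@near_eq_is_derive _ _ _ (fun y : R => y^-1 ^+ m * expR (- k / y))).
    near=> y; rewrite /flat ifT//; near: y; exact: lt_nbhsr.
  have dV : is_derive s (1 : R) (fun y : R => y^-1) (- s ^- 2).
    have := @is_deriveV _ (fun y : R => y) s 1 1 (lt0r_neq0 s0) (is_derive_id _ _).
    by rewrite /GRing.scale/= mulr1.
  have dX : is_derive s (1 : R) (fun y : R => y^-1 ^+ m) (m%:R * s^-1 ^+ m.-1 * - s ^- 2).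
    have := is_deriveX m dV; rewrite (_ : GRing.exp _ m = (fun y : R => y^-1 ^+ m))//.
    by apply/funext => y; rewrite exprfctE.
  have dE : is_derive s (1 : R) (fun y : R => - k / y) (k * s^-1 ^+ 2).
    have := is_deriveZ (- k) dV; rewrite /GRing.scale/= mulrNN -exprVn; exact.
  have dexp := @is_derive1_comp _ expR (fun y : R => - k / y) _ _ _ (is_derive_expR _) dE.
  have := is_deriveM dX dexp; move/is_derive_eq; apply.
  rewrite /flat s0 /GRing.scale/=.
  case: m dX => [|m] dX; first by rewrite !mul0r mulr0 addr0 subr0 expr0 /=; ring.
  rewrite /= -exprVn !exprS; ring.
- apply: (@near_eq_is_derive _ _ _ (cst 0)).
    near=> y; rewrite flat_le0//; apply: ltW; near: y; exact: lt_nbhsl.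
  by rewrite !flat_le0 ?ltW// !mulr0 subr0; exact: is_derive_cst.
- rewrite !flat_le0// !mulr0 subr0; apply/is_derive1_caratheodory.
  exists (flat k m.+1); split.
  + move=> z; rewrite [flat k m 0]flat_le0// !subr0 /flat; case: ifPn => z0.
      by rewrite exprSr mulrAC -(mulrA _ _ z) mulVf ?mulr1// gt_eqF.
    by rewrite mul0r.
  + exact: continuous_flat0.
  + by rewrite flat_le0.
Unshelve. all: by end_near. Qed.

(** A class of functions stable under differentiation and containing the bump
    functions, so that a single first derivative computation proves smoothness
    to all orders. *)
Inductive bump_class : (R -> R) -> Prop :=
| bump_term k a b c m n : 0 < k ->
    bump_class (fun x => c * (flat k m (x - a) * flat k n (b - x)))
| bump_add f g : bump_class f -> bump_class g -> bump_class (fun x => f x + g x).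

Lemma bump_class_derive f : bump_class f ->
  exists2 f', bump_class f' & forall x, is_derive x (1 : R) f (f' x).
Proof.
elim=> [k a b c m n k0|f1 f2 _ [f1' h1 d1] _ [f2' h2 d2]]; last first.
  exists (fun x => f1' x + f2' x); first exact: bump_add.
  by move=> x; exact: is_deriveD.
exists (fun x => (c * k * (flat k m.+2 (x - a) * flat k n (b - x)) +
    - (c * m%:R) * (flat k m.+1 (x - a) * flat k n (b - x))) +
   (- (c * k) * (flat k m (x - a) * flat k n.+2 (b - x)) +
    c * n%:R * (flat k m (x - a) * flat k n.+1 (b - x)))).
  by apply: bump_add; apply: bump_add; exact: bump_term.
move=> x; have dl : is_derive x (1 : R) (fun y : R => y - a) 1.
  by have := is_deriveB (is_derive_id x (1 : R)) (is_derive_cst a x (1 : R)); rewrite subr0.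
have dr : is_derive x (1 : R) (fun y : R => b - y) (- 1).
  by have := is_deriveB (is_derive_cst b x (1 : R)) (is_derive_id x (1 : R)); rewrite sub0r.
have d1 := @is_derive1_comp _ (flat k m) (fun y => y - a) _ _ _ (is_derive_flat m (x - a) k0) dl.
have d2 := @is_derive1_comp _ (flat k n) (fun y => b - y) _ _ _ (is_derive_flat n (b - x) k0) dr.
have := is_deriveZ c (is_deriveM d1 d2); move/is_derive_eq; apply.
by rewrite /GRing.scale/=; ring.
Qed.

Lemma bump_class_smooth f : bump_class f -> forall n x, derivable (f^`(n))%classic x 1.
Proof.
move=> bf n; elim: n f bf => [|n IH] f bf x; have [f' bf' df] := bump_class_derive bf.
  by case: (df x).
rewrite derive1Sn (_ : f^`()%classic = f'); first exact: IH.
by apply/funext => y; rewrite derive1E; have d := df y; rewrite derive_val.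
Qed.

Lemma compact_support (f : R -> R) a b : (forall x, f x != 0 -> a <= x <= b) ->
  compact (closure [set x | f x != 0]).
Proof.
move=> fab; apply: (subclosed_compact _ (@segment_compact R a b)).
  exact: closed_closure.
have cab : closed (`[a, b]%classic : set R) by exact: interval_closed.
rewrite [X in _ `<=` X](closure_id _).1//; apply: closure_subset => x /= /fab.
by rewrite in_itv.
Qed.

(** Only the derivative needs to be in the class: primitives of bumps, which
    are not in it, are the useful test functions. *)
Lemma test_function_primitive f f' a b : bump_class f' ->
  (forall x, is_derive x (1 : R) f (f' x)) -> (forall x, f x != 0 -> a <= x <= b) ->
  test_function f.
Proof.
move=> bf' df /compact_support; split=> // n x; case: n => [|n].
  by case: (df x).
rewrite derive1Sn (_ : f^`()%classic = f'); first exact: bump_class_smooth.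
by apply/funext => y; rewrite derive1E; have d := df y; rewrite derive_val.
Qed.

Definition bump k a b x := flat k 0 (x - a) * flat k 0 (b - x).

Lemma bump_classP k a b : 0 < k -> bump_class (bump k a b).
Proof.
move=> k0; have := bump_term a b 1 0 0 k0; congr bump_class.
by apply/funext => x; rewrite mul1r.
Qed.

Lemma flat_le1 k s : 0 < k -> flat k 0 s <= 1.
Proof.
move=> k0; rewrite /flat; case: ifPn => // s0; rewrite expr0 mul1r.
by rewrite -expR0 ler_expR mulNr oppr_le0 divr_ge0// ltW.
Qed.

Lemma bump_ge0 k a b x : 0 <= bump k a b x.
Proof. by rewrite mulr_ge0// flat_ge0. Qed.

Lemma bump_le1 k a b x : 0 < k -> bump k a b x <= 1.
Proof. by move=> k0; rewrite mulr_ile1 ?flat_ge0 ?flat_le1. Qed.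

Lemma bump_supp k a b x : bump k a b x != 0 -> a < x < b.
Proof.
apply: contraTT; rewrite negb_and -!leNgt negbK => /orP[h|h]; apply/eqP.
  by rewrite /bump flat_le0 ?mul0r// subr_le0.
by rewrite /bump [X in _ * X]flat_le0 ?mulr0// subr_le0.
Qed.

End test_functions.

(** * Weak derivatives and almost everywhere equality *)

Section fundamental_lemma.
Context {R : realType}.
Notation mu := (@lebesgue_measure R).
Implicit Types (k a b c s x : R).

Lemma locally_integrable_segment (f : R -> R) a b : locally_integrable setT f ->
  mu.-integrable `[a, b] (EFin \o f).
Proof.
move=> [mf _ fK]; apply/integrableP; split.
  by apply/measurable_EFinP; exact: measurable_funTS.
exact: (fK `[a, b]%classic (@subsetT _ _) (@segment_compact R a b)).
Qed.

(** At a Lebesgue point, [|f x|] is at most the average of [|f - f x|] over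
    small balls, because [f] has average zero there. *)
Lemma ae_eq0_of_intervals (f : R -> R) : locally_integrable setT f ->
  (forall a b, a < b -> \int[mu]_(x in `]a, b[) f x = 0) ->
  {ae mu, forall x, f x = 0}.
Proof.
move=> lf f0; have := lebesgue_differentiation lf.
apply: (@filterS _ _ (ae_filter_ringOfSetsType mu)) => x.
rewrite /lebesgue_pt => dx; apply/eqP; rewrite -normr_le0 -lee_fin.
apply: (cvge_ge _ dx); near=> r.
have r0 : 0 < r by [].
have ball_itv : ball x r = `]x - r, x + r[%classic by rewrite ball_itv.
have mB : mu (ball x r) = (r *+ 2)%:E.
  rewrite ball_itv lebesgue_measure_itv/= lte_fin ifT; last by lra.
  by rewrite -EFinB; congr EFin; rewrite mulr2n; ring.
have iB : mu.-integrable (ball x r) (EFin \o f).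
  rewrite ball_itv; apply: integrableS (locally_integrable_segment (x - r) (x + r) lf) => //.
  exact: subset_itv_oo_cc.
have mBm : measurable (ball x r) by rewrite ball_itv; exact: measurable_itv.
have icst : mu.-integrable (ball x r) (EFin \o (fun=> f x)).
  apply: measurable_bounded_integrable => //.
    by rewrite [X in (X < _)%E]mB ltry.
  by exists (`|f x|); split => // y xy z _ /=; exact: ltW.
have idif : mu.-integrable (ball x r) (EFin \o (fun y => f y - f x)) by exact: integrable_EFinB.
have main : `|f x| * (r *+ 2) <= \int[mu]_(y in ball x r) `|f y - f x|.
  apply: le_trans (le_normr_Rintegral _ idif) => //.
  rewrite RintegralB// Rintegral_cst// [X in fine X]mB/= ball_itv f0; last by lra.
  by rewrite sub0r normrN normrM [`|r *+ 2|]ger0_norm// mulrn_wge0// ltW.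
rewrite /davg /iavg [X in X^-1%E]mB inver gt_eqF ?mulrn_wgt0//.
rewrite -lee_pdivrMl ?invr_gt0 ?mulrn_wgt0// invrK -EFinM mulrC.
apply: (@le_trans _ _ (\int[mu]_(y in ball x r) `|f y - f x|)%:E); first by rewrite lee_fin.
rewrite /Rintegral fineK; last first.
  by apply: integrable_fin_num => //; exact: integrable_norm idif.
exact: lexx.
Unshelve. all: by end_near. Qed.

Lemma continuous_bump k a b : 0 < k -> continuous (bump k a b).
Proof.
move=> k0 x; have [f' _ df] := bump_class_derive (bump_classP a b k0).
by apply: differentiable_continuous; apply/derivable1_diffP; case: (df x).
Qed.

Lemma integrable_bump k a b (f : R -> R) : 0 < k -> locally_integrable setT f ->
  mu.-integrable setT (EFin \o (fun x => f x * bump k a b x)).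
Proof.
move=> k0 lf; have i1 := locally_integrable_segment a b lf.
have mb : measurable_fun setT (bump k a b).
  by apply: continuous_measurable_fun; exact: continuous_bump.
have i2 : mu.-integrable `[a, b] (EFin \o (fun x => bump k a b x * f x)).
  apply: (@integrable_EFinM _ _ _ _ _ _ 1) i1 => //; first exact: measurable_funTS.
  by move=> x _; rewrite ger0_norm ?bump_ge0// bump_le1.
move: i2 => /integrable_mkcond => /(_ (measurable_itv _)); apply: eq_integrable => // x _.
rewrite /= patchE mulrC; case: ifPn => // /negP xab.
have -> : bump k a b x = 0; last by rewrite mul0r.
apply/eqP; apply: contrapT => /negP /bump_supp /andP[ax xb]; apply: xab.
by rewrite inE/= in_itv/= !ltW.
Qed.

End fundamental_lemma.

Section primitive_of_bump.
Context {R : realType}.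
Notation mu := (@lebesgue_measure R).
Variable d : R.
Hypothesis d0 : 0 < d.
Notation B := (bump 1 0 d).

Lemma integrable_bump1 : mu.-integrable setT (EFin \o B).
Proof.
have l1 : locally_integrable [set: R] (cst (1 : R)).
  split => //; first exact: openT.
  move=> K _ cK; rewrite (eq_integral (cst 1%:E)); last by move=> x _; rewrite normr1.
  by rewrite integral_cst ?mul1e; [exact: compact_finite_measure|exact: compact_measurable].
apply: eq_integrable (@integrable_bump _ 1 0 d (cst 1) ltr01 l1) => // x _.
by rewrite /= mul1r.
Qed.

Definition bump_mass := \int[mu]_x B x.

(** A smooth step from 0 to its mass on the segment from 0 to [d]. *)
Definition bump_prim x := \int[mu]_(y in `]-oo, x]) B y.

Lemma bump_mass_gt0 : 0 < bump_mass.
Proof.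
pose m := expR (- (4 / d)) ^+ 2.
have m0 : 0 < m by rewrite exprn_gt0// expR_gt0.
have d40 : 0 < d / 4 by rewrite divr_gt0.
have Bm x : d / 4 <= x -> x <= d / 4 * 3 -> m <= B x.
  move=> x1 x2; have x0 : 0 < x by lra.
  have x3 : 0 < d - x by lra.
  rewrite /bump /flat subr0 x0 x3 !expr0 !mul1r /m expr2.
  have le y : 0 < y -> d / 4 <= y -> expR (- (4 / d)) <= expR (-1 / y).
    move=> y0 dy; rewrite ler_expR mulN1r lerN2 -[leRHS]invf_div lef_pV2 ?posrE//.
  by apply: ler_pM; rewrite ?expR_ge0// le//; lra.
have iB := integrable_bump1.
have mI : measurable (`[d / 4, d / 4 * 3]%classic : set R) by exact: measurable_itv.
apply: (@lt_le_trans _ _ (\int[mu]_(x in `[(d / 4), (d / 4 * 3)]) m)).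
  rewrite Rintegral_cst//= [X in _ * fine X]lebesgue_measure_itv/= lte_fin ifT; last lra.
  by rewrite -EFinB /= mulr_gt0// subr_gt0; lra.
have iBI : mu.-integrable (`[d / 4, d / 4 * 3]%classic : set R) (EFin \o B).
  exact: integrableS iB.
apply: (@le_trans _ _ (\int[mu]_(x in `[(d / 4), (d / 4 * 3)]) B x)).
  apply: le_Rintegral => //.
    apply: measurable_bounded_integrable => //.
      exact: compact_finite_measure (@segment_compact R _ _).
    by exists `|m|; split => // y my z _ /=; exact: ltW.
  by move=> x; rewrite /= in_itv/= => /andP[x1 x2]; exact: Bm.
apply: fine_le.
- exact: integrable_fin_num iBI.
- exact: integrable_fin_num iB.
apply: ge0_subset_integral => //.
- by have := measurable_int _ iB.
- by move=> x _; rewrite lee_fin bump_ge0.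
Qed.

Lemma bump_prim_le0 x : x <= 0 -> bump_prim x = 0.
Proof.
move=> x0; rewrite /bump_prim /Rintegral integral0_eq// => y /=; rewrite in_itv/= => yx.
congr EFin; apply/eqP; apply: contrapT => /negP /bump_supp /andP[y0 _].
by move: (lt_le_trans y0 (le_trans yx x0)); rewrite ltxx.
Qed.

Lemma bump_prim_ge x : d <= x -> bump_prim x = bump_mass.
Proof.
move=> dx; rewrite /bump_prim /bump_mass /Rintegral [in LHS]integral_mkcond; congr fine.
apply: eq_integral => y _; rewrite patchE; case: ifPn => // yx; congr EFin; apply/esym/eqP.
apply: contrapT => /negP /bump_supp /andP[_ yd]; move/negP: yx; apply.
by rewrite inE/= in_itv/= ltW// (lt_le_trans yd).
Qed.

Lemma bump_prim_bd x : 0 <= bump_prim x <= bump_mass.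
Proof.
have iB := integrable_bump1; apply/andP; split.
  by apply: Rintegral_ge0 => y _; exact: bump_ge0.
apply: fine_le.
- by apply: integrable_fin_num => //; exact: integrableS iB.
- exact: integrable_fin_num iB.
apply: ge0_subset_integral => //.
- by have := measurable_int _ iB.
- by move=> y _; rewrite lee_fin bump_ge0.
Qed.

Lemma is_derive_bump_prim x : is_derive x (1 : R) bump_prim (B x).
Proof.
have iB := integrable_bump1.
have := @continuous_FTC1 _ B -oo%O x (x + 1) _ _ _ (@continuous_bump _ 1 0 d ltr01 x).
rewrite /= ltrDl => /(_ ltr01) h.
have [||dP eP] := h; [by exact: integrableS iB|exact: ltNyr|].
by split; [exact: dP|rewrite -derive1E eP].
Qed.

End primitive_of_bump.

Section du_Bois_Reymond.
Context {R : realType}.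
Notation mu := (@lebesgue_measure R).
Implicit Types (a b c l r x : R).

(** A smooth approximation of the indicator function of [l, r], which is a
    test function although built from primitives: the two steps cancel to the
    right of [r + d]. *)
Definition ramp d l r x := (bump_mass d)^-1 * (bump_prim d (x - l) - bump_prim d (x - r)).
Definition dramp d l r x := (bump_mass d)^-1 * (bump 1 0 d (x - l) - bump 1 0 d (x - r)).

Lemma is_derive_ramp d l r x : 0 < d ->
  is_derive x (1 : R) (ramp d l r) (dramp d l r x).
Proof.
move=> d0; have dl c : is_derive x (1 : R) (fun y : R => bump_prim d (y - c)) (bump 1 0 d (x - c)).
  have dc : is_derive x (1 : R) (fun y : R => y - c) 1.
    by have := is_deriveB (is_derive_id x (1 : R)) (is_derive_cst c x (1 : R)); rewrite subr0.
  have := @is_derive1_comp _ (bump_prim d) (fun y => y - c) _ _ _ (is_derive_bump_prim d (x - c)) dc.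
  by rewrite mulr1.
exact: is_deriveZ (is_deriveB (dl l) (dl r)).
Qed.

Lemma test_function_ramp d l r : 0 < d -> l <= r -> test_function (ramp d l r).
Proof.
move=> d0 lr; apply: (@test_function_primitive _ _ (dramp d l r) l (r + d)).
- have h := bump_add (bump_term l (l + d) ((bump_mass d)^-1) 0 0 ltr01)
    (bump_term r (r + d) (- (bump_mass d)^-1) 0 0 ltr01).
  have := h; congr bump_class; apply/funext => x; rewrite /dramp /bump !subr0 mulrBr mulNr.
  by congr (_ * (_ * flat _ _ _) - _ * (_ * flat _ _ _)); ring.
- by move=> x; exact: is_derive_ramp.
- move=> x; apply: contraTT; rewrite negb_and -!ltNge negbK => /orP[h|h]; apply/eqP.
    by rewrite /ramp !bump_prim_le0 ?subrr ?mulr0//; lra.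
  by rewrite /ramp !bump_prim_ge ?subrr ?mulr0//; lra.
Qed.

Lemma ramp_bd d l r x : 0 < d -> l <= r -> `|ramp d l r x| <= 1.
Proof.
move=> d0 lr; have c0 := bump_mass_gt0 d0.
have /andP[a0 a1] := bump_prim_bd d (x - l); have /andP[b0 b1] := bump_prim_bd d (x - r).
rewrite /ramp normrM gtr0_norm ?invr_gt0// mulrC ler_pdivrMr// mul1r ler_norml.
by apply/andP; split; lra.
Qed.

(** The limit is the indicator function of the interval open at [l] and closed
    at [r], since each step vanishes at its starting point. *)
Lemma ramp_cvg l r x : l <= r ->
  ramp n.+1%:R^-1 l r x @[n --> \oo] --> (\1_(`]l, r]%classic) x : R).
Proof.
move=> lr; have hp n : 0 < n.+1%:R^-1 :> R by rewrite invr_gt0.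
have lim c : (c < x)%R%:R = (0 < x - c)%R%:R :> R by rewrite subr_gt0.
have P c : (bump_mass n.+1%:R^-1)^-1 * bump_prim n.+1%:R^-1 (x - c) @[n --> \oo] -->
    (((c < x)%R)%:R : R).
  have [cx|cx] := ltP c x; last first.
    apply: cvg_near_cst; near=> n; by rewrite bump_prim_le0 ?mulr0// subr_le0.
  apply: cvg_near_cst; near=> n; rewrite bump_prim_ge ?mulVf ?gt_eqF ?bump_mass_gt0//.
  near: n; have xc : 0 < x - c by rewrite subr_gt0.
  have := @cvg_harmonic R => /cvgrPdist_le/(_ _ xc); apply: filterS => n.
  by rewrite sub0r normrN ger0_norm// harmonic_ge0.
have val : (l < x)%R%:R - (r < x)%R%:R = \1_(`]l, r]%classic) x :> R.
  rewrite indicE mem_setE in_itv/=; have [rx|xr] := ltP r x.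
    by rewrite (le_lt_trans lr rx) andbF subrr.
  by rewrite subr0 andbT.
rewrite -val (_ : (fun n => ramp _ _ _ _) = (fun n : nat =>
  (bump_mass n.+1%:R^-1)^-1 * bump_prim n.+1%:R^-1 (x - l) -
  (bump_mass n.+1%:R^-1)^-1 * bump_prim n.+1%:R^-1 (x - r))); first by apply: cvgB; exact: P.
by apply/funext => n; rewrite /ramp mulrBr.
Unshelve. all: by end_near. Qed.

Lemma locally_integrable_continuous (v : R -> R) : continuous v ->
  locally_integrable [set: R] v.
Proof.
move=> cv; split; [exact: continuous_measurable_fun|exact: openT|].
move=> K _ cK; have := continuous_compact_integrable cK (continuous_subspaceT cv).
by case/integrableP.
Qed.

(** The derivative of a ramp averages [v] over short segments to the right of
    its end points. *)
Lemma ramp_average d c (v : R -> R) e : 0 < d -> continuous v ->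
  (forall x, 0 <= x -> x <= d -> `|v (x + c) - v c| <= e) ->
  `|\int[mu]_x (v x * bump 1 0 d (x - c)) - v c * bump_mass d| <= e * bump_mass d.
Proof.
move=> d0 cv ve; have iB := integrable_bump1 d.
have cw : continuous (fun x => v (x + c)).
  by move=> x; apply: continuous_comp; [apply: cvgD; [exact: cvg_id|exact: cvg_cst]|exact: cv].
have i1 := @integrable_bump _ 1 0 d _ ltr01 (locally_integrable_continuous cw).
have -> : \int[mu]_x (v x * bump 1 0 d (x - c)) = \int[mu]_x (v (x + c) * bump 1 0 d x).
  rewrite /Rintegral; congr fine.
  have i1' := @integral_shift _ (- c) _ i1.
  rewrite -i1'; apply: eq_integral => x _ /=.
  by rewrite subrK.
have i2 : mu.-integrable setT (EFin \o (fun x => v c * bump 1 0 d x)) by exact: integrable_EFinZ.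
rewrite /bump_mass -!RintegralZl// -RintegralB//.
apply: (le_trans (le_normr_Rintegral measurableT _)); first exact: integrable_EFinB.
apply: le_Rintegral => //.
- by apply: integrable_norm; exact: integrable_EFinB.
- exact: integrable_EFinZ.
move=> x _; rewrite -mulrBl normrM (ger0_norm (bump_ge0 _ _ _ _)).
have [/eqP ->|/bump_supp/andP[x0 xd]] := boolP (bump 1 0 d x == 0); first by rewrite !mulr0.
by apply: ler_wpM2r; [exact: bump_ge0|apply: ve; exact: ltW].
Qed.

Lemma ramp_integral_cvg (g : R -> R) l r : locally_integrable setT g -> l <= r ->
  \int[mu]_x (g x * ramp n.+1%:R^-1 l r x) @[n --> \oo] --> \int[mu]_(x in `[l, r]) g x.
Proof.
move=> lg lr; have hp n : 0 < n.+1%:R^-1 :> R by rewrite invr_gt0.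
have mg : measurable_fun setT g by case: lg.
have ir d : 0 < d -> measurable_fun setT (ramp d l r).
  move=> d0; apply: continuous_measurable_fun => x; apply: differentiable_continuous.
  by apply/derivable1_diffP; case: (is_derive_ramp l r x d0).
have rsupp d x : 0 < d -> ramp d l r x != 0 -> l <= x <= r + d.
  move=> d0; apply: contraTT; rewrite negb_and -!ltNge negbK => /orP[h|h]; apply/eqP.
    by rewrite /ramp !bump_prim_le0 ?subrr ?mulr0//; lra.
  by rewrite /ramp !bump_prim_ge ?subrr ?mulr0//; lra.
have ig := locally_integrable_segment l (r + 1) lg.
pose G x := `|g x|.
have dom : mu.-integrable setT ((EFin \o G) \_ `[l, r + 1]).
  have := integrable_normr_itv ig.
  by move=> /integrable_mkcond => /(_ (measurable_itv _)).
have gl x : (g x * ramp n.+1%:R^-1 l r x)%:E @[n --> \oo] --> (g x * \1_(`]l, r]%classic) x)%:E.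
  apply: cvg_EFin; first by near=> n.
  by apply: cvgM; [exact: cvg_cst|exact: ramp_cvg].
have domx n x : (`|(g x * ramp n.+1%:R^-1 l r x)%:E| <= ((EFin \o G) \_ `[l, (r + 1)%R]) x)%E.
  rewrite patchE; case: ifPn => [_|xab].
    by rewrite /= lee_fin normrM ler_piMr// ramp_bd.
  rewrite lee_fin normr_le0 mulf_eq0; apply/orP; right; apply: contraNT xab.
  move=> /(rsupp _ _ (hp n))/andP[lx xr]; rewrite inE/= in_itv/= lx/= (le_trans xr)// lerD2l.
  by rewrite invf_le1// ler1n.
have ign n : mu.-integrable setT (fun x => (g x * ramp n.+1%:R^-1 l r x)%:E).
  apply: le_integrable dom => //.
    by apply/measurable_EFinP; apply: measurable_funM => //; exact: ir.
  move=> x _; apply: (le_trans (domx n x)); exact: lee_abs.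
have := @dominated_cvg _ _ _ mu setT measurableT _ _ _ (fun n => measurable_int _ (ign n))
  (fun x _ => gl x) _ dom (fun n x _ => domx n x).
have fd x : setT x -> ((EFin \o G) \_ `[l, r + 1]) x \is a fin_num.
  by move=> _; rewrite patchE; case: ifP.
move=> /(_ fd) h; apply: fine_cvg.
rewrite (_ : (fine _)%:E = \int[mu]_x (g x * \1_(`]l, r]%classic) x)%:E)%E//.
have igI : mu.-integrable (`]l, r]%classic : set R) (EFin \o g).
  apply: integrableS (locally_integrable_segment l r lg) => //.
  exact: subset_itv_oc_cc.
transitivity (\int[mu]_(x in `]l, r]) g x)%:E.
  by congr EFin; exact: (esym (Rintegral_itv_obnd_cbnd igI)).
rewrite /Rintegral fineK; last by apply: integrable_fin_num.
rewrite integral_mkcond; apply: eq_integral => x _; rewrite patchE indicE.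
by case: ifPn => _; rewrite ?mulr1 ?mulr0.
Unshelve. all: by end_near. Qed.

Lemma ae_eq0_of_test (f : R -> R) : locally_integrable setT f ->
  (forall phi, test_function phi -> \int[mu]_x (f x * phi x) = 0) ->
  {ae mu, forall x, f x = 0}.
Proof.
move=> lf ft; apply: ae_eq0_of_intervals => // a b ab.
have := ramp_integral_cvg lf (ltW ab).
rewrite (_ : (fun n : nat => _) = cst 0); last first.
  by apply/funext => n; apply: ft; apply: test_function_ramp; [rewrite invr_gt0|exact: ltW].
move=> /(cvg_unique (@Rhausdorff R) (@cvg_cst _ _ _ _ _)) I0.
have i1 := locally_integrable_segment a b lf.
rewrite Rintegral_itv_bndo_bndc; last first.
  by apply: integrableS i1 => //; exact: subset_itv_oo_cc.
rewrite Rintegral_itv_obnd_cbnd ?I0//.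
by apply: integrableS i1 => //; exact: subset_itv_oc_cc.
Qed.

(** Du Bois-Reymond: in the definition of the weak derivative tested against
    ramps, one side tends to the integral of [g] over the segment and the
    other one to the increment of [v]. *)
Lemma weak_derivative_primitive (v g : R -> R) l r : continuous v -> weak_derivative v g ->
  l <= r -> v r - v l = \int[mu]_(x in `[l, r]) g x.
Proof.
move=> cv [_ lg wd] lr.
have hp n : 0 < n.+1%:R^-1 :> R by rewrite invr_gt0.
have mg : measurable_fun setT g by case: lg.
have lim1 := ramp_integral_cvg lg lr.
have wdn n := wd _ (test_function_ramp (hp n) lr).
have ramp' n : (ramp n.+1%:R^-1 l r)^`()%classic = dramp n.+1%:R^-1 l r.
  by apply/funext => x; rewrite derive1E; have dx := is_derive_ramp l r x (hp n); rewrite derive_val.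
have lim2 : \int[mu]_x (g x * ramp n.+1%:R^-1 l r x) @[n --> \oo] --> v r - v l.
  apply/cvgrPdist_le => e e0; have e20 : 0 < e / 2 by rewrite divr_gt0.
  have /cvgrPdist_le/(_ _ e20)/nbhs_ballP[d1 /= d10 hd1] := cv l.
  have /cvgrPdist_le/(_ _ e20)/nbhs_ballP[d2 /= d20 hd2] := cv r.
  have d120 : 0 < Num.min d1 d2 by rewrite lt_min d10.
  near=> n; have dd : n.+1%:R^-1 < Num.min d1 d2 :> R.
    near: n; have := @cvg_harmonic R => /cvgrPdist_lt/(_ _ d120); apply: filterS => n.
    by rewrite sub0r normrN ger0_norm// harmonic_ge0.
  pose d : R := n.+1%:R^-1; have d0 : 0 < d by exact: hp.
  rewrite -/d in dd.
  move: dd; rewrite lt_min => /andP[dd1 dd2]; have c0 := bump_mass_gt0 d0.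
  have al : `|\int[mu]_x (v x * bump 1 0 d (x - l)) - v l * bump_mass d| <= e / 2 * bump_mass d.
    apply: ramp_average => // x x0 xd; rewrite distrC; apply: hd1.
    by rewrite /ball/= opprD addrCA subrr addr0 normrN ger0_norm// (le_lt_trans xd).
  have ar : `|\int[mu]_x (v x * bump 1 0 d (x - r)) - v r * bump_mass d| <= e / 2 * bump_mass d.
    apply: ramp_average => // x x0 xd; rewrite distrC; apply: hd2.
    by rewrite /ball/= opprD addrCA subrr addr0 normrN ger0_norm// (le_lt_trans xd).
  have ib c : mu.-integrable setT (EFin \o (fun x => v x * bump 1 0 d (x - c))).
    apply: eq_integrable (@integrable_bump _ 1 c (c + d) v ltr01 (locally_integrable_continuous cv)) => // x _.
    by rewrite /= /bump subr0 (_ : c + d - x = d - (x - c))//; ring.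
  have := wdn n; rewrite ramp' => /eqP; rewrite eq_sym eqr_oppLR => /eqP ->.
  have -> : \int[mu]_x (v x * dramp n.+1%:R^-1 l r x) = (bump_mass d)^-1 *
     (\int[mu]_x (v x * bump 1 0 d (x - l)) - \int[mu]_x (v x * bump 1 0 d (x - r))).
    rewrite -RintegralB// -RintegralZl//; last exact: integrable_EFinB.
    by apply: eq_Rintegral => x _; rewrite /dramp -/d; ring.
  move: al ar; set I1 := \int[mu]_x _; set I2 := \int[mu]_x _ => al ar.
  rewrite (_ : v r - v l - - _ = (bump_mass d)^-1 *
    ((I1 - v l * bump_mass d) - (I2 - v r * bump_mass d))); last first.
    by field; rewrite gt_eqF.
  rewrite normrM gtr0_norm ?invr_gt0// ler_pdivrMl//.
  rewrite (le_trans (ler_normB _ _))// (le_trans (lerD al ar))//.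
  by rewrite -mulrDl -splitr mulrC.
by have := cvg_unique _ lim2 lim1; apply.
Unshelve. all: by end_near. Qed.

End du_Bois_Reymond.

(** * Parametric integrals of continuous functions *)

Section parametric_integrals.
Context {R : realType}.
Notation mu := (@lebesgue_measure R).
Notation mu2 := (mu \x mu)%E.

Lemma integrable_continuous (h : R -> R) (l r : R) : continuous h ->
  mu.-integrable `[l, r] (EFin \o h).
Proof.
move=> ch; apply: continuous_compact_integrable; first exact: segment_compact.
exact: continuous_subspaceT.
Qed.

Lemma ac_on_primitive (g : R -> R) l r : mu.-integrable `[l, r] (EFin \o g) ->
  ac_on l r (fun x => \int[mu]_(y in `[l, x]) g y) g.
Proof.
move=> ig; split => // s t ls st tr.
rewrite (@Rintegral_itv_cat _ g l s t)//; last exact: integrable_sub_itv ig.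
by rewrite addrAC subrr add0r.
Qed.

Lemma Rintegral_itv_bound (g : R -> R) l r C :
  mu.-integrable `[l, r] (EFin \o g) -> l <= r ->
  (forall x, l <= x -> x <= r -> `|g x| <= C) ->
  `|\int[mu]_(x in `[l, r]) g x| <= C * (r - l).
Proof.
move=> ig lr gC; have ic := integrable_continuous l r (@cst_continuous _ _ C).
apply: (le_trans (le_normr_Rintegral _ ig)) => //.
apply: (@le_trans _ _ (\int[mu]_(x in `[l, r]) C)).
  apply: le_Rintegral => //; first exact: integrable_normr_itv.
  by move=> x /=; rewrite in_itv/= => /andP[]; exact: gC.
rewrite Rintegral_cst//; move: lr; rewrite le_eqVlt => /predU1P[<-|lr].
  by rewrite set_itv1 [X in fine X]lebesgue_measure_set1 subrr.
by rewrite [X in fine X]lebesgue_measure_itv/= lte_fin lr -EFinD.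
Qed.

Lemma measurable_triangle (t : R) :
  measurable [set z : measurableTypeR R * measurableTypeR R | 0 <= z.2 /\ z.2 <= z.1 /\ z.1 <= t].
Proof.
have m1 : measurable_fun [set: R * R] (fun z : R * R => z.1) by exact: measurable_fst.
have m2 : measurable_fun [set: R * R] (fun z : R * R => z.2) by exact: measurable_snd.
have le (f g : R * R -> R) : measurable_fun [set: R * R] f -> measurable_fun [set: R * R] g ->
    measurable [set z : R * R | f z <= g z].
  move=> mf mg; rewrite -[X in measurable X]setTI.
  exact: measurable_fun_le.
rewrite (_ : [set z | _] = [set z : R * R | 0 <= z.2] `&`
  ([set z : R * R | z.2 <= z.1] `&` [set z : R * R | z.1 <= t])); last by [].
by apply: measurableI; [exact: (le (cst 0))|apply: measurableI; [exact: le|exact: (le _ (cst t))]].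
Qed.

(** Fubini's theorem for the indicator function of the triangle [0 <= s <= r
    <= t]. *)
Lemma triangle_fubini (h : R -> R -> R) (t : R) : continuous (fun z : R * R => h z.1 z.2) ->
  0 <= t ->
  \int[mu]_(r in `[0, t]) \int[mu]_(s in `[0, r]) h r s =
  \int[mu]_(s in `[0, t]) \int[mu]_(r in `[s, t]) h r s.
Proof.
move=> ch t0; pose D := [set z : measurableTypeR R * measurableTypeR R |
   0 <= z.2 /\ z.2 <= z.1 /\ z.1 <= t].
have mD : measurable D by exact: measurable_triangle.
have mh := continuous_plane_measurable ch.
have [C [_ HC]] : bounded_set ((fun z : R * R => h z.1 z.2) @` (`[0, t] `*` `[0, t])).
  apply: compact_bounded; apply: continuous_compact; first exact: continuous_subspaceT.
  by apply: compact_setX; exact: segment_compact.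
have {}HC r s : D (r, s) -> `|h r s| <= `|C| + 1.
  move=> [/= s0 [sr rt]]; apply: (HC (`|C| + 1)).
    by rewrite (le_lt_trans (ler_norm C))// ltrDl.
  by exists (r, s) => //; split; rewrite /= in_itv/=; apply/andP; split => //; lra.
have finD : (mu2 D < +oo)%E.
  apply: (@le_lt_trans _ _ (mu2 (`[0, t]%classic `*` `[0, t]%classic))).
    apply: le_measure; rewrite ?inE//; first by apply: measurableX; exact: measurable_itv.
    by move=> [r s] [/= s0 [sr rt]]; split; rewrite /= in_itv/=; apply/andP; split => //; lra.
  have fin : (mu `[0%R, t]%classic < +oo)%E.
    exact: compact_finite_measure (@segment_compact R 0 t).
  rewrite product_measure1E//; apply: lte_mul_pinfty => //.
  by rewrite ge0_fin_numE.
have iD : mu2.-integrable D (EFin \o (fun z => h z.1 z.2)).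
  apply: measurable_bounded_integrable => //; first exact: measurable_funTS.
  by exists (`|C| + 1); split; [exact: num_real|move=> M CM [r s] Drs /=; apply: ltW; apply: le_lt_trans CM; exact: HC].
have iH : mu2.-integrable setT ((EFin \o (fun z => h z.1 z.2)) \_ D).
  exact/(integrable_mkcond _ mD).
have ch1 r : continuous (h r).
  move=> s; apply: (@continuous2_cvg _ _ _ _ _ _ (cst r) id h r s); [exact: (ch (r, s))|exact: cvg_cst|exact: cvg_id].
have ch2 s : continuous (h^~ s).
  move=> r; apply: (@continuous2_cvg _ _ _ _ _ _ id (cst s) h r s); [exact: (ch (r, s))|exact: cvg_id|exact: cvg_cst].
have := Fubini iH.
have -> : (\int[mu]_x \int[mu]_y ((EFin \o (fun z => h z.1 z.2)) \_ D) (x, y) =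
    \int[mu]_(r in `[0%R, t]) (\int[mu]_(s in `[0%R, r]) h r s)%R%:E)%E.
  rewrite [RHS]integral_mkcond; apply: eq_integral => r _; rewrite patchE; case: ifPn => rt.
    rewrite /Rintegral fineK; last first.
      by apply: integrable_fin_num => //; exact: integrable_continuous.
    rewrite [RHS]integral_mkcond; apply: eq_integral => s _; rewrite !patchE.
    congr (if _ then _ else _); move: rt; rewrite inE/= in_itv/= => /andP[r0 rt].
    apply/idP/idP; rewrite !inE/= in_itv/=.
      by move=> [/= -> [-> _]].
    by move=> /andP[s0 sr]; split => //=; split.
  apply: integral0_eq => s _; rewrite patchE ifN//; apply: contra rt; rewrite !inE/= in_itv/=.
  by move=> [/= s0 [sr ->]]; rewrite (le_trans s0).
have -> : (\int[mu]_y \int[mu]_x ((EFin \o (fun z => h z.1 z.2)) \_ D) (x, y) =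
    \int[mu]_(s in `[0%R, t]) (\int[mu]_(r in `[s, t]) h r s)%R%:E)%E.
  rewrite [RHS]integral_mkcond; apply: eq_integral => s _; rewrite patchE; case: ifPn => st.
    rewrite /Rintegral fineK; last first.
      by apply: integrable_fin_num => //; exact: (integrable_continuous _ _ (ch2 s)).
    rewrite [RHS]integral_mkcond; apply: eq_integral => r _; rewrite !patchE.
    congr (if _ then _ else _); move: st; rewrite inE/= in_itv/= => /andP[s0 st].
    apply/idP/idP; rewrite !inE/= in_itv/=.
      by move=> [/= _ [-> ->]].
    by move=> /andP[sr rt]; split => //=; split.
  apply: integral0_eq => r _; rewrite patchE ifN//; apply: contra st; rewrite !inE/= in_itv/=.
  by move=> [/= -> [sr rt]]; rewrite (le_trans sr).
by move=> E; rewrite /Rintegral [X in fine X = _]E.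
Qed.

(** Measurability in the parameter comes from Tonelli's theorem for the
    positive and for the negative part. *)
Lemma measurable_parametric (h : (R * R) * R -> R) :
  measurable_fun [set: (R * R) * R] h ->
  measurable_fun [set: R * R] (fun z : R * R => \int[mu]_(s in `[0, z.2]) h (z, s)).
Proof.
move=> mh; pose D := [set w : (R * R) * R | 0 <= w.2 /\ w.2 <= w.1.2].
have le (f g : (R * R) * R -> R) : measurable_fun setT f -> measurable_fun setT g ->
    measurable [set w : (R * R) * R | f w <= g w].
  move=> mf mg; rewrite -[X in measurable X]setTI.
  exact: measurable_fun_le.
have m2 : measurable_fun [set: (R * R) * R] (fun w : (R * R) * R => w.2) by exact: measurable_snd.
have m12 : measurable_fun [set: (R * R) * R] (fun w : (R * R) * R => w.1.2).
  by apply: (measurableT_comp measurable_snd); exact: measurable_fst.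
have mD : measurable D.
  rewrite (_ : D = [set w | 0 <= w.2] `&` [set w | w.2 <= w.1.2])//.
  by apply: measurableI; [exact: (le (cst 0))|exact: le].
pose K : (R * R) * R -> \bar R := (EFin \o h) \_ D.
have mK : measurable_fun [set: (R * R) * R] K.
  by apply/(measurable_restrictT _ mD)/measurable_funTS/measurable_EFinP.
rewrite (_ : (fun z => _) = (fun z => fine (fubini_F mu K^\+ z - fubini_F mu K^\- z)%E)).
  apply: (measurableT_comp (@fine_measurable R setT measurableT)).
  apply: emeasurable_funB; apply: measurable_fun_fubini_tonelli_F => //.
    exact: measurable_funepos.
  exact: measurable_funeneg.
apply/funext => -[x t]; rewrite /Rintegral; congr fine.
rewrite integral_mkcond (_ : _ \_ _ = (fun s => K ((x, t), s))); last first.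
  apply/funext => s; rewrite /K !patchE /D /=; congr (if _ then _ else _).
  by apply/idP/idP; rewrite !inE/= in_itv/=; move/andP.
by rewrite integralE /fubini_F funepos.unlock funeneg.unlock.
Qed.

End parametric_integrals.

(** * From the integral equation to the characteristic system *)

Section characteristic_derivative.
Context {R : realType}.
Notation mu := (@lebesgue_measure R).
Notation mu2 := (mu \x mu)%E.
Variable p : R.
Hypothesis p1 : 1 < p.
Notation N := (nonlinearity p).

Variables (u : R -> R -> R) (al : R -> R).
Hypothesis cu : continuous (fun z : R * R => u z.1 z.2).
Hypothesis mal : measurable_fun [set: R] al.
Hypothesis ial : mu.-integrable setT (fun x => (al x ^+ 2)%:E).
Hypothesis dal : forall z t : R, 0 <= t -> u (z + t) t - u z 0 =
  2^-1 * \int[mu]_(x in `[z, z + 2 * t]) al x -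
  2^-1 * \int[mu]_(s in `[0, t]) \int[mu]_(y in `[z + s, z + 2 * t - s]) N (u y s).

Definition duhamel (x t : R) : R := \int[mu]_(s in `[0, t]) N (u (x + t - s) s).

(** Duhamel's formula for [u_t + u_x]. It is defined everywhere, which makes
    exact statements along every characteristic possible. *)
Definition char_deriv (x t : R) : R := al (x + t) - duhamel x t.

Let cNu : continuous (fun z : R * R => N (u z.1 z.2)).
Proof. by move=> z; apply: continuous_comp; [exact: cu|exact: continuous_nonlinearity]. Qed.
Arguments cNu : clear implicits.

Let cNu_along (f g : R -> R) : continuous f -> continuous g ->
  continuous (fun s => N (u (f s) (g s))).
Proof.
move=> cf cg s.
apply: (@continuous2_cvg _ _ _ _ _ _ f g (fun x t => N (u x t)) (f s) (g s)).
- exact: (cNu (f s, g s)).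
- exact: cf.
- exact: cg.
Qed.

Let cNs (x : R) : continuous (fun s => N (u (x - s) s)).
Proof.
apply: (@cNu_along (fun s => x - s) id); last by move=> s; exact: cvg_id.
by move=> s; apply: cvgB; [exact: cvg_cst|exact: cvg_id].
Qed.

Arguments cNs : clear implicits.

Lemma duhamel_along (z t : R) : duhamel (z + -1 * t) t = \int[mu]_(s in `[0, t]) N (u (z - s) s).
Proof. by apply: eq_Rintegral => s _; congr (N (u _ _)); ring. Qed.

Lemma char_deriv_ac (z T : R) : ac_on 0 T (fun t => char_deriv (z + -1 * t) t)
  (fun t => - N (u (z + -1 * t) t)).
Proof.
have h := ac_onD (ac_on_cst 0 T (al z)) (ac_onZ (-1) (ac_on_primitive (integrable_continuous 0 T (cNs z)))).
apply: eq_ac_on h => t _.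
  have zt : z + -1 * t + t = z by ring.
  by rewrite /char_deriv duhamel_along zt [in LHS]mulN1r.
by rewrite add0r !mulN1r.
Qed.

Lemma measurable_duhamel : measurable_fun [set: R * R] (fun z : R * R => duhamel z.1 z.2).
Proof.
pose h (w : (R * R) * R) := N (u (w.1.1 + w.1.2 - w.2) w.2).
apply: (@measurable_parametric _ h).
apply: (measurableT_comp (continuous_plane_measurable cNu) (_ : measurable_fun setT
  (fun w : (R * R) * R => (w.1.1 + w.1.2 - w.2, w.2)))).
have m2 : measurable_fun [set: (R * R) * R] (fun w : (R * R) * R => w.2) by exact: measurable_snd.
apply/measurable_fun_pairP; split => //=; apply: measurable_funB => //.
apply: measurable_funD.
  by apply: (measurableT_comp measurable_fst); exact: measurable_fst.
by apply: (measurableT_comp measurable_snd); exact: measurable_fst.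
Qed.

Lemma measurable_char_deriv :
  measurable_fun [set: R * R] (fun z : R * R => char_deriv z.1 z.2).
Proof.
apply: measurable_funB; last exact: measurable_duhamel.
by apply: measurableT_comp => //; apply: measurable_funD; [exact: measurable_fst|exact: measurable_snd].
Qed.

Lemma duhamel_bound (K T : R) : exists2 C, 0 <= C &
  forall x t, `|x| <= K -> 0 <= t <= T -> `|duhamel x t| <= C.
Proof.
have [C C0 HC] := bounded_on_box T (`|K| + `|T|) cNu.
exists (C * `|T|); first by rewrite mulr_ge0.
move=> x t xK /andP[t0 tT]; apply: (@le_trans _ _ (C * (t - 0))).
  have cns : continuous (fun s => N (u (x + t - s) s)) by exact: (cNs (x + t)).
  apply: Rintegral_itv_bound => //; first exact: integrable_continuous.
  move=> s s0 st; apply: HC; last by rewrite s0 (le_trans st).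
  have h : `|t - s| <= `|T| by rewrite !ger0_norm ?subr_ge0//; lra.
  apply: (@le_trans _ _ (`|x| + `|t - s|)).
    by rewrite -[leLHS]/(`|x + t - s|) -addrA ler_normD.
  by rewrite lerD// (le_trans xK)// ler_norm.
by apply: ler_wpM2l => //; rewrite subr0 (le_trans tT)// ler_norm.
Qed.

Let al2 : measurable_fun [set: R] (fun x => al x ^+ 2). Proof. exact: measurable_funX. Qed.

Let sqr_le (x y : R) : (x - y) ^+ 2 <= 2 * x ^+ 2 + 2 * y ^+ 2.
Proof. by have := sqr_ge0 (x + y); rewrite sqrrD sqrrB; lra. Qed.

Lemma integrable_char_deriv_box (K T : R) :
  mu2.-integrable (box K T) (fun z => (char_deriv z.1 z.2 ^+ 2)%:E).
Proof.
have [C C0 HC] := duhamel_bound K T.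
have mB : measurable (box K T) by apply: measurableX; exact: measurable_itv.
have msum : measurable_fun [set: R * R] (fun z : R * R => z.1 + z.2).
  by apply: measurable_funD; [exact: measurable_fst|exact: measurable_snd].
have fin (s t : R) : (mu `[s, t]%classic < +oo)%E.
  exact: compact_finite_measure (@segment_compact R s t).
have i1 : mu2.-integrable (box K T) (EFin \o (fun z : R * R => al (z.1 + z.2) ^+ 2)).
  apply: (integrableS (measurable_slab T)) => //; first by move=> [x t] [].
  have mal2 : measurable_fun [set: R * R] (fun z : R * R => (al (z.1 + z.2) ^+ 2)%:E).
    by apply/measurable_EFinP; exact: (measurableT_comp al2 msum).
  apply/integrableP; split; first exact: measurable_funTS.
  under eq_integral => z _ do rewrite /= ger0_norm ?sqr_ge0//.
  rewrite (ge0_integral_slab T mal2); last by move=> z; rewrite lee_fin sqr_ge0.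
  rewrite (eq_integral (fun=> \int[mu]_x (al x ^+ 2)%:E)%E); last first.
    move=> t _ /=; apply: (@ge0_integral_shift _ t (fun x => (al x ^+ 2)%:E)).
      exact/measurable_EFinP.
    by move=> x; rewrite lee_fin sqr_ge0.
  rewrite integral_cst//; apply: lte_mul_pinfty.
  - by apply: integral_ge0 => x _; rewrite lee_fin sqr_ge0.
  - by apply: integrable_fin_num.
  - exact: fin.
have i2 : mu2.-integrable (box K T) (EFin \o (fun=> 2 * C ^+ 2)).
  apply: measurable_bounded_integrable => //.
    rewrite [X in (X < _)%E]product_measure1E//; apply: lte_mul_pinfty; [by []| |exact: fin].
    by rewrite ge0_fin_numE//; exact: fin.
  by exists `|2 * C ^+ 2|; split => // y y1 z _ /=; rewrite ltW.
apply: (@integrable_EFin_le _ _ _ mu2 (box K T) mB _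
  (fun z : R * R => 2 * al (z.1 + z.2) ^+ 2 + 2 * C ^+ 2)).
- by apply: measurable_funTS; apply: measurable_funX; exact: measurable_char_deriv.
- move=> [x t] [/= xK tT]; rewrite ger0_norm ?sqr_ge0//.
  rewrite (le_trans (sqr_le _ _))// lerD2l ler_pM2l//.
  rewrite -[leLHS]real_normK ?num_real// ler_sqr ?nnegrE//; apply: HC => //.
  by move: xK; rewrite in_itv/= -ler_norml.
- by apply: integrable_EFinD => //; exact: integrable_EFinZ.
Qed.

Lemma integrable_char_deriv_slice (K t : R) : 0 <= t ->
  mu.-integrable `[- K, K] (fun x => (char_deriv x t ^+ 2)%:E).
Proof.
move=> t0; have [C C0 HC] := duhamel_bound K t.
have i1 : mu.-integrable `[- K, K] (EFin \o (fun x => al (x + t) ^+ 2)).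
  apply: (@integrableS _ _ _ mu setT) => //.
  have := @integrable_affine _ 1 t _ (oner_neq0 R) ial.
  by apply: eq_integrable => // x _; rewrite mul1r.
have i2 : mu.-integrable `[- K, K] (EFin \o (fun=> 2 * C ^+ 2)).
  by apply: integrable_continuous => x; exact: cvg_cst.
apply: (@integrable_EFin_le _ _ _ mu _ _ _ (fun x => 2 * al (x + t) ^+ 2 + 2 * C ^+ 2)).
- exact: measurable_itv.
- apply: measurable_funTS; apply: measurable_funX.
  exact: (measurable_slice t measurable_char_deriv).
- move=> x /= xK; rewrite ger0_norm ?sqr_ge0//.
  rewrite (le_trans (sqr_le _ _))// lerD2l ler_pM2l//.
  rewrite -[leLHS]real_normK ?num_real// ler_sqr ?nnegrE//; apply: HC.
    by move: xK; rewrite in_itv/= -ler_norml.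
  by rewrite t0 lexx.
- by apply: integrable_EFinD => //; exact: integrable_EFinZ.
Qed.

Lemma integrable_al (l r : R) : mu.-integrable `[l, r] (EFin \o al).
Proof.
have i2 : mu.-integrable `[l, r] (EFin \o (fun=> 1)).
  by apply: integrable_continuous => x; exact: cvg_cst.
have i1 : mu.-integrable `[l, r] (EFin \o (fun x => al x ^+ 2)).
  exact: (@integrableS _ _ _ mu setT).
apply: (@integrable_EFin_le _ _ _ mu _ _ _ (fun x => al x ^+ 2 + 1)).
- exact: measurable_itv.
- exact: measurable_funTS.
- move=> x _; have := sqr_ge0 (`|al x| - 1).
  rewrite sqrrB1 real_normK ?num_real// -mulr_natr; have := normr_ge0 (al x); lra.
- exact: integrable_EFinD.
Qed.

Lemma integrable_duhamel_line (z t : R) : 0 <= t ->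
  mu.-integrable `[0, t] (EFin \o (fun r => duhamel (z + 1 * r) r)).
Proof.
move=> t0; have [C C0 HC] := duhamel_bound (`|z| + `|t|) t.
apply: measurable_bounded_integrable.
- exact: measurable_itv.
- exact: compact_finite_measure (@segment_compact R 0 t).
- apply: measurable_funTS; apply: (measurableT_comp measurable_duhamel (_ : measurable_fun setT
    (fun r : R => (z + 1 * r, r)))).
  apply/measurable_fun_pairP; split; last exact: measurable_id.
  by apply: measurable_funD => //; exact: measurable_funM.
- exists C; split; [exact: num_real|move=> M CM r /=; rewrite in_itv/= => /andP[r0 rt]].
  apply: ltW; apply: le_lt_trans CM; apply: HC; last by rewrite r0 rt.
  by rewrite mul1r (le_trans (ler_normD _ _))// lerD2l !ger0_norm.
Qed.

Lemma integrable_al_line (z t : R) : mu.-integrable `[0, t] (EFin \o (fun s => al (2 * s + z))).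
Proof.
have two0 : 0 < 2 :> R by [].
exact: (@integrable_affine_itv _ 2 z 0 t al two0 (integrable_al _ _)).
Qed.

Lemma integrable_char_deriv_line (z t : R) : 0 <= t ->
  mu.-integrable `[0, t] (EFin \o (fun s => char_deriv (z + 1 * s) s)).
Proof.
move=> t0; have e r : 2 * r + z = z + 1 * r + r by ring.
have i1 := integrable_al_line z t; have i2 := integrable_duhamel_line z t0.
have := integrable_EFinB _ i1 i2; move=> /(_ (measurable_itv _)).
by apply: eq_integrable => // s _; rewrite /= /char_deriv e.
Qed.

(** Substituting [y = 2 r + (z - s)] in the inner integral of d'Alembert's
    formula turns the backward triangle into [0 <= s <= r <= t], where the
    order of integration can be exchanged. *)
Lemma char_deriv_line (z t : R) : 0 <= t ->
  u (z + t) t - u z 0 = \int[mu]_(s in `[0, t]) char_deriv (z + 1 * s) s.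
Proof.
have two0 : 0 < 2 :> R by [].
move=> t0; rewrite (dal z t0).
have ial2 := integrable_al_line z t.
have -> : 2^-1 * \int[mu]_(x in `[z, z + 2 * t]) al x = \int[mu]_(s in `[0, t]) al (2 * s + z).
  have := @Rintegral_affine_itv _ 2 z 0 t al two0 (integrable_al _ _).
  rewrite mulr0 add0r addrC => <-; rewrite RintegralZl// mulrA mulVf ?mul1r//.
pose h (r s : R) := 2 * N (u (2 * r + (z - s)) s).
have ch : continuous (fun w : R * R => h w.1 w.2).
  move=> w; apply: cvgM; first exact: cvg_cst.
  apply: (@continuous2_cvg _ _ _ _ _ _ (fun w : R * R => 2 * w.1 + (z - w.2)) snd
    (fun x t => N (u x t)) (2 * w.1 + (z - w.2)) w.2).
  - exact: (cNu (2 * w.1 + (z - w.2), w.2)).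
  - apply: cvgD; first by apply: cvgM; [exact: cvg_cst|exact: cvg_fst].
    by apply: cvgB; [exact: cvg_cst|exact: cvg_snd].
  - exact: cvg_snd.
have inner s : s \in `[0, t] -> \int[mu]_(y in `[z + s, z + 2 * t - s]) N (u y s) =
    \int[mu]_(r in `[s, t]) h r s.
  move=> _; have cN' : continuous (fun y => N (u y s)).
    by apply: (@cNu_along id (fun=> s)) => y; [exact: cvg_id|exact: cvg_cst].
  have e1 : 2 * s + (z - s) = z + s by ring.
  have e2 : 2 * t + (z - s) = z + 2 * t - s by ring.
  have E := @Rintegral_affine_itv _ 2 (z - s) s t (fun y => N (u y s)) two0
    (integrable_continuous _ _ cN').
  by rewrite e1 e2 in E; rewrite -E.
have -> : \int[mu]_(s in `[0, t]) \int[mu]_(y in `[z + s, z + 2 * t - s]) N (u y s) =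
    \int[mu]_(s in `[0, t]) \int[mu]_(r in `[s, t]) h r s.
  by apply: eq_Rintegral => s; rewrite inE; exact: inner.
rewrite -(triangle_fubini ch t0).
have duE r : r \in `[0, t] -> \int[mu]_(s in `[0, r]) h r s = 2 * duhamel (z + 1 * r) r.
  move=> _; rewrite /duhamel -RintegralZl//; last first.
    exact: integrable_continuous (cNs (z + 1 * r + r)).
  have e s : 2 * r + (z - s) = z + 1 * r + r - s by ring.
  by apply: eq_Rintegral => s _; rewrite /h e.
have idu := integrable_duhamel_line z t0.
have -> : \int[mu]_(r in `[0, t]) \int[mu]_(s in `[0, r]) h r s =
    2 * \int[mu]_(r in `[0, t]) duhamel (z + 1 * r) r.
  rewrite -RintegralZl//; apply: eq_Rintegral => r; rewrite inE; exact: duE.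
rewrite mulrA mulVf ?mul1r// -RintegralB//; apply: eq_Rintegral => s _.
have e r : 2 * r + z = z + 1 * r + r by ring.
by rewrite /char_deriv e.
Qed.

Lemma char_deriv_ac_u (z T : R) : 0 <= T -> ac_on 0 T (fun t => u (z + 1 * t) t)
  (fun t => char_deriv (z + 1 * t) t).
Proof.
move=> T0; have i1 : mu.-integrable `[0, T] (EFin \o (fun t => char_deriv (z + 1 * t) t)).
  exact: integrable_char_deriv_line.
split => // s t s0 st tT; have t0 := le_trans s0 st.
have E r : 0 <= r -> u (z + 1 * r) r = u z 0 + \int[mu]_(s in `[0, r]) char_deriv (z + 1 * s) s.
  by move=> r0; rewrite -(char_deriv_line z r0) mul1r [RHS]addrC subrK.
rewrite !E// (Rintegral_itv_cat s0 st); last exact: integrable_sub_itv i1.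
by rewrite opprD addrACA subrr add0r addrAC subrr add0r.
Qed.

End characteristic_derivative.

Section half_solutions.
Context {R : realType}.
Notation mu := (@lebesgue_measure R).
Notation mu2 := (mu \x mu)%E.
Variable p : R.
Hypothesis p1 : 1 < p.
Notation N := (nonlinearity p).
Notation F := (potential p).

(** What is used of a solution, for nonnegative times: formulated in this way,
    it applies both to a solution and to its time reversal. The velocity at
    time 0 replaces the datum [u1]. *)
Record half_solution (u ux ut : R -> R -> R) : Prop := HalfSolution {
  hs_cont : continuous (fun z : R * R => u z.1 z.2);
  hs_ux : forall t, 0 <= t -> weak_derivative (u^~ t) (ux^~ t);
  hs_ut : forall phi : R -> R, test_function phi -> forall t : R, 0 <= t ->
    is_derive t (1 : R) (fun s : R => \int[mu]_x (u x s * phi x))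
      (\int[mu]_x (ut x t * phi x));
  hs_ux2 : forall t, 0 <= t -> ux^~ t \in Lfun mu 2%:E;
  hs_ut2 : forall t, 0 <= t -> ut^~ t \in Lfun mu 2%:E;
  hs_F0 : mu.-integrable setT (fun x => (F (u x 0))%:E);
  hs_dal : forall x t, 0 <= t -> u x t =
    2^-1 * (u (x - t) 0 + u (x + t) 0 + \int[mu]_(y in `[x - t, x + t]) ut y 0) -
    2^-1 * \int[mu]_(s in `[0, t]) \int[mu]_(y in `[x - t + s, x + t - s]) N (u y s)
}.

Lemma Rintegral_reflect_itv (f : R -> R) l r : mu.-integrable `[- r, - l] (EFin \o f) ->
  \int[mu]_(x in `[l, r]) f (- x) = \int[mu]_(x in `[- r, - l]) f x.
Proof.
have k0 : -1 != 0 :> R by rewrite oppr_eq0 oner_eq0.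
move=> /integrable_mkcond => /(_ (measurable_itv _)) h.
rewrite /Rintegral [in RHS]integral_mkcond (integral_affine 0 k0 h) normrN1 mul1e.
rewrite [in LHS]integral_mkcond; congr fine; apply: eq_integral => x _.
rewrite !patchE addr0 mulN1r; congr (if _ then _ else _).
by rewrite !mem_setE !in_itv/= !lerN2 andbC.
Qed.

Lemma integrable_sqr_sum (f g : R -> R) k : mu.-integrable setT (fun x => (f x ^+ 2)%:E) ->
  mu.-integrable setT (fun x => (g x ^+ 2)%:E) -> measurable_fun setT f -> measurable_fun setT g ->
  `|k| = 1 -> mu.-integrable setT (fun x => ((f x + k * g x) ^+ 2)%:E).
Proof.
move=> f2 g2 mf mg k1.
have i := integrable_EFinD measurableT (integrable_EFinZ measurableT 2 f2)
  (integrable_EFinZ measurableT 2 g2).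
apply: (@integrable_EFin_le _ _ _ mu setT measurableT _ _ _ _ i).
  by apply: measurable_funX; apply: measurable_funD => //; exact: measurable_funM.
move=> x _; rewrite ger0_norm ?sqr_ge0//.
have kk : (k * g x) ^+ 2 = g x ^+ 2 by rewrite exprMn -(real_normK (num_real k)) k1 expr1n mul1r.
rewrite -kk; have := sqr_ge0 (f x - k * g x); rewrite sqrrB sqrrD; lra.
Qed.

Variables u ux ut : R -> R -> R.
Hypothesis hs : half_solution u ux ut.

Let refl (f : R -> R -> R) x t := f (- x) t.
Let al x := ut x 0 + 1 * ux x 0.
Let al' x := ut (- x) 0 + -1 * ux (- x) 0.

Let cu : continuous (fun z : R * R => u z.1 z.2). Proof. exact: hs_cont hs. Qed.

Let cu' : continuous (fun z : R * R => refl u z.1 z.2).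
Proof.
move=> z; apply: (@continuous2_cvg _ _ _ _ _ _ (fun z => - z.1) snd u (- z.1) z.2).
- by have h := hs_cont hs; exact: (h (- z.1, z.2)).
- by apply: cvgN; exact: cvg_fst.
- exact: cvg_snd.
Qed.

Let L2 f : f \in Lfun mu 2%:E -> measurable_fun setT f /\ mu.-integrable setT (fun x => (f x ^+ 2)%:E).
Proof.
move=> f2; split; last exact: Lfun2_integrable_sqr f2.
by move: f2; rewrite !inE => /andP[/[!inE]].
Qed.

Let mt : measurable_fun setT (ut^~ 0). Proof. by case: (L2 (hs_ut2 hs (lexx 0))). Qed.
Let mx : measurable_fun setT (ux^~ 0). Proof. by case: (L2 (hs_ux2 hs (lexx 0))). Qed.
Let it : mu.-integrable setT (fun x => (ut x 0 ^+ 2)%:E).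
Proof. by case: (L2 (hs_ut2 hs (lexx 0))). Qed.
Let ix : mu.-integrable setT (fun x => (ux x 0 ^+ 2)%:E).
Proof. by case: (L2 (hs_ux2 hs (lexx 0))). Qed.

Let mal : measurable_fun [set: R] al.
Proof. by apply: measurable_funD => //; exact: measurable_funM. Qed.

Let ial : mu.-integrable setT (fun x => (al x ^+ 2)%:E).
Proof. by apply: integrable_sqr_sum => //; rewrite normr1. Qed.

Let mal' : measurable_fun [set: R] al'.
Proof.
have mo : measurable_fun [set: R] (fun x : R => - x) by exact: measurable_funN.
apply: measurable_funD; first exact: (measurableT_comp mt mo).
by apply: measurable_funM => //; exact: (measurableT_comp mx mo).
Qed.

Let ial' : mu.-integrable setT (fun x => (al' x ^+ 2)%:E).
Proof.
have := @integrable_reflect _ (fun x => (ut x 0 + -1 * ux x 0) ^+ 2).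
by apply; apply: integrable_sqr_sum => //; rewrite normrN1.
Qed.

Let iloc (f : R -> R) l r : measurable_fun setT f -> mu.-integrable setT (fun x => (f x ^+ 2)%:E) ->
  mu.-integrable `[l, r] (EFin \o f).
Proof. by move=> mf f2; exact: integrable_al. Qed.

Let dx l r : l <= r -> u r 0 - u l 0 = \int[mu]_(x in `[l, r]) ux x 0.
Proof.
move=> lr; have w := hs_ux hs (lexx 0).
apply: (weak_derivative_primitive _ w lr).
move=> x; apply: (@continuous2_cvg _ _ _ _ _ _ id (cst 0) u x 0).
- by have h := hs_cont hs; exact: (h (x, 0)).
- exact: cvg_id.
- exact: cvg_cst.
Qed.

Let alg1 (x y i j : R) : 2^-1 * (x + y + i) - 2^-1 * j - x = 2^-1 * (i + (y - x)) - 2^-1 * j.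
Proof. by field. Qed.

Let alg2 (x y i j : R) : 2^-1 * (y + x + i) - 2^-1 * j - x = 2^-1 * (i - (x - y)) - 2^-1 * j.
Proof. by field. Qed.

Let dal (z t : R) : 0 <= t -> u (z + t) t - u z 0 =
  2^-1 * \int[mu]_(x in `[z, z + 2 * t]) al x -
  2^-1 * \int[mu]_(s in `[0, t]) \int[mu]_(y in `[z + s, z + 2 * t - s]) N (u y s).
Proof.
move=> t0; have e1 : z + t - t = z by ring.
have e2 : z + t + t = z + 2 * t by ring.
rewrite (hs_dal hs (z + t) t0) e1 e2.
have zt : z <= z + 2 * t by lra.
have it' : mu.-integrable `[z, z + 2 * t] (EFin \o ut^~ 0) by exact: iloc.
have ix' : mu.-integrable `[z, z + 2 * t] (EFin \o ux^~ 0) by exact: iloc.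
have -> : \int[mu]_(x in `[z, z + 2 * t]) al x =
    \int[mu]_(x in `[z, z + 2 * t]) ut x 0 + (u (z + 2 * t) 0 - u z 0).
  rewrite dx// -RintegralD//; apply: eq_Rintegral => x _; by rewrite /al mul1r.
exact: alg1.
Qed.

Let dal' (z t : R) : 0 <= t -> refl u (z + t) t - refl u z 0 =
  2^-1 * \int[mu]_(x in `[z, z + 2 * t]) al' x -
  2^-1 * \int[mu]_(s in `[0, t]) \int[mu]_(y in `[z + s, z + 2 * t - s]) N (refl u y s).
Proof.
move=> t0; have e1 : - (z + t) - t = - (z + 2 * t) by ring.
have e2 : - (z + t) + t = - z by ring.
rewrite /refl (hs_dal hs (- (z + t)) t0) e1 e2.
have zt : - (z + 2 * t) <= - z by lra.
have it' : mu.-integrable `[- (z + 2 * t), - z] (EFin \o ut^~ 0) by exact: iloc.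
have ix' : mu.-integrable `[- (z + 2 * t), - z] (EFin \o ux^~ 0) by exact: iloc.
have -> : \int[mu]_(x in `[z, z + 2 * t]) al' x =
    \int[mu]_(x in `[- (z + 2 * t), - z]) ut x 0 - (u (- z) 0 - u (- (z + 2 * t)) 0).
  rewrite dx// -RintegralB//.
  rewrite -(@Rintegral_reflect_itv (fun x => ut x 0 - ux x 0)); last exact: integrable_EFinB.
  by apply: eq_Rintegral => x _; rewrite /al' mulN1r.
have -> : \int[mu]_(s in `[0, t]) \int[mu]_(y in `[z + s, z + 2 * t - s]) N (u (- y) s) =
    \int[mu]_(s in `[0, t]) \int[mu]_(y in `[- (z + 2 * t) + s, - z - s]) N (u y s).
  apply: eq_Rintegral => s _.
  have e3 : - (z + 2 * t) + s = - (z + 2 * t - s) by ring.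
  have e4 : - z - s = - (z + s) by ring.
  rewrite e3 e4 (@Rintegral_reflect_itv (fun y => N (u y s)))//.
  apply: integrable_continuous => y; apply: continuous_comp; last exact: continuous_nonlinearity.
  apply: (@continuous2_cvg _ _ _ _ _ _ id (cst s) u y s).
  - by have h := hs_cont hs; exact: (h (y, s)).
  - exact: cvg_id.
  - exact: cvg_cst.
exact: alg2.
Qed.

Definition right_deriv := char_deriv p u al.
(** The derivative [u_t - u_x] is obtained from the reflected solution. *)
Definition left_deriv x t := char_deriv p (refl u) al' (- x) t.

Lemma char_solution_of_half : char_solution p u right_deriv left_deriv.
Proof.
have duh0 v x : duhamel p v x 0 = 0.
  by rewrite /duhamel set_itv1 Rintegral_set1.
have m := measurable_char_deriv p1 cu mal.
have m' := measurable_char_deriv p1 cu' mal'.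
split.
- exact: cu.
- exact: m.
- exact: measurable_reflect m'.
- by move=> K T; have h := integrable_char_deriv_box p1 cu mal ial K T; exact: h.
- move=> K T; have := integrable_char_deriv_box p1 cu' mal' ial' K T.
  exact: (@integrable_box_reflect _ (fun x t => char_deriv p (refl u) al' x t ^+ 2)).
- by move=> K t t0; have h := integrable_char_deriv_slice p1 cu mal ial K t0; exact: h.
- move=> K t t0; have := integrable_char_deriv_slice p1 cu' mal' ial' K t0.
  exact: (@integrable_slice_reflect _ (fun x => char_deriv p (refl u) al' x t ^+ 2)).
- by move=> z T T0; have h := char_deriv_ac p1 al cu z T; exact: h.
- move=> z T T0; have := char_deriv_ac p1 al' cu' (- z) T.
  by apply: eq_ac_on => t _; rewrite /left_deriv /refl mulN1r mul1r ?opprD ?opprK.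
- by move=> z T T0; have h := char_deriv_ac_u p1 cu mal ial dal z T0; exact: h.
- move=> z T T0; have := char_deriv_ac_u p1 cu' mal' ial' dal' (- z) T0.
  by apply: eq_ac_on => t _; rewrite /left_deriv /refl mulN1r mul1r opprD opprK.
- apply: eq_integrable ial => // x _.
  by rewrite /right_deriv /char_deriv duh0 subr0 addr0.
- apply: eq_integrable (@integrable_reflect _ (fun x => al' x ^+ 2) ial') => // x _.
  by rewrite /= /left_deriv /char_deriv duh0 subr0 addr0.
- exact: hs_F0 hs.
Qed.

End half_solutions.

(** * Identification of the characteristic derivatives *)

Section difference_quotients.
Context {R : realType}.
Notation mu := (@lebesgue_measure R).
Implicit Types (x t k K : R).

Lemma is_derive_harmonic (g : R -> R) t (d : R) : is_derive t (1 : R) g d ->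
  (g (t + n.+1%:R^-1) - g t) / n.+1%:R^-1 @[n --> \oo] --> d.
Proof.
move=> [dg <-].
have h0 : (n.+1%:R^-1 : R) @[n --> \oo] --> (0 : R)^'.
  move=> A /= hA; have h := @cvg_harmonic R _ hA.
  apply: (@filterS _ \oo _ _ _ _ h) => n /=; apply; by rewrite gt_eqF// invr_gt0.
have := cvg_comp _ _ h0 dg; apply: cvg_trans; apply: near_eq_cvg; near=> n.
by rewrite /= /GRing.scale/= mulr1 [X in g X]addrC mulrC.
Unshelve. all: by end_near. Qed.

(** What is used of a test function, in a form stable under reflection. *)
Record test_profile (phi phi' : R -> R) K : Prop := TestProfile {
  tp_derive : forall x, is_derive x (1 : R) phi (phi' x);
  tp_cont : continuous phi';
  tp_supp : forall x, K < `|x| -> phi x = 0;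
  tp_supp' : forall x, K < `|x| -> phi' x = 0
}.

Lemma test_profile_of_test_function phi : test_function phi ->
  exists2 K, 0 <= K & test_profile phi (phi^`())%classic K.
Proof.
move=> [smooth /compact_bounded[M [_ HM]]].
have supp x : `|M| + 1 < `|x| -> phi x = 0.
  move=> Mx; apply/eqP; apply: contraTT Mx => px; rewrite -leNgt.
  by apply: HM; [rewrite (le_lt_trans (ler_norm M))// ltrDl|exact: subset_closure].
exists (`|M| + 1); first by rewrite addr_ge0.
split => //.
- move=> x; have := smooth 0%N x => /derivableP.
  by rewrite derive1E.
- move=> x; apply: differentiable_continuous; apply/derivable1_diffP.
  exact: (smooth 1%N x).
- move=> x Mx; rewrite derive1E; have <- : 'D_1 (cst (0 : R)) x = 0 by rewrite derive_val.
  apply: near_eq_derive.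
  have : \forall y \near x, `|M| + 1 < `|y|.
    have h : id y @[y --> x] --> x by exact: cvg_id.
    by apply: (cvgr_norm_gt _ h).
  by apply: filterS => y /supp ->.
Qed.

Lemma test_profile_reflect phi phi' K : test_profile phi phi' K ->
  test_profile (fun x => phi (- x)) (fun x => - phi' (- x)) K.
Proof.
move=> [d c s s']; split.
- move=> x; have dx : is_derive x (1 : R) (fun y : R => - y) (- 1) by exact: is_deriveNid.
  have := is_derive1_comp (f := phi) (g := fun y => - y) (d (- x)) dx.
  by move/is_derive_eq; apply; rewrite mulrN1.
- move=> x; apply: cvgN; apply: (@continuous_comp _ _ _ (fun y : R => - y) phi' x).
    by apply: cvgN; exact: cvg_id.
  exact: c.
- by move=> x Kx; rewrite s// normrN.
- by move=> x Kx; rewrite s' ?normrN// oppr0.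
Qed.

Section profile.
Variables (phi phi' : R -> R) (K : R).
Hypothesis tp : test_profile phi phi' K.

Lemma profile_continuous : continuous phi.
Proof.
move=> x; apply: differentiable_continuous; apply/derivable1_diffP.
by case: (tp_derive tp x).
Qed.

Lemma profile_lipschitz : exists2 L, 0 <= L & forall x y, `|phi y - phi x| <= L * `|y - x| /\ `|phi' x| <= L.
Proof.
have [C C0 HC] : exists2 C, 0 <= C & forall x, `|phi' x| <= C.
  have /compact_bounded[M [_ HM]] : compact [set phi' x | x in `[(- K)%R, K]].
    apply: continuous_compact; last exact: segment_compact.
    by apply: continuous_subspaceT; exact: tp_cont tp.
  exists (`|M| + 1); first by rewrite addr_ge0.
  move=> x; have [xK|xK] := leP `|x| K; last by rewrite (tp_supp' tp xK) normr0 addr_ge0.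
  apply: HM; first by rewrite (le_lt_trans (ler_norm M))// ltrDl.
  by exists x => //=; rewrite in_itv/= -ler_norml.
exists C => // x y; split => //; wlog xy : x y / x <= y.
  move=> H; case: (leP x y) => [|/ltW] yx; first exact: H.
  by rewrite distrC [`|y - x|]distrC; exact: H.
have cphi : {within `[x, y], continuous phi}.
  by apply: continuous_subspaceT; exact: profile_continuous.
have [c _ ->] := @MVT_segment R phi phi' x y xy (fun z _ => tp_derive tp z) cphi.
by rewrite normrM ler_wpM2r.
Qed.

(** Dominated convergence: the difference quotients of [phi] are bounded by a
    Lipschitz constant and supported in a fixed compact set. *)
Lemma diff_quotient_cvg (v : nat -> R -> R) (v0 : R -> R) k M :
  (forall n, measurable_fun setT (v n)) ->
  (forall n x, `|x| <= K + `|k| -> `|v n x| <= M) ->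
  (forall x, `|x| <= K + `|k| -> v n x @[n --> \oo] --> v0 x) ->
  measurable_fun setT v0 -> (forall x, `|x| <= K + `|k| -> `|v0 x| <= M) ->
  \int[mu]_x (v n x * ((phi (x - k * n.+1%:R^-1) - phi x) / n.+1%:R^-1)) @[n --> \oo] -->
  \int[mu]_x (v0 x * - (k * phi' x)).
Proof.
move=> mv vM vc mv0 v0M; have [L L0 HL] := profile_lipschitz.
set B := K + `|k| in vM vc v0M *.
pose dq n x := (phi (x - k * n.+1%:R^-1) - phi x) / n.+1%:R^-1.
have hn0 n : 0 < n.+1%:R^-1 :> R by rewrite invr_gt0.
have hn1 n : n.+1%:R^-1 <= 1 :> R by rewrite invf_le1// ler1n.
have dqL n x : `|dq n x| <= L * `|k|.
  have -> : `|dq n x| = `|phi (x - k * n.+1%:R^-1) - phi x| / n.+1%:R^-1.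
    by rewrite /dq normrM [X in _ * X = _]ger0_norm// invr_ge0 ltW.
  rewrite ler_pdivrMr//; apply: (le_trans (HL _ _).1); rewrite addrAC subrr add0r normrN normrM [`|_^-1|]ger0_norm ?(ltW (hn0 n))//.
  by rewrite mulrA.
have dq0 n x : B < `|x| -> dq n x = 0.
  move=> Bx; rewrite /dq !(tp_supp tp) ?subrr ?mul0r//.
    by apply: le_lt_trans Bx; rewrite lerDl.
  have := ler_normB x (k * n.+1%:R^-1).
  have : `|k * n.+1%:R^-1| <= `|k|.
    by rewrite normrM [`|_^-1|]ger0_norm ?(ltW (hn0 n))// ler_piMr.
  have := lerB_normD x (- (k * n.+1%:R^-1)); rewrite normrN; move: Bx; rewrite /B; lra.
have phi'0 x : B < `|x| -> phi' x = 0.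
  by move=> Bx; apply: (tp_supp' tp); apply: le_lt_trans Bx; rewrite lerDl.
have dqc x : dq n x @[n --> \oo] --> - (k * phi' x).
  have da : is_derive (0 : R) (1 : R) (fun s => x - k * s) (- k).
    have := is_deriveB (is_derive_cst x (0 : R) (1 : R)) (is_deriveZ k (is_derive_id (0 : R) (1 : R))).
    by move/is_derive_eq; apply; rewrite sub0r; congr (- _); exact: mulr1.
  have dx : is_derive (x - k * 0) (1 : R) phi (phi' x).
    by rewrite mulr0 subr0; exact: tp_derive tp x.
  have := is_derive_harmonic (is_derive1_comp (f := phi) (g := fun s => x - k * s) dx da).
  rewrite (_ : - (k * phi' x) = phi' x * - k); last by ring.
  apply: cvg_trans; apply: near_eq_cvg; near=> n.
  by rewrite /dq /= add0r mulr0 subr0.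
have mdq n : measurable_fun setT (dq n).
  have cm := continuous_measurable_fun profile_continuous.
  apply: measurable_funM => //; apply: measurable_funB => //.
  by apply: (measurableT_comp cm); exact: measurable_funB.
pose G : R -> \bar R := (EFin \o cst (M * (L * `|k|))) \_ `[(- B)%R, B].
have iG : mu.-integrable setT G.
  have := integrable_continuous (- B) B (@cst_continuous _ _ (M * (L * `|k|))).
  by move=> /integrable_mkcond => /(_ (measurable_itv _)).
have bd n x : (`|(v n x * dq n x)%:E| <= G x)%E.
  rewrite /G patchE mem_setE in_itv/= -ler_norml; case: ifPn.
    by move=> xB; rewrite lee_fin normrM; apply: ler_pM => //; exact: vM.
  by rewrite -ltNge => xB; rewrite dq0// mulr0 normr0.
have cvx x : (v n x * dq n x)%:E @[n --> \oo] --> (v0 x * - (k * phi' x))%:E.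
  apply: cvg_EFin; first by near=> n.
  have [xB|xB] := leP `|x| B; first by apply: cvgM; [exact: vc|exact: dqc].
  by rewrite phi'0// !(mulr0, oppr0); apply: cvg_near_cst; near=> n; rewrite /= dq0// mulr0.
have mf n : measurable_fun setT (EFin \o (fun x => v n x * dq n x)).
  by apply/measurable_EFinP; exact: measurable_funM.
have fd x : setT x -> G x \is a fin_num.
  by move=> _; rewrite /G patchE; case: ifP.
have := @dominated_cvg _ _ _ mu setT measurableT (fun n x => (v n x * dq n x)%:E)
  (fun x => (v0 x * - (k * phi' x))%:E) G mf (fun x _ => cvx x) fd iG (fun n x _ => bd n x).
move=> h; apply: fine_cvg; rewrite (_ : (fine _)%:E = \int[mu]_x (v0 x * - (k * phi' x))%:E)%E//.
rewrite /Rintegral fineK//; apply: integrable_fin_num => //.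
apply: (le_integrable measurableT _ _ iG).
  apply/measurable_EFinP; apply: measurable_funM => //.
  apply: measurableT_comp => //; apply: measurable_funM => //.
  by apply: continuous_measurable_fun; exact: tp_cont tp.
move=> x _; apply: le_trans (lee_abs _).
rewrite /G patchE mem_setE in_itv/= -ler_norml; case: ifPn.
  move=> xB; rewrite lee_fin normrM normrN normrM mulrC [L * _]mulrC mulrC; apply: ler_pM => //.
    exact: v0M.
  by apply: ler_wpM2l => //; exact: (HL x x).2.
by rewrite -ltNge => xB; rewrite phi'0// !(mulr0, oppr0) normr0.
Unshelve. all: by end_near. Qed.

End profile.
End difference_quotients.

Section slices.
Context {R : realType}.
Notation mu := (@lebesgue_measure R).
Implicit Types (x t k K : R).

Lemma integrable_of_sqr (f : R -> R) l r : measurable_fun setT f ->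
  mu.-integrable `[l, r] (fun x => (f x ^+ 2)%:E) -> mu.-integrable `[l, r] (EFin \o f).
Proof.
move=> mf f2; have i1 := integrable_continuous l r (@cst_continuous _ _ (1 : R)).
apply: (integrable_EFin_le _ _ _ (integrable_EFinD _ i1 f2)) => //.
  exact: measurable_funTS.
move=> x _; have := sqr_ge0 (`|f x| - 2^-1); rewrite sqrrB -normrX ger0_norm ?sqr_ge0//=.
have := normr_ge0 (f x); lra.
Qed.

Lemma locally_integrable_of_segments (f : R -> R) : measurable_fun setT f ->
  (forall K, mu.-integrable `[(- K)%R, K] (EFin \o f)) -> locally_integrable setT f.
Proof.
move=> mf fi; split => //; first exact: openT.
move=> A _ cA; have [M [_ HM]] := compact_bounded cA.
have AM : A `<=` `[- (`|M| + 1), `|M| + 1].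
  move=> x Ax; rewrite /= in_itv/= -ler_norml; apply: HM => //.
  by rewrite (le_lt_trans (ler_norm M))// ltrDl.
have mA : measurable A by exact: closed_measurable (compact_closed (@Rhausdorff R) cA).
have /integrableP[] // := @integrableS _ _ _ mu _ _ _ (measurable_itv _) mA AM (fi (`|M| + 1)).
Qed.

Lemma Rintegral_supported (f : R -> R) l r : (forall x, ~~ (l <= x <= r) -> f x = 0) ->
  \int[mu]_x f x = \int[mu]_(x in `[l, r]) f x.
Proof.
move=> f0; rewrite /Rintegral [in RHS]integral_mkcond; congr fine.
apply: eq_integral => x _; rewrite patchE mem_setE in_itv/=.
by case: ifPn => // /f0 ->.
Qed.

Lemma integrable_supported (f : R -> R) K M : measurable_fun setT f ->
  (forall x, K < `|x| -> f x = 0) -> (forall x, `|x| <= K -> `|f x| <= M) ->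
  mu.-integrable setT (EFin \o f).
Proof.
move=> mf f0 fM; have i1 := integrable_continuous (- K) K (@cst_continuous _ _ M).
have : mu.-integrable `[- K, K] (EFin \o f).
  apply: (integrable_EFin_le _ _ _ i1) => //; first exact: measurable_funTS.
  by move=> x; rewrite /= in_itv/= -ler_norml; exact: fM.
move=> /integrable_mkcond => /(_ (measurable_itv _)); apply: eq_integrable => // x _.
by rewrite patchE mem_setE in_itv/= -ler_norml; case: ifPn => //; rewrite -ltNge => /f0 /= ->.
Qed.

Lemma continuous_bounded_segment (f : R -> R) K : continuous f ->
  exists2 M, 0 <= M & forall x, `|x| <= K -> `|f x| <= M.
Proof.
move=> cf; have /compact_bounded[M [_ HM]] : compact [set f x | x in `[(- K)%R, K]].
  by apply: continuous_compact; [exact: continuous_subspaceT|exact: segment_compact].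
exists (`|M| + 1); first by rewrite addr_ge0.
move=> x xK; apply: HM; first by rewrite (le_lt_trans (ler_norm M))// ltrDl.
by exists x => //=; rewrite in_itv/= -ler_norml.
Qed.

Lemma integrable_mul_supported (f g : R -> R) K M : measurable_fun setT f -> continuous g ->
  (forall x, K < `|x| -> g x = 0) -> (forall x, `|x| <= K -> `|f x| <= M) ->
  mu.-integrable setT (EFin \o (fun x => f x * g x)).
Proof.
move=> mf cg g0 fM; have [L L0 HL] := continuous_bounded_segment K cg.
apply: (@integrable_supported _ K (M * L)).
- by apply: measurable_funM => //; exact: continuous_measurable_fun.
- by move=> x /g0 ->; rewrite mulr0.
- by move=> x xK; rewrite normrM; apply: ler_pM => //; [exact: fM|exact: HL].
Qed.

Lemma Rintegral_translate (f : R -> R) c : mu.-integrable setT (EFin \o f) ->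
  \int[mu]_x f (x + c) = \int[mu]_x f x.
Proof.
by move=> fi; rewrite /Rintegral -(integral_shift c fi).
Qed.

Lemma integrable_translate (f : R -> R) c : mu.-integrable setT (EFin \o f) ->
  mu.-integrable setT (EFin \o (fun x => f (x + c))).
Proof.
have k0 : 1 != 0 :> R by rewrite oner_eq0.
move=> /(integrable_affine c k0); apply: eq_integrable => // x _.
by rewrite /= mul1r.
Qed.

End slices.

Section identification.
Context {R : realType}.
Notation mu := (@lebesgue_measure R).
Implicit Types (x t k K : R).
Variable p : R.
Hypothesis p1 : 1 < p.
Notation N := (nonlinearity p).

Lemma continuous_slice (u : R -> R -> R) t : continuous (fun z : R * R => u z.1 z.2) ->
  continuous (u^~ t).
Proof.
move=> cu x; apply: (@continuous2_cvg _ _ _ _ _ _ id (cst t) u x t).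
- exact: (cu (x, t)).
- exact: cvg_id.
- exact: cvg_cst.
Qed.

(** Translating the moving frame onto [phi]: the increment of [int u (x + k h,
    t + h) phi (x)] differs from that of [int u (x, t + h) phi (x)] by the
    integral of [u (x, t + h)] against [phi (x - k h) - phi (x)]. *)
Lemma moving_frame_quotient (u : R -> R -> R) phi phi' K k t :
  continuous (fun z : R * R => u z.1 z.2) -> test_profile phi phi' K -> 0 <= K -> 0 <= t ->
  \int[mu]_x ((u (x + k * n.+1%:R^-1) (t + n.+1%:R^-1) - u x t) / n.+1%:R^-1 * phi x) -
  (\int[mu]_x (u x (t + n.+1%:R^-1) * phi x) - \int[mu]_x (u x t * phi x)) / n.+1%:R^-1
  @[n --> \oo] --> - (k * \int[mu]_x (u x t * phi' x)).
Proof.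
move=> cu tp K0 t0; pose h n : R := n.+1%:R^-1.
have h0 n : 0 < h n by rewrite invr_gt0.
have h1 n : h n <= 1 by rewrite invf_le1// ler1n.
have mu_ s : measurable_fun setT (u^~ s).
  by apply: continuous_measurable_fun; exact: continuous_slice.
have cphi := profile_continuous tp.
have mphi : measurable_fun setT phi by exact: continuous_measurable_fun.
have [M M0 HM] := bounded_on_box (t + 1) (K + `|k|) cu.
have iu s y : 0 <= s <= t + 1 -> `|y| <= `|k| ->
    mu.-integrable setT (EFin \o (fun x => u (x + y) s * phi x)).
  move=> s1 yk; apply: (@integrable_mul_supported _ (fun x => u (x + y) s) phi K M) => //.
  - by apply: (measurableT_comp (mu_ s)); exact: measurable_funD.
  - exact: tp_supp tp.
  - move=> x xK; apply: (HM _ s) => //; by rewrite (le_trans (ler_normD _ _))// lerD.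
have iu0 s : 0 <= s <= t + 1 -> mu.-integrable setT (EFin \o (fun x => u x s * phi x)).
  move=> s1; apply: eq_integrable (iu s 0 s1 _) => //; last by rewrite normr0.
  by move=> x _; rewrite /= addr0.
have htb n : 0 <= t + h n <= t + 1 by rewrite addr_ge0 ?(ltW (h0 n))// lerD2l h1.
have tb : 0 <= t <= t + 1 by rewrite t0/= lerDl.
have ii : mu.-integrable setT (EFin \o (fun x => u x t * phi' x)).
  apply: (@integrable_mul_supported _ (u^~ t) phi' K M) => //.
  - exact: tp_cont tp.
  - exact: tp_supp' tp.
  - by move=> x xK; apply: (HM x t) => //; rewrite (le_trans xK)// lerDl.
rewrite -mulNr -RintegralZl//.
rewrite (_ : \int[mu]_x (- k * (u x t * phi' x)) = \int[mu]_x (u x t * - (k * phi' x))); last first.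
  by apply: eq_Rintegral => x _; ring.
have hh := @diff_quotient_cvg _ phi phi' K tp (fun n => u^~ (t + h n)) (u^~ t) k M.
suff -> : (fun n : nat => \int[mu]_x ((u (x + k * n.+1%:R^-1) (t + n.+1%:R^-1) - u x t) / n.+1%:R^-1 * phi x) -
  (\int[mu]_x (u x (t + n.+1%:R^-1) * phi x) - \int[mu]_x (u x t * phi x)) / n.+1%:R^-1) =
  (fun n => \int[mu]_x (u x (t + h n) * ((phi (x - k * n.+1%:R^-1) - phi x) / n.+1%:R^-1))).
  apply: hh => //.
  - by move=> n x xK; exact: (HM x (t + h n)).
  - move=> x xK; apply: (@continuous2_cvg _ _ _ _ _ _ (cst x) (fun n => t + h n) u x t).
    + exact: (cu (x, t)).
    + exact: cvg_cst.
    + rewrite -[X in _ --> X]addr0; apply: cvgD; first exact: cvg_cst.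
      exact: cvg_harmonic.
  - by move=> x xK; exact: (HM x t).
apply/funext => n; rewrite -/(h n).
have kh : `|k * h n| <= `|k| by rewrite normrM [`|h n|]ger0_norm ?(ltW (h0 n))// ler_piMr.
have -> : \int[mu]_x ((u (x + k * h n) (t + h n) - u x t) / h n * phi x) =
   (h n)^-1 * (\int[mu]_x (u (x + k * h n) (t + h n) * phi x) - \int[mu]_x (u x t * phi x)).
  rewrite -RintegralB//; [|exact: iu|exact: iu0].
  rewrite -RintegralZl//; last by apply: integrable_EFinB => //; [exact: iu|exact: iu0].
  by apply: eq_Rintegral => x _; ring.
have tr : \int[mu]_x (u (x + k * h n) (t + h n) * phi x) =
    \int[mu]_x (u x (t + h n) * phi (x - k * h n)).
  rewrite -(Rintegral_translate (- (k * h n)) (iu (t + h n) (k * h n) (htb n) kh)).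
  by apply: eq_Rintegral => x _; rewrite subrK.
have it : mu.-integrable setT (EFin \o (fun x => u x (t + h n) * phi (x - k * h n))).
  apply: eq_integrable (integrable_translate (- (k * h n)) (iu (t + h n) (k * h n) (htb n) kh)) => //.
  by move=> x _; rewrite /= subrK.
have -> : \int[mu]_x (u x (t + h n) * ((phi (x - k * h n) - phi x) / h n)) =
  (h n)^-1 * (\int[mu]_x (u x (t + h n) * phi (x - k * h n)) - \int[mu]_x (u x (t + h n) * phi x)).
  rewrite -RintegralB//; last exact: iu0.
  rewrite -RintegralZl//; last by apply: integrable_EFinB => //; exact: iu0.
  by apply: eq_Rintegral => x _; ring.
rewrite tr; move: (\int[mu]_x _) (\int[mu]_x _) (\int[mu]_x _) => I1 I2 I3; ring.
Qed.

End identification.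

Section characteristic_quotient.
Context {R : realType}.
Notation mu := (@lebesgue_measure R).
Implicit Types (x t k K : R).
Variable p : R.
Hypothesis p1 : 1 < p.
Notation N := (nonlinearity p).
Variables u a b : R -> R -> R.
Hypothesis cs : char_solution p u a b.

Let cu : continuous (fun z : R * R => u z.1 z.2). Proof. exact: cs_cont cs. Qed.
Arguments cu : clear implicits.

Lemma slice_integrable K t : 0 <= t -> mu.-integrable `[(- K)%R, K] (EFin \o a^~ t).
Proof.
move=> t0; apply: integrable_of_sqr; last exact: (cs_a2t cs K t0).
by apply: (measurableT_comp (cs_ma cs) (_ : measurable_fun setT (fun x : R => (x, t)))).
Qed.

Lemma slice_integrable_sub l r t : 0 <= t -> mu.-integrable `[l, r] (EFin \o a^~ t).
Proof.
move=> t0; apply: integrable_sub_itv (slice_integrable (`|l| + `|r|) t0).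
  have := ler_norm (- l); have := normr_ge0 r; rewrite normrN; lra.
have := ler_norm r; have := normr_ge0 l; lra.
Qed.

(** Along the characteristic [u] has derivative [a], and [a (x + s, t + s)]
    differs from [a (x + 2 s, t)], which lies on the same line [x + t =
    const], by [O (s)]. *)
Lemma char_deriv_freeze K t : 0 <= t -> exists2 C, 0 <= C &
  forall x h, `|x| <= K -> 0 <= h <= 1 ->
    `|u (x + h) (t + h) - u x t - 2^-1 * \int[mu]_(y in `[x, x + 2 * h]) a y t| <= C * h ^+ 2.
Proof.
move=> t0.
have cNu : continuous (fun z : R * R => N (u z.1 z.2)).
  by move=> z; apply: continuous_comp; [exact: (cu z)|exact: continuous_nonlinearity].
have [C C0 HC] := bounded_on_box (t + 1) (K + 2) cNu.
exists C => // x h xK /andP[h0 h1].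
have th : t <= t + h by rewrite lerDl.
have th0 : 0 <= t + h by exact: le_trans th.
have [iua uaE] := cs_ac_ua cs (x - t) th0.
have e1 : x - t + 1 * (t + h) = x + h by ring.
have e2 : x - t + 1 * t = x by ring.
have := uaE t (t + h) t0 th (lexx _); rewrite e1 e2 => ->.
have k2 : 0 < 2 :> R by [].
have e3 : 2 * t + (x - 2 * t) = x by ring.
have e4 : 2 * (t + h) + (x - 2 * t) = x + 2 * h by ring.
have ia' : mu.-integrable `[2 * t + (x - 2 * t), 2 * (t + h) + (x - 2 * t)] (EFin \o a^~ t).
  exact: slice_integrable_sub.
have := Rintegral_affine_itv k2 ia'; rewrite e3 e4 => <-.
have i2 := integrable_affine_itv k2 ia'.
rewrite RintegralZl// mulrA mulVf ?mul1r; last by rewrite gt_eqF.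
have i1 := integrable_sub_itv t0 (lexx (t + h)) iua.
rewrite -RintegralB//.
have bd s : t <= s -> s <= t + h ->
    `|a (x - t + 1 * s) s - a (2 * s + (x - 2 * t)) t| <= C * h.
  move=> ts sh; have s0 : 0 <= s by exact: le_trans ts.
  have [iN aE] := cs_ac_a cs (x - t + 2 * s) s0.
  have e5 : x - t + 2 * s + -1 * s = x - t + 1 * s by ring.
  have e6 : x - t + 2 * s + -1 * t = 2 * s + (x - 2 * t) by ring.
  have := aE t s t0 ts (lexx s); rewrite e5 e6 => ->.
  have sth : s - t <= h by rewrite lerBlDl.
  apply: (le_trans (_ : _ <= C * (s - t))); last exact: ler_wpM2l.
  have ig := integrable_sub_itv t0 (lexx s) iN.
  apply: Rintegral_itv_bound => // r tr rs; rewrite normrN.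
  have e7 : x - t + 2 * s + -1 * r = x + (s - t + (s - r)) by ring.
  have hK : `|x - t + 2 * s + -1 * r| <= K + 2.
    rewrite e7; apply: (le_trans (ler_normD _ _)); apply: lerD => //; rewrite ger0_norm; lra.
  have hr : 0 <= r <= t + 1 by apply/andP; split; lra.
  exact: (HC _ r hK hr).
apply: (le_trans (Rintegral_itv_bound _ th bd)); first exact: integrable_EFinB.
by rewrite addrAC subrr add0r expr2 mulrA.
Qed.

Lemma ac_on_parts (g g' phi phi' : R -> R) K B : ac_on (- B) B g g' ->
  test_profile phi phi' K -> K < B -> 0 <= K ->
  \int[mu]_(x in `[- B, B]) (g' x * phi x) = - \int[mu]_(x in `[- B, B]) (g x * phi' x).
Proof.
move=> gac tp KB K0.
have BB : - B <= B by lra.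
have pac : ac_on (- B) B phi phi'.
  have := ac_on_comp (tp_derive tp) (tp_cont tp) (ac_on_affine (- B) B 1 0).
  by apply: eq_ac_on => x _; rewrite mul1r addr0 ?mulr1.
have pM x : B <= `|x| -> phi x = 0 by move=> Bx; apply: (tp_supp tp); exact: lt_le_trans Bx.
have [_ h] := ac_onM gac pac.
have := h (- B) B (lexx _) BB (lexx _).
rewrite !pM ?normrN ?ler_norm// !mulr0 subrr RintegralD//; last 2 first.
- by have := ac_on_integrableM pac gac.1; apply: eq_integrable => // x _; rewrite /= mulrC.
- exact: ac_on_integrableM gac pac.1.
by move=> /esym/eqP; rewrite addr_eq0 => /eqP.
Qed.

(** By the preceding bound [u (x + h, t + h) - u (x, t)] may be replaced by
    half the increment of a primitive of [a (., t)] over [x, x + 2 h]. The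
    increment is moved onto [phi] by a translation, and the limit is
    identified by integration by parts. *)
Lemma char_quotient_cvg phi phi' K t : test_profile phi phi' K -> 0 <= K -> 0 <= t ->
  \int[mu]_x ((u (x + n.+1%:R^-1) (t + n.+1%:R^-1) - u x t) / n.+1%:R^-1 * phi x)
    @[n --> \oo] --> \int[mu]_x (a x t * phi x).
Proof.
move=> tp K0 t0; pose h n : R := n.+1%:R^-1.
have h0 n : 0 < h n by rewrite invr_gt0.
have h1 n : h n <= 1 by rewrite invf_le1// ler1n.
have [C C0 HC] := char_deriv_freeze K t0.
(* The primitive is only needed on a segment containing [x + 2 * h n] for all
   [x] in the support of [phi]; outside of it, it is extended by 0. *)
pose B := K + 3.
have ia : mu.-integrable `[- B, B] (EFin \o a^~ t) by exact: slice_integrable.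
pose g x := \int[mu]_(y in `[- B, x]) a y t.
have gac : ac_on (- B) B g (a^~ t) by exact: ac_on_primitive.
have [M M0 gM] := ac_on_bounded gac.
pose G := g \_ `[- B, B].
have GE x : `|x| <= B -> G x = g x.
  by move=> xB; rewrite /G patchE mem_setE in_itv/= -ler_norml xB.
have mG : measurable_fun setT G.
  by apply/(measurable_restrictT _ _).1 => //; exact: ac_on_measurable gac.
have GM x : `|x| <= K + 2 -> `|G x| <= M.
  move=> xK; have xB : `|x| <= B by rewrite /B; lra.
  by rewrite GE//; apply: gM; rewrite -ler_norml.
have cphi := profile_continuous tp.
have mphi : measurable_fun setT phi by exact: continuous_measurable_fun.
have iG y : `|y| <= 2 -> mu.-integrable setT (EFin \o (fun x => G (x + y) * phi x)).
  move=> y2; apply: (@integrable_mul_supported _ (fun x => G (x + y)) phi K M) => //.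
  - by apply: (measurableT_comp mG); exact: measurable_funD.
  - exact: tp_supp tp.
  - by move=> x xK; apply: GM; rewrite (le_trans (ler_normD _ _))// lerD.
have iG0 : mu.-integrable setT (EFin \o (fun x => G x * phi x)).
  apply: eq_integrable (iG 0 _) => //; last by rewrite normr0.
  by move=> x _; rewrite /= addr0.
have S : \int[mu]_x (2^-1 * ((G (x + 2 * h n) - G x) / h n) * phi x) @[n --> \oo] -->
    \int[mu]_x (a x t * phi x).
  have k2 : `|2| = 2 :> R by rewrite ger0_norm.
  have := @diff_quotient_cvg _ phi phi' K tp (fun _ x => 2^-1 * G x) (fun x => 2^-1 * G x) 2 (2^-1 * M).
  have -> : \int[mu]_x (2^-1 * G x * - (2 * phi' x)) = \int[mu]_x (a x t * phi x).
    rewrite (@Rintegral_supported _ (fun x => a x t * phi x) (- B) B); last first.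
      move=> x; rewrite -ler_norml -ltNge => Bx; rewrite (tp_supp tp) ?mulr0//.
      by apply: lt_trans Bx; rewrite /B; lra.
    rewrite (@Rintegral_supported _ _ (- B) B); last first.
      move=> x; rewrite -ler_norml -ltNge => Bx; rewrite (tp_supp' tp) ?mulr0 ?oppr0 ?mulr0//.
      by apply: lt_trans Bx; rewrite /B; lra.
    have KB : K < B by rewrite /B; lra.
    rewrite (ac_on_parts gac tp KB K0).
    have ii : mu.-integrable `[- B, B] (EFin \o (fun x => g x * phi' x)).
      apply: ac_on_integrableM gac _; apply: integrable_continuous; exact: tp_cont tp.
    transitivity (\int[mu]_(x in `[- B, B]) (-1 * (g x * phi' x))); last by rewrite RintegralZl// mulN1r.
    apply: eq_Rintegral => x; rewrite mem_setE in_itv/= -ler_norml => xB.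
    by rewrite GE//; field.
  rewrite k2; have -> : (fun n : nat => \int[mu]_x (2^-1 * G x * ((phi (x - 2 * n.+1%:R^-1) - phi x) / n.+1%:R^-1)))
     = (fun n => \int[mu]_x (2^-1 * ((G (x + 2 * h n) - G x) / h n) * phi x)).
    apply/funext => n; rewrite -/(h n).
    have hn2 : `|2 * h n| <= 2 by rewrite normrM k2 [`|h n|]ger0_norm ?(ltW (h0 n))// ler_piMr.
    have iGn := iG (2 * h n) hn2.
    have tr := Rintegral_translate (- (2 * h n)) iGn.
    have itr := integrable_translate (- (2 * h n)) iGn.
    have eqG x : G (x - 2 * h n + 2 * h n) * phi (x - 2 * h n) = G x * phi (x - 2 * h n).
      by rewrite subrK.
    transitivity (2^-1 / h n * (\int[mu]_x (G x * phi (x - 2 * h n)) - \int[mu]_x (G x * phi x))).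
      have itr' : mu.-integrable setT (EFin \o (fun x => G x * phi (x - 2 * h n))).
        by apply: eq_integrable itr => // x _; rewrite /= eqG.
      rewrite -RintegralB// -RintegralZl//; last exact: integrable_EFinB.
      by apply: eq_Rintegral => x _; ring.
    rewrite (_ : \int[mu]_x (G x * phi (x - 2 * h n)) = \int[mu]_x (G (x + 2 * h n) * phi x)); last first.
      by rewrite -tr; apply: eq_Rintegral => x _; rewrite eqG.
    rewrite -RintegralB// -RintegralZl//; last exact: integrable_EFinB.
    by apply: eq_Rintegral => x _; ring.
  apply.
  - by move=> n; exact: measurable_funM.
  - by move=> n x xK; rewrite normrM [`|2^-1|]ger0_norm ?invr_ge0// ler_pM2l ?invr_gt0//; exact: GM.
  - by move=> x xK; exact: cvg_cst.
  - exact: measurable_funM.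
  - by move=> x xK; rewrite normrM [`|2^-1|]ger0_norm ?invr_ge0// ler_pM2l ?invr_gt0//; exact: GM.
have iphi : mu.-integrable setT (EFin \o (fun x => `|phi x|)).
  have [L L0 HL] := continuous_bounded_segment K cphi.
  apply: (@integrable_supported _ _ K L).
  - by apply: measurableT_comp.
  - by move=> x /(tp_supp tp) ->; rewrite normr0.
  - by move=> x /HL; rewrite normr_id.
pose I := \int[mu]_x `|phi x|.
pose D n x := (u (x + h n) (t + h n) - u x t) / h n.
pose E n x := 2^-1 * ((G (x + 2 * h n) - G x) / h n).
have mE n : measurable_fun setT (E n).
  apply: measurable_funM => //; apply: measurable_funM => //; apply: measurable_funB => //.
  by apply: (measurableT_comp mG); exact: measurable_funD.
have cD n : continuous (D n).
  move=> x; apply: cvgM; last exact: cvg_cst.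
  apply: cvgB; last by have h' := @continuous_slice _ u t cu; exact: h'.
  apply: (@continuous2_cvg _ _ _ _ _ _ (fun x => x + h n) (cst (t + h n)) u (x + h n) (t + h n)).
  - exact: (cu (x + h n, t + h n)).
  - by apply: cvgD; [exact: cvg_id|exact: cvg_cst].
  - exact: cvg_cst.
have DE n x : `|x| <= K -> `|D n x - E n x| <= C * h n.
  move=> xK; have xB : `|x| <= B by rewrite /B; lra.
  have hn : 0 <= h n <= 1 by rewrite (ltW (h0 n))/=.
  have xhB : `|x + 2 * h n| <= B.
    apply: (le_trans (ler_normD _ _)); rewrite /B; apply: lerD => //.
    rewrite ger0_norm; have := h1 n; have := h0 n; lra.
  have xh : x <= x + 2 * h n by rewrite lerDl mulr_ge0// (ltW (h0 n)).
  have Eg : E n x = (2^-1 * \int[mu]_(y in `[x, x + 2 * h n]) a y t) / h n.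
    have /andP[lx _] : - B <= x <= B by rewrite -ler_norml.
    have /andP[_ xr] : - B <= x + 2 * h n <= B by rewrite -ler_norml.
    by rewrite /E !GE// (gac.2 x (x + 2 * h n) lx xh xr) mulrA.
  rewrite Eg /D -mulrBl normrM [X in _ * X]ger0_norm ?invr_ge0 ?(ltW (h0 n))// ler_pdivrMr//.
  by rewrite -mulrA -expr2; exact: HC.
have iE n : mu.-integrable setT (EFin \o (fun x => E n x * phi x)).
  apply: (@integrable_mul_supported _ (E n) phi K (2^-1 * ((M + M) / h n))) => //.
    exact: tp_supp tp.
  move=> x xK; rewrite /E normrM [`|2^-1|]ger0_norm ?invr_ge0// ler_pM2l ?invr_gt0//.
  rewrite normrM [X in _ * X]ger0_norm ?invr_ge0 ?(ltW (h0 n))// ler_pM2r ?invr_gt0//.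
  apply: (le_trans (ler_normB _ _)); apply: lerD; apply: GM; last by lra.
  apply: (le_trans (ler_normD _ _)); apply: lerD => //.
  rewrite ger0_norm; have := h1 n; have := h0 n; lra.
have iD n : mu.-integrable setT (EFin \o (fun x => D n x * phi x)).
  have [L L0 HL] := continuous_bounded_segment K (cD n).
  apply: (@integrable_mul_supported _ (D n) phi K L) => //; last exact: tp_supp tp.
  exact: continuous_measurable_fun (cD n).
have bound n : `|\int[mu]_x (D n x * phi x) - \int[mu]_x (E n x * phi x)| <= C * I * h n.
  rewrite -RintegralB//; apply: (le_trans (le_normr_Rintegral _ _)) => //.
    exact: integrable_EFinB.
  rewrite (mulrC _ (h n)) mulrA /I -RintegralZl//.
  apply: le_Rintegral => //.
  - by apply: integrable_norm; exact: integrable_EFinB.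
  - exact: integrable_EFinZ.
  - move=> x _; rewrite -mulrBl normrM.
    have [xK|xK] := leP `|x| K; first by apply: ler_wpM2r => //; rewrite mulrC; exact: DE.
    by rewrite (tp_supp tp xK) normr0 !mulr0.
have lim0 : \int[mu]_x (D n x * phi x) - \int[mu]_x (E n x * phi x) @[n --> \oo] --> (0 : R).
  apply/norm_cvg0P; apply: (@squeeze_cvgr _ _ _ _ (cst 0) (fun n => C * I * h n)).
  - by near=> n; rewrite normr_ge0/=; exact: bound.
  - exact: cvg_cst.
  - by rewrite -[X in _ --> X](mulr0 (C * I)); apply: cvgM; [exact: cvg_cst|exact: cvg_harmonic].
have eQ : (fun n => \int[mu]_x (D n x * phi x)) =
    (fun n => \int[mu]_x (D n x * phi x) - \int[mu]_x (E n x * phi x) + \int[mu]_x (E n x * phi x)).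
  by apply/funext => n; rewrite subrK.
by rewrite eQ -[X in _ --> X]add0r; apply: cvgD.
Unshelve. all: by end_near. Qed.

End characteristic_quotient.

Lemma eq_cvg_seq {R : realType} (s1 s2 : nat -> R) (l : R) : s1 =1 s2 ->
  s2 @ \oo --> l -> s1 @ \oo --> l.
Proof. by move=> /funext ->. Qed.

Section identification.
Context {R : realType}.
Notation mu := (@lebesgue_measure R).
Implicit Types (x t k K : R).
Variable p : R.
Hypothesis p1 : 1 < p.

Lemma integrable_mul_profile (f g : R -> R) K :
  mu.-integrable `[(- K)%R, K] (EFin \o f) -> continuous g ->
  (forall x, K < `|x| -> g x = 0) -> mu.-integrable setT (EFin \o (fun x => f x * g x)).
Proof.
move=> fi cg g0; have [M M0 HM] := continuous_bounded_segment K cg.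
have : mu.-integrable `[(- K)%R, K] (EFin \o (fun x => g x * f x)).
  apply: (integrable_EFinM _ _ _ fi) => //.
    by apply: measurable_funTS; exact: continuous_measurable_fun.
  by move=> x; rewrite /= in_itv/= -ler_norml; exact: HM.
move=> /integrable_mkcond => /(_ (measurable_itv _)); apply: eq_integrable => // x _.
rewrite patchE mem_setE in_itv/= -ler_norml; case: ifPn => [_|]; first by rewrite /= mulrC.
by rewrite -ltNge => /g0 /= ->; rewrite mulr0.
Qed.

Lemma ae_eq_of_test (f g : R -> R) : measurable_fun setT f -> measurable_fun setT g ->
  (forall K, mu.-integrable `[(- K)%R, K] (EFin \o f)) ->
  (forall K, mu.-integrable `[(- K)%R, K] (EFin \o g)) ->
  (forall phi, test_function phi -> \int[mu]_x (f x * phi x) = \int[mu]_x (g x * phi x)) ->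
  {ae mu, forall x, f x = g x}.
Proof.
move=> mf mg fi gi fg.
have : {ae mu, forall x, f x - g x = 0}.
  apply: ae_eq0_of_test.
    apply: locally_integrable_of_segments; first exact: measurable_funB.
    by move=> K; exact: integrable_EFinB.
  move=> phi tphi; have [K K0 tp] := test_profile_of_test_function tphi.
  have cphi := profile_continuous tp; have s0 := tp_supp tp.
  transitivity (\int[mu]_x (f x * phi x) - \int[mu]_x (g x * phi x)); last by rewrite fg// subrr.
  rewrite -RintegralB//; try exact: (@integrable_mul_profile _ phi K).
  by apply: eq_Rintegral => x _; rewrite mulrBl.
apply: (@filterS _ _ (ae_filter_ringOfSetsType mu)) => x /eqP.
by rewrite subr_eq0 => /eqP.
Qed.

Variables u ux ut a b : R -> R -> R.
Hypothesis hs : half_solution p u ux ut.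
Hypothesis cs : char_solution p u a b.

Let cu : continuous (fun z : R * R => u z.1 z.2). Proof. exact: hs_cont hs. Qed.

Let L2 (f : R -> R) : f \in Lfun mu 2%:E -> measurable_fun setT f /\
  forall K, mu.-integrable `[(- K)%R, K] (EFin \o f).
Proof.
move=> f2; have mf : measurable_fun setT f by move: f2; rewrite !inE => /andP[/[!inE]].
by split => // K; exact: integrable_al (Lfun2_integrable_sqr f2) _ _.
Qed.

(** The same derivative computed from the distributional derivatives of [u] in
    time and in space. *)
Lemma moving_frame_derivative phi phi' K k t : test_function phi ->
  test_profile phi phi' K -> phi' = (phi^`())%classic -> 0 <= K -> 0 <= t ->
  \int[mu]_x ((u (x + k * n.+1%:R^-1) (t + n.+1%:R^-1) - u x t) / n.+1%:R^-1 * phi x)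
   @[n --> \oo] --> \int[mu]_x ((ut x t + k * ux x t) * phi x).
Proof.
move=> tphi tp phiE K0 t0.
have q := moving_frame_quotient cu tp K0 t0 (k := k).
have d := is_derive_harmonic (hs_ut hs tphi t0).
have [mt it] := L2 (hs_ut2 hs t0); have [mx ix] := L2 (hs_ux2 hs t0).
have cphi := profile_continuous tp; have s0 := tp_supp tp.
have := cvgD q d => /(_ _).
have [_ _ /(_ phi tphi)] := hs_ux hs t0; rewrite -phiE => ->.
rewrite mulrN opprK -RintegralZl//; last exact: (@integrable_mul_profile _ phi K).
rewrite -RintegralD//; last 2 first.
- by apply: integrable_EFinZ => //; exact: (@integrable_mul_profile _ phi K).
- exact: (@integrable_mul_profile _ phi K).
rewrite (_ : \int[mu]_x (k * (ux x t * phi x) + ut x t * phi x) =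
  \int[mu]_x ((ut x t + k * ux x t) * phi x)); last by apply: eq_Rintegral => x _; ring.
by apply: eq_cvg_seq => n; rewrite /GRing.add/= subrK.
Qed.

Lemma right_identification t : 0 <= t -> {ae mu, forall x, a x t = ut x t + ux x t}.
Proof.
move=> t0; have [mt it] := L2 (hs_ut2 hs t0); have [mx ix] := L2 (hs_ux2 hs t0).
apply: ae_eq_of_test.
- by apply: (measurableT_comp (cs_ma cs) (_ : measurable_fun setT (fun x : R => (x, t)))).
- exact: measurable_funD.
- by move=> K; exact: (slice_integrable cs).
- by move=> K; exact: integrable_EFinD.
move=> phi tphi; have [K K0 tp] := test_profile_of_test_function tphi.
have h1 := char_quotient_cvg p1 cs tp K0 t0.
have h2 := moving_frame_derivative (k := 1) tphi tp erefl K0 t0.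
transitivity (\int[mu]_x ((ut x t + 1 * ux x t) * phi x)); last first.
  by apply: eq_Rintegral => x _; rewrite mul1r.
have := @cvg_unique _ (@Rhausdorff R) _ _ _ _ h1; apply.
apply: eq_cvg_seq h2 => n; by apply: eq_Rintegral => x _; rewrite mul1r.
Qed.

(** The preceding comparison for the reflected characteristic solution and the
    reflected test function, with [k = -1] in the moving frame. *)
Lemma left_identification t : 0 <= t -> {ae mu, forall x, b x t = ut x t - ux x t}.
Proof.
move=> t0; have [mt it] := L2 (hs_ut2 hs t0); have [mx ix] := L2 (hs_ux2 hs t0).
have mb : measurable_fun setT (b^~ t).
  by apply: (measurableT_comp (cs_mb cs) (_ : measurable_fun setT (fun x : R => (x, t)))).
have ib K : mu.-integrable `[(- K)%R, K] (EFin \o b^~ t).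
  by apply: integrable_of_sqr => //; exact: (cs_b2t cs K t0).
apply: ae_eq_of_test => //.
- exact: measurable_funB.
- by move=> K; exact: integrable_EFinB.
move=> phi tphi; have [K K0 tp] := test_profile_of_test_function tphi.
have cphi := profile_continuous tp; have s0 := tp_supp tp.
have h1 := char_quotient_cvg p1 (char_solution_reflect cs) (test_profile_reflect tp) K0 t0.
have h2 := moving_frame_derivative (k := -1) tphi tp erefl K0 t0.
transitivity (\int[mu]_x ((ut x t + -1 * ux x t) * phi x)); last first.
  by apply: eq_Rintegral => x _; rewrite mulN1r.
rewrite -(@Rintegral_reflect _ (fun x => b x t * phi x)); last exact: (@integrable_mul_profile _ phi K).
have := @cvg_unique _ (@Rhausdorff R) _ _ _ _ h1; apply.
apply: eq_cvg_seq h2 => n; pose h : R := n.+1%:R^-1.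
have cD : continuous (fun x => (u (x + -1 * h) (t + h) - u x t) / h).
  move=> x; apply: cvgM; last exact: cvg_cst.
  apply: cvgB; last by have h' := @continuous_slice _ u t cu; exact: h'.
  apply: (@continuous2_cvg _ _ _ _ _ _ (fun x => x + -1 * h) (cst (t + h)) u (x + -1 * h) (t + h)).
  - by have h' := hs_cont hs; exact: (h' (x + -1 * h, t + h)).
  - by apply: cvgD; [exact: cvg_id|exact: cvg_cst].
  - exact: cvg_cst.
rewrite -(@Rintegral_reflect _ (fun x => (u (x + -1 * h) (t + h) - u x t) / h * phi x)).
  by apply: eq_Rintegral => x _; rewrite opprD mulN1r.
by apply: (@integrable_mul_profile _ phi K) => //; exact: integrable_continuous.
Qed.

End identification.

(** * Solutions on the two half-lines of time *)

Lemma Rintegral_opp {R : realType} (f : R -> R) (D : set R) : measurable D ->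
  (@lebesgue_measure R).-integrable D (EFin \o f) ->
  \int[@lebesgue_measure R]_(x in D) (- f x) = - (\int[@lebesgue_measure R]_(x in D) f x).
Proof.
move=> mD fi; transitivity (\int[@lebesgue_measure R]_(x in D) (-1 * f x)).
  by apply: eq_Rintegral => x _; rewrite mulN1r.
by rewrite RintegralZl// mulN1r.
Qed.

Section half_line_solutions.
Context {R : realType}.
Notation mu := (@lebesgue_measure R).
Implicit Types (x t k K : R).
Variable p : R.
Hypothesis p1 : 1 < p.
Notation N := (nonlinearity p).
Notation F := (potential p).
Variables (u0 u1 : R -> R) (u ux ut : R -> R -> R).
Hypothesis sol : finite_energy_solution p u0 u1 u ux ut.

Let cu : continuous (fun z : R * R => u z.1 z.2). Proof. exact: sol_continuous sol. Qed.
Arguments cu : clear implicits.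

Let L2 (f : R -> R) : f \in Lfun mu 2%:E -> measurable_fun setT f /\
  forall l r, mu.-integrable `[l, r] (EFin \o f).
Proof.
move=> f2; have mf : measurable_fun setT f by move: f2; rewrite !inE => /andP[/[!inE]].
by split => // l r; exact: integrable_al (Lfun2_integrable_sqr f2) _ _.
Qed.

Let data1 l r : \int[mu]_(y in `[l, r]) u1 y = \int[mu]_(y in `[l, r]) ut y 0.
Proof.
have [m1 i1] := L2 (data_L2 sol); have [mt it] := L2 ((sol_ut_L2 sol).1 0).
rewrite /Rintegral; congr fine; apply: ae_eq_integral => //.
- by apply/measurable_EFinP; exact: measurable_funTS.
- by apply/measurable_EFinP; exact: measurable_funTS.
- by apply: (@filterS _ _ (ae_filter_ringOfSetsType mu) _ _ _ (sol_init1 sol)) => x /= -> _.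
Qed.

Let F0 : mu.-integrable setT (fun x => (F (u x 0))%:E).
Proof.
have p1' : (1%:E <= (p + 1)%:E)%E by rewrite lee_fin; have := p1; lra.
have := Lfun_integrable p1' (data_Lp sol) => i0.
have := integrable_EFinZ measurableT (p + 1)^-1 i0.
by apply: eq_integrable => // x _; rewrite /= (sol_init0 sol).
Qed.

Let orient l r (f : R -> R) : l <= r -> oriented_integral l r f = \int[mu]_(x in `[l, r]) f x.
Proof. by rewrite /oriented_integral => ->. Qed.

Let orientN l r (f : R -> R) : l <= r -> oriented_integral r l f = - \int[mu]_(x in `[l, r]) f x.
Proof.
rewrite /oriented_integral; case: ifPn => // rl lr; have -> : l = r by apply/eqP; rewrite eq_le lr.
by rewrite set_itv1 !Rintegral_set1 oppr0.
Qed.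

Lemma forward_half_solution : half_solution p u ux ut.
Proof.
split.
- exact: cu.
- by move=> t _; exact: sol_ux sol t.
- by move=> phi tphi t _; exact: sol_ut sol phi tphi t.
- by move=> t _; exact: (sol_ux_L2 sol).1.
- by move=> t _; exact: (sol_ut_L2 sol).1.
- exact: F0.
- move=> x t t0; rewrite (sol_dalembert sol x t) !(sol_init0 sol).
  rewrite orient; last by lra.
  rewrite data1 orient//; congr (_ - 2^-1 * _).
  apply: eq_Rintegral => s; rewrite mem_setE in_itv/= => /andP[s0 st].
  by rewrite orient//; lra.
Qed.

Let cNu : continuous (fun z : R * R => N (u z.1 z.2)).
Proof. by move=> z; apply: continuous_comp; [exact: (cu z)|exact: continuous_nonlinearity]. Qed.
Arguments cNu : clear implicits.

Let cone_section x t s := \int[mu]_(y in `[x - t - s, x + t + s]) N (u y s).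

(** The section is bounded; its measurability in time comes from writing the
    section as an integral over a segment starting at 0. *)
Let integrable_cone_section x t : 0 <= t ->
  mu.-integrable `[(- t)%R, (- 0)%R] (EFin \o cone_section x t).
Proof.
move=> t0; have [C C0 HC] : exists2 C, 0 <= C & forall y s, `|y| <= `|x| + t -> `|s| <= t ->
    `|N (u y s)| <= C.
  have : compact ((fun z : R * R => N (u z.1 z.2)) @` (`[(- (`|x| + t))%R, `|x| + t] `*` `[(- t)%R, t])).
    apply: continuous_compact; first exact: continuous_subspaceT.
    by apply: compact_setX; exact: segment_compact.
  move=> /compact_bounded [M [_ HM]]; exists (`|M| + 1); first by rewrite addr_ge0.
  move=> y s yK st; apply: (HM (`|M| + 1)).
    by rewrite (le_lt_trans (ler_norm M))// ltrDl.
  by exists (y, s) => //; split; rewrite /= in_itv/= -ler_norml.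
have iN (s l r : R) : mu.-integrable `[l, r] (EFin \o (fun y => N (u y s))).
  by apply: integrable_continuous; exact: (@continuous_slice _ (fun y s => N (u y s)) s cNu).
have cE s : cone_section x t s = \int[mu]_(w in `[0, 2 * (t + s)]) N (u (x - t - s + w) s).
  have k0 : 0 < 1 :> R by [].
  have := @Rintegral_affine_itv _ 1 (x - t - s) 0 (2 * (t + s)) (fun y => N (u y s)) k0 (iN _ _ _).
  rewrite mul1r add0r (_ : 1 * (2 * (t + s)) + (x - t - s) = x + t + s); last by ring.
  by rewrite /cone_section => <-; apply: eq_Rintegral => w _; rewrite !mul1r [x - t - s + w]addrC.
have mc : measurable_fun setT (cone_section x t).
  pose h (w : (R * R) * R) := N (u (x - t - w.1.1 + w.2) w.1.1).
  have mh : measurable_fun setT h.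
    apply: (measurableT_comp (continuous_plane_measurable cNu) (_ : measurable_fun setT
      (fun w : (R * R) * R => (x - t - w.1.1 + w.2, w.1.1)))).
    have m11 : measurable_fun [set: (R * R) * R] (fun w : (R * R) * R => w.1.1).
      by apply: (measurableT_comp measurable_fst); exact: measurable_fst.
    apply/measurable_fun_pairP; split => //=; apply: measurable_funD; last exact: measurable_snd.
    exact: measurable_funB.
  have := measurable_parametric mh => /measurableT_comp.
  move=> /(_ _ _ _ (fun s => (s, 2 * (t + s)))) hm.
  rewrite (_ : cone_section x t = (fun z : R * R => \int[mu]_(s in `[0, z.2]) h (z, s)) \o
    (fun s => (s, 2 * (t + s)))); last by apply/funext => s; rewrite cE.
  apply: hm; apply/measurable_fun_pairP; split; rewrite /comp/=; first exact: measurable_id.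
  by apply: measurable_funM => //; exact: measurable_funD.
apply: (@integrable_EFin_le _ _ _ mu _ _ _ (cst (C * (2 * t)))) => //.
- exact: measurable_funTS.
- move=> s /=; rewrite in_itv/= oppr0 => /andP[ts s0].
  apply: (le_trans (Rintegral_itv_bound (C := C) (iN s _ _) _ _)); first by lra.
    move=> y y1 y2; apply: HC; last by rewrite ler_norml; lra.
    have := ler_norm x; have := ler_norm (- x); rewrite normrN ler_norml; lra.
  by apply: ler_wpM2l => //; lra.
- exact: integrable_continuous (@cst_continuous _ _ _).
Qed.

(** For negative times both oriented integrals in d'Alembert's formula change
    sign, and so does the velocity: the double integral keeps its sign and the
    velocity term is that of the reversed solution. *)
Lemma backward_half_solution :
  half_solution p (fun x t => u x (- t)) (fun x t => ux x (- t)) (fun x t => - ut x (- t)).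
Proof.
split.
- move=> z; apply: (@continuous2_cvg _ _ _ _ _ _ fst (fun z => - z.2) u z.1 (- z.2)).
  + exact: (cu (z.1, - z.2)).
  + exact: cvg_fst.
  + by apply: cvgN; exact: cvg_snd.
- by move=> t _; exact: sol_ux sol (- t).
- move=> phi tphi t _.
  have [K K0 tp] := test_profile_of_test_function tphi.
  have dx : is_derive t (1 : R) (fun y : R => - y) (- 1) by exact: is_deriveNid.
  have := is_derive1_comp (f := fun s => \int[mu]_x (u x s * phi x)) (g := fun y => - y)
    (sol_ut sol tphi (- t)) dx.
  move/is_derive_eq; apply; rewrite mulrN1 -Rintegral_opp//.
    by apply: eq_Rintegral => x _; ring.
  have [mt it] := L2 ((sol_ut_L2 sol).1 (- t)).
  by apply: (@integrable_mul_profile _ _ phi K) => //; [exact: profile_continuous tp|exact: tp_supp tp].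
- by move=> t _; exact: (sol_ux_L2 sol).1.
- move=> t _; have := @Lfun_scale _ _ _ mu _ (-1) 2 _ ((sol_ut_L2 sol).1 (- t)).
  rewrite (_ : _ \o* _ = (fun x => - ut x (- t))); last by apply/funext => x /=; rewrite mulrN1.
  by apply; rewrite ler1n.
- by rewrite oppr0; exact: F0.
- move=> x t; rewrite le_eqVlt => /predU1P[<-|t0].
    by rewrite !(oppr0, addr0) !set_itv1 !Rintegral_set1; field.
  have t0' := ltW t0.
  rewrite oppr0 (sol_dalembert sol x (- t)) !(sol_init0 sol) opprK.
  rewrite orientN; last by lra.
  rewrite orientN; last by lra.
  have -> : \int[mu]_(y in `[x - t, x + t]) - ut y 0 = - \int[mu]_(y in `[x - t, x + t]) u1 y.
    have [mt it] := L2 ((sol_ut_L2 sol).1 0).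
    by rewrite data1 Rintegral_opp.
  have -> : \int[mu]_(s in `[- t, 0]) oriented_integral (x + t + s) (x - t - s)
       (fun y => `|u y s| `^ (p - 1) * u y s) = - \int[mu]_(s in `[0, t])
       \int[mu]_(y in `[x - t + s, x + t - s]) N (u y (- s)).
    have ic := integrable_cone_section x t0'.
    rewrite (_ : \int[mu]_(s in `[0, t]) \int[mu]_(y in `[x - t + s, x + t - s]) N (u y (- s)) =
      \int[mu]_(s in `[0, t]) cone_section x t (- s)); last first.
      by apply: eq_Rintegral => s _; rewrite /cone_section opprK.
    rewrite (Rintegral_reflect_itv ic) oppr0 -Rintegral_opp//; last by rewrite oppr0 in ic.
    apply: eq_Rintegral => s; rewrite mem_setE in_itv/= => /andP[s0 st].
    by rewrite orientN//; lra.
  by rewrite addrC [u0 _ + u0 _]addrC; ring.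
Qed.

End half_line_solutions.

(** * Conclusion *)

Section half_line_limits.
Context {R : realType}.
Notation mu := (@lebesgue_measure R).
Implicit Types (x t : R).
Variable p : R.
Hypothesis p1 : 1 < p.
Variables u ux ut : R -> R -> R.
Hypothesis hs : half_solution p u ux ut.

Definition right_density x t : R :=
  4^-1 * `|ux x t + ut x t| ^+ 2 + (2 * (p + 1))^-1 * `|u x t| `^ (p + 1).
Definition left_density x t : R :=
  4^-1 * `|ux x t - ut x t| ^+ 2 + (2 * (p + 1))^-1 * `|u x t| `^ (p + 1).
Definition energy_density x t : R :=
  2^-1 * `|ux x t| ^+ 2 + 2^-1 * `|ut x t| ^+ 2 + (p + 1)^-1 * `|u x t| `^ (p + 1).

Let p10 : 0 < p + 1. Proof. by have := p1; lra. Qed.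

Let mslice t : 0 <= t -> [/\ measurable_fun setT (u^~ t), measurable_fun setT (ux^~ t) &
  measurable_fun setT (ut^~ t)].
Proof.
move=> t0; split.
- by apply: continuous_measurable_fun; exact: continuous_slice (hs_cont hs).
- by have := hs_ux2 hs t0; rewrite !inE => /andP[/[!inE]].
- by have := hs_ut2 hs t0; rewrite !inE => /andP[/[!inE]].
Qed.

Lemma right_density_ge0 x t : 0 <= right_density x t.
Proof.
by rewrite /right_density addr_ge0// mulr_ge0// ?powR_ge0// ?invr_ge0// ?mulr_ge0// ltW.
Qed.

Lemma left_density_ge0 x t : 0 <= left_density x t.
Proof.
by rewrite /left_density addr_ge0// mulr_ge0// ?powR_ge0// ?invr_ge0// ?mulr_ge0// ltW.
Qed.

Let mpow t : 0 <= t -> measurable_fun setT (fun x => `|u x t| `^ (p + 1)).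
Proof.
move=> t0; have [mu_ _ _] := mslice t0.
by apply: (measurableT_comp (@measurable_powR _ (p + 1))); exact: measurableT_comp.
Qed.

Lemma measurable_right_density t : 0 <= t -> measurable_fun setT (right_density^~ t).
Proof.
move=> t0; have [_ mx mt] := mslice t0; have mp := mpow t0.
apply: measurable_funD; apply: measurable_funM => //.
by apply: measurable_funX; apply: measurableT_comp => //; exact: measurable_funD.
Qed.

Lemma measurable_left_density t : 0 <= t -> measurable_fun setT (left_density^~ t).
Proof.
move=> t0; have [_ mx mt] := mslice t0; have mp := mpow t0.
apply: measurable_funD; apply: measurable_funM => //.
by apply: measurable_funX; apply: measurableT_comp => //; exact: measurable_funB.
Qed.

Let cs := char_solution_of_half p1 hs.

Let alg1 (x y : R) : x / 4 + (p + 1)^-1 * y / 2 = 4^-1 * x + (2 * (p + 1))^-1 * y.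
Proof. by rewrite invfM; ring. Qed.

Let msl (H : R -> R -> R) t : measurable_fun [set: R * R] (fun z : R * R => H z.1 z.2) ->
  measurable_fun setT (H^~ t).
Proof.
by move=> mH; apply: (measurableT_comp mH (_ : measurable_fun setT (fun x : R => (x, t)))).
Qed.

Let menergy (v a b : R -> R -> R) t : char_solution p v a b -> measurable_fun setT (energy_plus p v a ^~ t).
Proof.
move=> c; have ma := msl t (cs_ma c).
have mv : measurable_fun setT (v^~ t).
  by apply: continuous_measurable_fun; exact: continuous_slice (cs_cont c).
apply: measurable_funD; apply: measurable_funM => //; first exact: measurable_funX.
apply: measurable_funM => //.
by apply: (measurableT_comp (@measurable_powR _ (p + 1))); exact: measurableT_comp.
Qed.

(** The limit of the characteristic system, in which [a] is replaced by [u_t +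
    u_x] almost everywhere at each time. *)
Lemma right_density_limit c : 0 < c -> c < 1 ->
  (\int[mu]_(x in `[(- (c * t))%R, +oo[) (right_density x t)%:E)%E @[t --> +oo] --> 0%E.
Proof.
move=> c0 c1; apply: cvg_trans (energy_limit p1 cs c0 c1); apply: near_eq_cvg.
near=> t; have t0 : 0 <= t by near: t; exact: nbhs_pinfty_ge.
apply: ae_eq_integral => //.
- by apply: measurable_funTS; apply/measurable_EFinP; exact: menergy cs.
- by apply: measurable_funTS; apply/measurable_EFinP; exact: measurable_right_density.
apply: (@filterS _ _ (ae_filter_ringOfSetsType mu) _ _ _ (right_identification p1 hs cs t0)) => x /= e _.
congr EFin; rewrite /energy_plus e /potential alg1 /right_density real_normK ?num_real//.
by congr (4^-1 * _ + _); ring.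
Unshelve. all: by end_near. Qed.

Lemma left_density_limit c : 0 < c -> c < 1 ->
  (\int[mu]_(x in `]-oo, (c * t)%R]) (left_density x t)%:E)%E @[t --> +oo] --> 0%E.
Proof.
move=> c0 c1; have cs' := char_solution_reflect cs.
apply: cvg_trans (energy_limit p1 cs' c0 c1); apply: near_eq_cvg.
near=> t; have t0 : 0 <= t by near: t; exact: nbhs_pinfty_ge.
pose d x := left_deriv p u ux ut x t ^+ 2 / 4 + potential p (u x t) / 2.
have md : measurable_fun setT d.
  have mb := msl t (cs_mb cs); have mp := mpow t0.
  apply: measurable_funD; apply: measurable_funM => //; first exact: measurable_funX.
  exact: measurable_funM.
transitivity (\int[mu]_(x in `]-oo, (c * t)%R]) (d x)%:E)%E.
  rewrite [LHS]integral_mkcond [RHS]integral_mkcond.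
  rewrite -[RHS]ge0_integral_reflect; last 2 first.
  - by apply/(measurable_restrictT _ _).1 => //; apply: measurable_funTS; exact/measurable_EFinP.
  - move=> x; rewrite patchE; case: ifP => // _; rewrite lee_fin addr_ge0// mulr_ge0// ?sqr_ge0//.
    exact: potential_ge0.
  apply: eq_integral => x _; rewrite !patchE !mem_setE !in_itv/= andbT.
  by rewrite lerNl.
apply: ae_eq_integral => //.
- by apply: measurable_funTS; exact/measurable_EFinP.
- by apply: measurable_funTS; apply/measurable_EFinP; exact: measurable_left_density.
apply: (@filterS _ _ (ae_filter_ringOfSetsType mu) _ _ _ (left_identification p1 hs cs t0)) => x /= e _.
congr EFin; rewrite /d e /potential alg1 /left_density real_normK ?num_real//.
by congr (4^-1 * _ + _); ring.
Unshelve. all: by end_near. Qed.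

Lemma energy_density_split x t : energy_density x t = left_density x t + right_density x t.
Proof.
rewrite /energy_density /left_density /right_density !real_normK ?num_real//.
rewrite invfM; move: (p + 1)^-1 (_ `^ _) => q y; by field.
Qed.

(** On the segment the energy density is the sum of the two others, each of
    which is integrated over a larger half-line. *)
Lemma energy_density_limit c : 0 < c -> c < 1 ->
  (\int[mu]_(x in `[(- (c * `|t|))%R, (c * `|t|)%R]) (energy_density x t)%:E)%E @[t --> +oo] --> 0%E.
Proof.
move=> c0 c1;
have lr : (\int[mu]_(x in `]-oo, (c * t)%R]) (left_density x t)%:E +
  \int[mu]_(x in `[(- (c * t))%R, +oo[) (right_density x t)%:E)%E @[t --> +oo] --> 0%E.
  rewrite -[X in _ --> X](adde0 0%E).
  by apply: cvgeD => //; [exact: left_density_limit|exact: right_density_limit].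
apply: (squeeze_cvge _ (cvg_cst 0%E) lr); near=> t.
have t0 : 0 <= t by near: t; exact: nbhs_pinfty_ge.
have ml := measurable_left_density t0; have mr := measurable_right_density t0.
rewrite ger0_norm//; apply/andP; split.
  by apply: integral_ge0 => x _; rewrite lee_fin energy_density_split addr_ge0// ?left_density_ge0// right_density_ge0.
rewrite (_ : \int[mu]_(x in `[(- (c * t))%R, (c * t)%R]) (energy_density x t)%:E =
  \int[mu]_(x in `[(- (c * t))%R, (c * t)%R]) ((left_density x t)%:E + (right_density x t)%:E))%E; last first.
  by apply: eq_integral => x _; rewrite energy_density_split.
rewrite ge0_integralD//; last 4 first.
- by move=> x _; rewrite lee_fin left_density_ge0.
- by apply: measurable_funTS; exact/measurable_EFinP.
- by move=> x _; rewrite lee_fin right_density_ge0.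
- by apply: measurable_funTS; exact/measurable_EFinP.
apply: leeD; apply: ge0_subset_integral => //.
- by apply: measurable_funTS; exact/measurable_EFinP.
- by move=> x _; rewrite lee_fin left_density_ge0.
- by move=> x; rewrite /= !in_itv/= => /andP[_].
- by apply: measurable_funTS; exact/measurable_EFinP.
- by move=> x _; rewrite lee_fin right_density_ge0.
- by move=> x; rewrite /= !in_itv/= andbT => /andP[].
Unshelve. all: by end_near. Qed.

End half_line_limits.

Theorem theorem2p1 (R : realType) (p : R) (hp : 1 < p) (u0 u1 : R -> R)
    (u ux ut : R -> R -> R) (hu : finite_energy_solution p u0 u1 u ux ut)
    (c : R) (hc0 : 0 < c) (hc1 : c < 1) :
  [/\ (\int[@lebesgue_measure R]_(x in `]-oo, (c * t)%R])
         (4^-1 * `|ux x t - ut x t| ^+ 2 +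
          (2 * (p + 1))^-1 * `|u x t| `^ (p + 1))%R%:E)%E
        @[t --> +oo] --> 0%E,
      (\int[@lebesgue_measure R]_(x in `[(- (c * t))%R, +oo[)
         (4^-1 * `|ux x t + ut x t| ^+ 2 +
          (2 * (p + 1))^-1 * `|u x t| `^ (p + 1))%R%:E)%E
        @[t --> +oo] --> 0%E,
      (\int[@lebesgue_measure R]_(x in `[(- (c * `|t|))%R, (c * `|t|)%R])
         (2^-1 * `|ux x t| ^+ 2 + 2^-1 * `|ut x t| ^+ 2 +
          (p + 1)^-1 * `|u x t| `^ (p + 1))%R%:E)%E
        @[t --> +oo] --> 0%E &
      (\int[@lebesgue_measure R]_(x in `[(- (c * `|t|))%R, (c * `|t|)%R])
         (2^-1 * `|ux x t| ^+ 2 + 2^-1 * `|ut x t| ^+ 2 +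
          (p + 1)^-1 * `|u x t| `^ (p + 1))%R%:E)%E
        @[t --> -oo] --> 0%E].
Proof.
have fwd := forward_half_solution hp hu; have bwd := backward_half_solution hp hu.
split.
- exact: (left_density_limit hp fwd hc0 hc1).
- exact: (right_density_limit hp fwd hc0 hc1).
- exact: (energy_density_limit hp fwd hc0 hc1).
have h := energy_density_limit hp bwd hc0 hc1.
apply/cvgNy_compNP; apply: cvg_trans h; apply: near_eq_cvg; near=> t.
rewrite /= normrN; apply: eq_integral => x _.
by rewrite /energy_density normrN.
Unshelve. all: by end_near. Qed.
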